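(* Let $u\in B_{p_0}$ for some $p_0>1$ satisfy conditions C1 and C2, and let $r\in(0,1)$. Let $h:\mathbb R^+\to\mathbb R^+$ be a continuous increasing convex function. Let $\mu$ be a positive Borel measure on $\mathbb D$ such that the Toeplitz operator $T_\mu:A^2_u\to A^2_u$ is compact. Then $T_\mu\in S_h(A^2_u)$ if and only if there is a constant $C>0$ such that $$\int_{\mathbb D}h\left(C\,\widetilde{\mu_2}(z)\right)u(\Delta(z,r))^{-1}u(z)\,dA(z)<\infty.$$
   Context: $\mathbb D$ is the open unit disk and $dA$ is normalized Lebesgue area measure. A weight is a locally integrable $u:\mathbb D\to(0,\infty)$; $u(E)=\int_Eu\,dA$. $A^2_u$ is the Hilbert space of analytic $f$ on $\mathbb D$ with $\|f\|_{A^2_u}^2=\int_{\mathbb D}|f|^2u\,dA<\infty$, inner product $\int f\bar g\,u\,dA$ and reproducing kernel $K(z,w)$; $K_z=K(\cdot,z)$. $\Delta(z,r)=\{w\in\mathbb D:\left|\frac{z-w}{1-\bar wz}\right|<r\}$. $\mathbb R^+=[0,\infty)$. Toeplitz operator: $T_\mu f(z)=\int_{\mathbb D}f(w)K(z,w)\,d\mu(w)$, where by standing convention $\mu$ is finite and $\int_{\mathbb D}|K(\xi,z)|^2\,d\mu(\xi)<\infty$ for all $z\in\mathbb D$. The 2-Berezin transform is $\widetilde{\mu_2}(z)=\int_{\mathbb D}|k_z(w)|^2\,d\mu(w)$ with $k_z=K_z/\|K_z\|_{A^2_u}$. For a continuous increasing $h:\mathbb R^+\to\mathbb R^+$ and a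 compact operator $T$ on a Hilbert space $H$ with singular values $\lambda_n(T)$, $n\geq 1$, $T\in S_h(H)$ means that there is $C>0$ with $\sum_{n=1}^\infty h(C\lambda_n(T))<\infty$. Class $B_p$ ($p>1$, $1/p+1/p'=1$): with $S(a)=\left\{\frac{a-z}{1-\bar az}:z\in\mathbb D,\ \mathrm{Re}(\bar az)\le0\right\}$ and $\langle f\rangle_E=\frac1{A(E)}\int_Ef\,dA$, $u\in B_p$ iff $\sup_{a\in\mathbb D}\langle u\rangle_{S(a)}\left(\langle u^{-p'/p}\rangle_{S(a)}\right)^{p-1}<\infty$. Condition C1: there is $L>0$ with $(1-|z|^2)|\nabla(\log u)(z)|\le L$ for all $z\in\mathbb D$. Condition C2: there are $b\ge a>0$ with $\frac a{(1-|z|^2)^2}\le-\Delta(\log u)(z)\le\frac b{(1-|z|^2)^2}$ for all $z\in\mathbb D$ ($\Delta$ the Euclidean Laplacian). *)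

(* Defs.v *)
From HB Require Import structures.
From mathcomp Require Import all_boot all_order all_algebra.
From mathcomp Require Import complex.
From mathcomp Require Import all_classical all_reals all_analysis.

Set Implicit Arguments.
Unset Strict Implicit.
Unset Printing Implicit Defensive.

Import Order.TTheory GRing.Theory Num.Theory.
Import numFieldNormedType.Exports.
Import ComplexField.Normc.

Local Open Scope classical_set_scope.
Local Open Scope ring_scope.
Local Open Scope complex_scope.

(* R[i]^o rather than R[i]: it carries the topology of the complex field and
   the scaling by complex numbers. *)
Notation Cplx R := (R[i]^o).

(* Measures live on R * R, whose product sigma-algebra is the Borel one;
   integrands are functions of a complex variable composed with [pt]. *)
Notation plane R := (measurableTypeR R * measurableTypeR R)%type.

Section hilbert.
Context {R : realType}.
Local Notation C := (Cplx R).

(* A complex inner product space is given by a carrier H in a vector space V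
   and a form ip on H, linear in its first argument. *)
Context {V : lmodType C}.
Implicit Types (H : set V) (ip : V -> V -> C) (T S : V -> V).

Definition hnorm ip (f : V) : R := Num.sqrt (complex.Re (ip f f)).

Definition linear_op H T : Prop :=
  (forall f, H f -> H (T f)) /\
  (forall (a : C) f g, H f -> H g -> T (a *: f + g) = a *: T f + T g).

Definition compact_op H ip T : Prop :=
  linear_op H T /\
  forall (f : nat -> V) (M : R),
    (forall n, H (f n)) -> (forall n, hnorm ip (f n) <= M) ->
    exists (phi : nat -> nat) (g : V),
      [/\ {homo phi : m n / (m < n)%N}, H g &
          (fun n => hnorm ip (T (f (phi n)) - g)) @ \oo --> (0 : R)].

Definition adjoint H ip T S : Prop :=
  linear_op H S /\ forall f g, H f -> H g -> ip (T f) g = ip f (S g).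

(* s lists the eigenvalues of |T| = sqrt (T^* T) in nonincreasing order,
   repeated according to multiplicity and padded with zeros: for each
   lambda > 0, the e n with s n = lambda form an orthonormal basis of the
   lambda^2-eigenspace of T^* T.  Indices start at 0. *)
Definition singular_values H ip T (s : nat -> R) : Prop :=
  [/\ forall n, 0 <= s n,
      forall m n, (m <= n)%N -> s n <= s m &
  exists Tstar, adjoint H ip T Tstar /\
  exists e : nat -> V,
    [/\ forall n, 0 < s n -> H (e n),
        forall m n, 0 < s m -> 0 < s n -> ip (e m) (e n) = (m == n)%:R,
        forall n, 0 < s n -> Tstar (T (e n)) = ((s n ^+ 2)%:C : C) *: e n &
        forall (lambda : R) (f : V), 0 < lambda -> H f ->
          Tstar (T f) = ((lambda ^+ 2)%:C : C) *: f ->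
          exists (N : nat) (c : nat -> C),
            f = \sum_(0 <= n < N | s n == lambda) c n *: e n]].

Definition schatten_h (h : R -> R) H ip T : Prop :=
  exists2 s : nat -> R, singular_values H ip T s &
  exists2 c : R, 0 < c & (\sum_(0 <= n <oo) (h (c * s n)%R)%:E < +oo)%E.

End hilbert.

Section disk.
Context {R : realType}.
Local Notation C := (Cplx R).

Definition pt (p : plane R) : C := (p.1 : R) +i* (p.2 : R).

Definition disk : set C := [set z | normc z < 1].

Fact pi_inv_ge0 : 0 <= (pi : R)^-1.
Proof. by rewrite invr_ge0 pi_ge0. Qed.

Definition area := mscale (NngNum pi_inv_ge0)
  (@lebesgue_measure R \x @lebesgue_measure R)%E.

Definition intR (m : {measure set (plane R) -> \bar R}) (E : set C)
    (f : C -> R) : R :=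
  Rintegral m (pt @^-1` E) (f \o pt).

Definition intE (m : {measure set (plane R) -> \bar R}) (E : set C)
    (f : C -> R) : \bar R :=
  (\int[m]_(p in pt @^-1` E) (f (pt p))%:E)%E.

Definition intC (m : {measure set (plane R) -> \bar R}) (E : set C)
    (f : C -> C) : C :=
  intR m E (fun z => complex.Re (f z)) +i* intR m E (fun z => complex.Im (f z)).

Definition Cintegrable (m : {measure set (plane R) -> \bar R}) (E : set C)
    (f : C -> C) : Prop :=
  m.-integrable (pt @^-1` E) (fun p => (complex.Re (f (pt p)))%:E) /\
  m.-integrable (pt @^-1` E) (fun p => (complex.Im (f (pt p)))%:E).

Definition is_weight (u : C -> R) : Prop :=
  [/\ forall z, disk z -> 0 < u z,
      measurable_fun (pt @^-1` disk) (u \o pt) &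
      forall E : set C, E `<=` disk -> compact E -> (intE area E u < +oo)%E].

(* Local power series expansions. *)
Definition analytic_on (D : set C) (f : C -> C) : Prop :=
  forall z0, D z0 -> exists2 rho : R, 0 < rho & exists a : nat -> C,
    forall z, normc (z - z0) < rho ->
      series (fun n => a n * (z - z0) ^+ n : C) @ \oo --> (f z : C).

(* Functions on the disk are extended by 0, so that two elements of A2 u are
   equal as functions on C iff they agree on the disk. *)
Definition A2 (u : C -> R) : set (C -> C) := [set f |
  [/\ analytic_on disk f, forall z, ~ disk z -> f z = 0 &
      (intE area disk (fun z => normc (f z) ^+ 2 * u z)%R < +oo)%E]].

Definition A2ip (u : C -> R) (f g : C -> C) : C :=
  intC area disk (fun z => f z * conjc (g z) * (u z)%:C).

(* This determines K w z for z in the disk and all w. *)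
Definition reproducing_kernel (u : C -> R) (K : C -> C -> C) : Prop :=
  forall z, disk z -> A2 u (K^~ z) /\
    forall f, A2 u f -> f z = A2ip u f (K^~ z).

(* K (., w) vanishes off the disk for w in the disk, so toeplitz K mu f does
   too. *)
Definition toeplitz (K : C -> C -> C) (mu : {measure set (plane R) -> \bar R})
    (f : C -> C) : C -> C :=
  fun z => intC mu disk (fun w => f w * K z w).

(* Lebesgue integrals of non-integrable functions have a junk value, so
   "T_mu acts on A2 u" includes convergence of the integrals defining it. *)
Definition toeplitz_defined (u : C -> R) (K : C -> C -> C)
    (mu : {measure set (plane R) -> \bar R}) : Prop :=
  forall f z, A2 u f -> disk z -> Cintegrable mu disk (fun w => f w * K z w).

Definition berezin2 (u : C -> R) (K : C -> C -> C)
    (mu : {measure set (plane R) -> \bar R}) (z : C) : R :=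
  let k w := K w z / (hnorm (A2ip u) (K^~ z))%:C in
  intR mu disk (fun w => normc (k w) ^+ 2).

Definition pseudohyp_disk (z : C) (r : R) : set C :=
  [set w | disk w /\ normc ((z - w) / (1 - conjc w * z)) < r].

Definition carleson_region (a : C) : set C :=
  [set (a - z) / (1 - conjc a * z) |
     z in [set z | disk z /\ complex.Re (conjc a * z) <= 0]].

Definition mean (E : set C) (f : C -> R) : \bar R :=
  ((fine (area (pt @^-1` E)))^-1%:E * intE area E f)%E.

Definition Bp (p : R) (u : C -> R) : Prop :=
  let p' := (1 - p^-1)^-1 in
  (ereal_sup [set mean (carleson_region a) u *
      poweR (mean (carleson_region a) (fun z => u z `^ (- (p' / p)))%R) (p - 1)%R
      | a in disk] < +oo)%E.

Definition dx (v : C -> R) (z : C) : R :=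
  derive1 (fun x : R => v (x +i* complex.Im z)) (complex.Re z).

Definition dy (v : C -> R) (z : C) : R :=
  derive1 (fun y : R => v (complex.Re z +i* y)) (complex.Im z).

Definition derivable_x (v : C -> R) (z : C) : Prop :=
  derivable (fun x : R => v (x +i* complex.Im z)) (complex.Re z) 1.

Definition derivable_y (v : C -> R) (z : C) : Prop :=
  derivable (fun y : R => v (complex.Re z +i* y)) (complex.Im z) 1.

(* Differentiability of log u is part of the condition, since the partial
   derivatives below are total functions. *)
Definition condC1 (u : C -> R) : Prop :=
  let v z := ln (u z) in
  (forall z, disk z ->
     differentiable (fun p : R * R => v (p.1 +i* p.2))
       (complex.Re z, complex.Im z)) /\
  exists2 L : R, 0 < L & forall z, disk z ->
    (1 - normc z ^+ 2) * Num.sqrt (dx v z ^+ 2 + dy v z ^+ 2) <= L.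

(* Only the second derivatives occurring in the Laplacian are required to
   exist. *)
Definition condC2 (u : C -> R) : Prop :=
  let v z := ln (u z) in
  (forall z, disk z -> [/\ derivable_x v z, derivable_y v z,
     derivable_x (dx v) z & derivable_y (dy v) z]) /\
  exists a b : R, [/\ 0 < a, a <= b & forall z, disk z ->
    a / (1 - normc z ^+ 2) ^+ 2 <= - (dx (dx v) z + dy (dy v) z)
      <= b / (1 - normc z ^+ 2) ^+ 2].

End disk.

(* Main.v *)
Require Import Defs.
From HB Require Import structures.
From mathcomp Require Import all_boot all_order all_algebra.
From mathcomp Require Import complex.
From mathcomp Require Import all_classical all_reals all_analysis.
From mathcomp Require Import measurable_realfun.
From mathcomp Require Import ring lra.

Set Implicit Arguments.
Unset Strict Implicit.
Unset Printing Implicit Defensive.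

Import Order.TTheory GRing.Theory Num.Theory.
Import numFieldNormedType.Exports.
Import ComplexField.Normc.

Local Open Scope classical_set_scope.
Local Open Scope ring_scope.
Local Open Scope complex_scope.

(* Write d(z) = 1 - |z|^2 and V(z) = u(z) d(z)^2.  By C1, u is comparable to a
   constant on hyperbolic disks, so u(Delta(z, r)) is comparable to V(z), and
   mean values give |f(z)|^2 <= c / V(z) int |f|^2 u over a small disk around z,
   with a matching Lipschitz estimate.  Hence K(z, z) <= c / V(z); the reverse
   inequality comes from testing with powers of the partial geometric sums
   sum_i (conj(z) w)^i, whose norms are controlled by the doubling property that
   B_p gives on Carleson regions.  Near the diagonal |k_z(w)|^2 >= c / V(z).

   On the span of the kernels, which is dense, <T_mu f, f> = int |f|^2 dmu; so
   T_mu is positive and the 2-Berezin transform is <T_mu k_z, k_z>.  If the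
   eigenvalues s_n have orthonormal eigenvectors e_n, then
     mu_2(z) = sum_n s_n |e_n(z)|^2 / K(z, z)   and, by Fubini,
     s_n = <T_mu e_n, e_n> <= c int mu_2 |e_n|^2 u dA.
   Jensen's inequality for h in these two averages and
   sum_n |e_n(z)|^2 <= K(z, z) give the two implications.  If h(0) > 0 then both
   sides fail, since d^(-2) is not integrable. *)

(** * Positive forms and compact positive operators *)

(** Three difficulties shape the argument. First, [mu] is reachable only through kernels: f
    conj(K_z) is known to be integrable, |f|^2 is not. Statements on <T f, f> are therefore proved
    on the span of the kernels and carried to [A2] by boundedness of T and density. Second, the
    spectral expansion appears only in truncated form: on the complement of the first N eigenvectors
    the form is at most s_N |f|^2, and s_N -> 0 makes this remainder harmless in Jensen's
    inequality. The weights of k_z on the eigenvectors may add up to less than 1, and h(0) = 0 is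
    what absorbs the deficit. Third, the test functions must be concentrated near z although u is
    controlled only by B_p: on disks of radius of order 2^k (1 - |z|) the u-mass may grow like
    4^(kp), while the square of the N-th power of a geometric sum decays like 4^(-kN), so some
    integer N > p is taken. Local estimates for analytic functions all come from averages against
    one differentiable kernel, the squared cap; its Lipschitz dependence on the centre replaces
    derivative estimates. *)

Section complex_modulus.
Context {R : realType}.
Implicit Types z w : Cplx R.

Lemma normc_sqr z : normc z ^+ 2 = complex.Re z ^+ 2 + complex.Im z ^+ 2.
Proof. by case: z => a b; rewrite /normc sqr_sqrtr ?addr_ge0 ?sqr_ge0. Qed.

Lemma normc_ge0 z : 0 <= normc z.
Proof. by case: z => a b; exact: sqrtr_ge0. Qed.

Lemma normc_conj z : normc (conjc z) = normc z.
Proof. by case: z => a b; rewrite /normc /= sqrrN. Qed.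

Lemma mulc_conj z : z * conjc z = (normc z ^+ 2)%:C.
Proof.
rewrite normc_sqr; case: z => a b /=.
by apply/eqP; rewrite eq_complex /=; apply/andP; split; apply/eqP; ring.
Qed.

Lemma conjcM z w : conjc (z * w) = conjc z * conjc w.
Proof. exact: rmorphM. Qed.

Lemma conjcD z w : conjc (z + w) = conjc z + conjc w.
Proof. exact: rmorphD. Qed.

Lemma conjcB z w : conjc (z - w) = conjc z - conjc w.
Proof. exact: rmorphB. Qed.

Lemma normc_real (x : R) : normc (x%:C : Cplx R) = `|x|.
Proof. by rewrite /normc /= expr0n addr0 sqrtr_sqr. Qed.

Lemma normcX z n : normc (z ^+ n) = normc z ^+ n.
Proof.
elim: n => [|n IH]; first by rewrite !expr0 normc1.
by rewrite !exprS normcM IH.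
Qed.

Lemma normc_Re z : `|complex.Re z| <= normc z.
Proof.
rewrite -[leLHS]sqrtr_sqr; case: z => a b /=.
by rewrite /normc ler_wsqrtr// lerDl sqr_ge0.
Qed.

Lemma normc_Im z : `|complex.Im z| <= normc z.
Proof.
rewrite -[leLHS]sqrtr_sqr; case: z => a b /=.
by rewrite /normc ler_wsqrtr// lerDr sqr_ge0.
Qed.

Lemma normc_distC z w : normc (z - w) = normc (w - z).
Proof. by rewrite -normcN opprB. Qed.

Lemma normcD z w : normc (z + w) <= normc z + normc w.
Proof. exact: le_normcD. Qed.

Lemma normc_dist_triangle x z w : normc (z - w) <= normc (z - x) + normc (x - w).
Proof. by have := normcD (z - x) (x - w); rewrite addrA subrK. Qed.

Lemma normcB_ge z w : normc z - normc w <= normc (z - w).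
Proof. by rewrite lerBlDr; have := normcD (z - w) w; rewrite subrK. Qed.

Lemma Re_add z w : complex.Re (z + w) = complex.Re z + complex.Re w.
Proof. by case: z => ? ?; case: w. Qed.

Lemma Im_add z w : complex.Im (z + w) = complex.Im z + complex.Im w.
Proof. by case: z => ? ?; case: w. Qed.

Lemma Re_opp z : complex.Re (- z) = - complex.Re z.
Proof. by case: z. Qed.

Lemma Im_opp z : complex.Im (- z) = - complex.Im z.
Proof. by case: z. Qed.

Lemma Re_mul z w : complex.Re (z * w) =
  complex.Re z * complex.Re w - complex.Im z * complex.Im w.
Proof. by case: z => ? ?; case: w. Qed.

Lemma Im_mul z w : complex.Im (z * w) =
  complex.Re z * complex.Im w + complex.Im z * complex.Re w.
Proof. by case: z => ? ?; case: w. Qed.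

Lemma Re_conjc z : complex.Re (conjc z) = complex.Re z.
Proof. by case: z. Qed.

Lemma Im_conjc z : complex.Im (conjc z) = - complex.Im z.
Proof. by case: z. Qed.

End complex_modulus.

Section forms.
Context {R : realType} {V : lmodType (Cplx R)}.
Implicit Types (H : set V) (B : V -> V -> Cplx R).

Record hermitian_form H B : Prop := {
  hf0 : H 0;
  hfP : forall (a : Cplx R) f g, H f -> H g -> H (a *: f + g);
  hf_lin : forall (a : Cplx R) f g k, H f -> H g -> H k ->
    B (a *: f + g) k = a * B f k + B g k;
  hf_conj : forall f g, H f -> H g -> B g f = conjc (B f g) }.

Definition psd_form H B := hermitian_form H B /\
  forall f, H f -> 0 <= complex.Re (B f f).

Section hermitian.
Variables (H : set V) (B : V -> V -> Cplx R).
Hypothesis hB : hermitian_form H B.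

Lemma hfZ (a : Cplx R) f : H f -> H (a *: f).
Proof. by move=> Hf; rewrite -[_ *: _]addr0; apply: (hfP hB) => //; exact: (hf0 hB). Qed.

Lemma hfD f g : H f -> H g -> H (f + g).
Proof. by move=> Hf Hg; rewrite -[f]scale1r; apply: (hfP hB). Qed.

Lemma hfB f g : H f -> H g -> H (f - g).
Proof. by move=> Hf Hg; rewrite addrC -scaleN1r; apply: (hfP hB). Qed.

Lemma hf_linZ (a : Cplx R) f k : H f -> H k -> B (a *: f) k = a * B f k.
Proof.
move=> Hf Hk; have H0 := hf0 hB.
have B0 : B 0 k = 0.
  have := hf_lin hB 1 H0 H0 Hk; rewrite scale1r addr0 mul1r => /eqP.
  by rewrite -subr_eq subrr eq_sym => /eqP.
by rewrite -[_ *: _]addr0 (hf_lin hB)// B0 addr0.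
Qed.

Lemma hf_linD f g k : H f -> H g -> H k -> B (f + g) k = B f k + B g k.
Proof.
by move=> Hf Hg Hk; rewrite -[f in LHS]scale1r (hf_lin hB)// mul1r.
Qed.

Lemma hf_linB f g k : H f -> H g -> H k -> B (f - g) k = B f k - B g k.
Proof.
move=> Hf Hg Hk; rewrite addrC -scaleN1r (hf_lin hB)//.
by rewrite mulN1r addrC.
Qed.

Lemma hf_antilinZ (a : Cplx R) f k : H f -> H k -> B f (a *: k) = conjc a * B f k.
Proof.
move=> Hf Hk; rewrite (hf_conj hB (hfZ a Hk) Hf) (hf_linZ a Hk Hf).
by rewrite conjcM -(hf_conj hB Hk Hf).
Qed.

Lemma hf_antilinD f g k : H f -> H g -> H k -> B f (g + k) = B f g + B f k.
Proof.
move=> Hf Hg Hk; rewrite (hf_conj hB (hfD Hg Hk) Hf) (hf_linD Hg Hk Hf).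
by rewrite conjcD -(hf_conj hB Hg Hf) -(hf_conj hB Hk Hf).
Qed.

Lemma hf_antilinB f g k : H f -> H g -> H k -> B f (g - k) = B f g - B f k.
Proof.
move=> Hf Hg Hk; rewrite (hf_conj hB (hfB Hg Hk) Hf) (hf_linB Hg Hk Hf).
by rewrite conjcB -(hf_conj hB Hg Hf) -(hf_conj hB Hk Hf).
Qed.

Lemma hf_Im f : H f -> complex.Im (B f f) = 0.
Proof.
move=> Hf; have /(congr1 (@complex.Im R)) := hf_conj hB Hf Hf.
by rewrite Im_conjc; lra.
Qed.

Lemma hf_real f : H f -> B f f = (complex.Re (B f f))%:C.
Proof. by move=> /hf_Im; case: (B f f) => a b /= ->. Qed.

Lemma hf_sqrZ (a : Cplx R) f : H f ->
  complex.Re (B (a *: f) (a *: f)) = normc a ^+ 2 * complex.Re (B f f).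
Proof.
move=> Hf; rewrite (hf_linZ a Hf (hfZ a Hf)) (hf_antilinZ a Hf Hf) mulrA mulc_conj.
by rewrite Re_mul /= mul0r subr0.
Qed.

Lemma hf_sqrB_scale (c : Cplx R) f e : H f -> H e ->
  complex.Re (B (f - c *: e) (f - c *: e)) = complex.Re (B f f)
   - 2 * complex.Re (conjc c * B f e) + normc c ^+ 2 * complex.Re (B e e).
Proof.
move=> Hf He; have Hce := hfZ c He.
rewrite (hf_linB Hf Hce (hfB Hf Hce)) !hf_antilinB// !Re_add !Re_opp Re_add Re_opp.
rewrite hf_sqrZ// (hf_antilinZ c Hf He) (hf_linZ c He Hf) (hf_conj hB Hf He).
rewrite !Re_mul !Re_conjc !Im_conjc; ring.
Qed.

End hermitian.

(** The form may be degenerate: it is applied also to lambda <f, g> - <T f, g>, which vanishes on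
    top eigenvectors. The vectors f - t B(f, g) g with t real give a quadratic polynomial in t that
    stays nonnegative. *)
Lemma psd_cauchy_schwarz H B f g : psd_form H B -> H f -> H g ->
  normc (B f g) ^+ 2 <= complex.Re (B f f) * complex.Re (B g g).
Proof.
move=> [hB B0] Hf Hg.
set y := normc (B f g) ^+ 2; set x := complex.Re (B f f).
set z := complex.Re (B g g).
have y0 : 0 <= y by rewrite sqr_ge0.
have z0 : 0 <= z by exact: B0.
have x0 : 0 <= x by exact: B0.
have key t : 0 <= x - 2 * t * y + t ^+ 2 * y * z.
  have := B0 _ (hfB hB Hf (hfZ hB (t%:C * B f g) Hg)).
  rewrite (hf_sqrB_scale hB)// conjcM normcM exprMn normc_real real_normK ?num_real//.
  rewrite -/x -/z -/y conjc_real -[_ * _ * B f g]mulrA [conjc _ * _]mulrC mulc_conj -/y.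
  by rewrite Re_mul /= mul0r subr0 mulrA.
have [z_eq0|zN0] := eqVneq z 0.
  rewrite z_eq0 mulr0.
  have [->//|yN0] := eqVneq y 0.
  have yp : 0 < y by rewrite lt_neqAle eq_sym yN0.
  (* With z = 0 the polynomial is x - 2 t y, and this t makes it -1. *)
  have := key ((x + 1) / (2 * y)).
  rewrite z_eq0 mulr0 addr0.
  have -> : 2 * ((x + 1) / (2 * y)) * y = x + 1 by field.
  lra.
have zp : 0 < z by rewrite lt_neqAle eq_sym zN0.
have := key z^-1.
have -> : x - 2 * z^-1 * y + z^-1 ^+ 2 * y * z = x - y / z by field.
by rewrite subr_ge0 ler_pdivrMr.
Qed.

End forms.

(** * Rayleigh quotients and top eigenvectors of a compact positive operator *)

Section compact_positive_operators.
Context {R : realType} {V : lmodType (Cplx R)}.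
Variables (H : set V) (ip : V -> V -> Cplx R) (T : V -> V).
Hypothesis ip_psd : psd_form H ip.
Hypothesis ip_def : forall f, H f -> complex.Re (ip f f) = 0 -> f = 0.
Hypothesis T_psd : psd_form H (fun f g => ip (T f) g).
Hypothesis T_compact : compact_op H ip T.

Local Notation n2 f := (complex.Re (ip f f)).
Let ipH := ip_psd.1.
Let TH f : H f -> H (T f). Proof. by case: T_compact => -[+ _] _; apply. Qed.
Let H0 : H 0 := hf0 ipH.

Let n2_ge0 f : H f -> 0 <= n2 f. Proof. exact: ip_psd.2. Qed.

Let TZ (a : Cplx R) f : H f -> T (a *: f) = a *: T f.
Proof.
move=> Hf; case: T_compact => -[_ Tl] _.
have T0 : T 0 = 0.
  have := Tl 1 0 0 H0 H0; rewrite !scale1r !addr0 => /eqP.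
  by rewrite -subr_eq subrr eq_sym => /eqP.
by rewrite -[_ *: f]addr0 Tl// T0 addr0.
Qed.

Let T0 : T 0 = 0.
Proof. by have := TZ 0 H0; rewrite !scale0r. Qed.

Let TB f g : H f -> H g -> T (f - g) = T f - T g.
Proof.
move=> Hf Hg; case: T_compact => -[_ Tl] _.
by rewrite addrC -scaleN1r Tl// scaleN1r addrC.
Qed.

Lemma psd_op_sym f g : H f -> H g -> ip (T f) g = ip f (T g).
Proof.
move=> Hf Hg; have /= := hf_conj T_psd.1 Hg Hf; rewrite (hf_conj ipH Hf (TH Hg)) => ->.
by rewrite conjcK.
Qed.

(** The term |f - g|^2 is dropped from the parallelogram identity; this serves as a triangle
    inequality that never leaves squared norms. *)
Lemma n2D_le f g : H f -> H g -> n2 (f + g) <= 2 * n2 f + 2 * n2 g.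
Proof.
move=> Hf Hg; have := n2_ge0 (hfB ipH Hf Hg).
rewrite (hf_linB ipH Hf Hg (hfB ipH Hf Hg)) !(hf_antilinB ipH)//.
rewrite (hf_linD ipH Hf Hg (hfD ipH Hf Hg)) !(hf_antilinD ipH)//.
rewrite !Re_add !Re_opp !Re_add !Re_opp; lra.
Qed.

Lemma n2Z (a : Cplx R) f : H f -> n2 (a *: f) = normc a ^+ 2 * n2 f.
Proof. exact: (hf_sqrZ ipH). Qed.

Let n20 : n2 0 = 0.
Proof. by have := n2Z 0 H0; rewrite scale0r normc0 expr0n mul0r. Qed.

Lemma n2N f : H f -> n2 (- f) = n2 f.
Proof. by move=> Hf; rewrite -scaleN1r n2Z// normcN normc1 expr1n mul1r. Qed.

Lemma compact_n2 (f : nat -> V) (M : R) : (forall n, H (f n)) ->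
  (forall n, n2 (f n) <= M) ->
  exists (phi : nat -> nat) (g : V), [/\ forall n, (n <= phi n)%N,
   {homo phi : m n / (m < n)%N}, H g &
   forall eps : R, 0 < eps -> exists N, forall n, (N <= n)%N ->
     n2 (T (f (phi n)) - g) < eps].
Proof.
move=> Hf fM; case: T_compact => _ /(_ f (Num.sqrt M) Hf) [].
  by move=> n; rewrite /hnorm ler_wsqrtr.
move=> phi [g [hphi Hg cv]]; exists phi, g; split=> //.
  elim=> // n IH; apply: leq_ltn_trans IH _; exact: hphi.
move=> eps eps0.
move/cvgrPdist_lt : cv => /(_ (Num.sqrt eps)); rewrite sqrtr_gt0 => /(_ eps0) [N _ hN].
exists N => n /hN /=; rewrite sub0r normrN ger0_norm ?sqrtr_ge0//.
by rewrite /hnorm ltr_sqrt.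
Qed.

(** Unit vectors g_n with |T g_n|^2 > n would have a subsequence along which T g_n converges, hence
    stays bounded. *)
Lemma compact_op_bounded :
  exists2 C : R, 0 <= C & forall f, H f -> n2 (T f) <= C * n2 f.
Proof.
apply: contrapT => nb.
have /choice [f hf] n : exists f, H f /\ n%:R * n2 f < n2 (T f).
  apply: contrapT => nf; apply: nb; exists n%:R => // f Hf.
  by rewrite leNgt; apply/negP => lt; apply: nf; exists f.
have Hf n : H (f n) by case: (hf n).
have f0 n : 0 < n2 (f n).
  rewrite lt_neqAle n2_ge0 // andbT eq_sym; apply/eqP => /(ip_def (Hf n)) fn0.
  by case: (hf n); rewrite fn0 T0 n20 mulr0 ltxx.
pose g n := ((Num.sqrt (n2 (f n)))^-1)%:C *: f n.
have Hg n : H (g n) by exact: (hfZ ipH).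
have ng n : normc (((Num.sqrt (n2 (f n)))^-1)%:C : Cplx R) ^+ 2 = (n2 (f n))^-1.
  rewrite normc_real ger0_norm ?invr_ge0 ?sqrtr_ge0// exprVn sqr_sqrtr//.
  exact: n2_ge0.
have g1 n : n2 (g n) <= 1 by rewrite n2Z// ng mulVf// gt_eqF.
have gn n : n%:R < n2 (T (g n)).
  rewrite TZ// n2Z ?ng; last exact: TH.
  by rewrite mulrC ltr_pdivlMr//; case: (hf n).
have [phi [h [phi_ge _ Hh /(_ 1 ltr01) [N hN]]]] := compact_n2 Hg g1.
(* Beyond N, |T g|^2 <= 2 |T g - h|^2 + 2 |h|^2 <= 2 + 2 |h|^2, whereas |T g_(phi n)|^2 > phi n >=
   n. *)
pose n := maxn N (Num.bound (2 + 2 * n2 h)).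
have /hN lt1 : (N <= n)%N by rewrite leq_maxl.
have := gn (phi n); apply/negP; rewrite -leNgt.
have HTg : H (T (g (phi n))) by exact: TH.
have := n2D_le (hfB ipH HTg Hh) Hh; rewrite subrK => /le_trans; apply.
apply: (@le_trans _ _ (2 + 2 * n2 h)); first lra.
apply: (le_trans (ltW (archi_boundP _))).
  by rewrite addr_ge0// mulr_ge0// n2_ge0.
by rewrite ler_nat; apply: leq_trans (phi_ge n); rewrite leq_maxr.
Qed.

Definition eigenvectors (E : seq V) := forall e, e \in E ->
  H e /\ exists s : R, T e = (s%:C : Cplx R) *: e.

Definition orth (E : seq V) : set V :=
  [set f | H f /\ forall e, e \in E -> ip f e = 0].

(** The supremum runs over the closed unit ball rather than the unit sphere, so the set is nonempty,
    and the value is 0, when only 0 is orthogonal to E. *)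
Definition top_value (E : seq V) : R :=
  sup [set complex.Re (ip (T f) f) | f in [set f | orth E f /\ n2 f <= 1]].

Lemma orth0 E : eigenvectors E -> orth E 0.
Proof.
move=> hE; split=> // e /hE [He _].
by have := hf_linZ ipH 0 H0 He; rewrite scale0r mul0r.
Qed.

Lemma orthZ E (a : Cplx R) f : eigenvectors E -> orth E f -> orth E (a *: f).
Proof.
move=> hE [Hf fE]; split; first exact: (hfZ ipH).
by move=> e eE; rewrite (hf_linZ ipH) ?fE ?mulr0//; case: (hE e eE).
Qed.

Let cs f g : H f -> H g -> normc (ip f g) ^+ 2 <= n2 f * n2 g.
Proof. exact: psd_cauchy_schwarz. Qed.

Lemma has_sup_top E : eigenvectors E ->
  has_sup [set complex.Re (ip (T f) f) | f in [set f | orth E f /\ n2 f <= 1]].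
Proof.
move=> hE; split.
  exists (complex.Re (ip (T 0) 0)); exists 0 => //; split; first exact: orth0.
  by rewrite n20.
have [C C0 hC] := compact_op_bounded.
exists (C + 1) => _ [f [[Hf _] f1] <-].
apply: (le_trans (ler_norm _)); apply: (le_trans (normc_Re _)).
rewrite -(@ler_pXn2r _ 2) ?nnegrE ?normc_ge0 ?addr_ge0//.
apply: (le_trans (cs (TH Hf) Hf)).
apply: (@le_trans _ _ (C * n2 f * n2 f)); first by rewrite ler_wpM2r ?n2_ge0 ?hC.
have f0 := n2_ge0 Hf.
rewrite -mulrA; apply: (le_trans (ler_piMr C0 (mulr_ile1 f0 f0 f1 f1))); nra.
Qed.

Lemma le_top_value E f : eigenvectors E -> orth E f ->
  complex.Re (ip (T f) f) <= top_value E * n2 f.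
Proof.
move=> hE fE; have [Hf _] := fE.
have [/(ip_def Hf) ->|fN0] := eqVneq (n2 f) 0.
  by rewrite T0 n20 mulr0.
have fp : 0 < n2 f by rewrite lt_neqAle eq_sym fN0 n2_ge0.
rewrite -ler_pdivrMr//.
apply: ub_le_sup; first by case: (has_sup_top hE).
exists ((Num.sqrt (n2 f))^-1%:C *: f).
  split; first exact: orthZ.
  rewrite n2Z// normc_real ger0_norm ?invr_ge0 ?sqrtr_ge0// exprVn sqr_sqrtr//.
    by rewrite mulVf.
  exact: ltW.
rewrite (hf_sqrZ T_psd.1)// normc_real ger0_norm ?invr_ge0 ?sqrtr_ge0// exprVn sqr_sqrtr//.
  by rewrite mulrC.
exact: ltW.
Qed.

Lemma top_value_ge0 E : eigenvectors E -> 0 <= top_value E.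
Proof.
move=> hE; apply: ub_le_sup; first by case: (has_sup_top hE).
exists 0; last by rewrite T0 n20.
split; first exact: orth0.
by rewrite n20.
Qed.

(** Symmetry moves T onto the eigenvector: <T f, e> = <f, T e> = s <f, e>. *)
Lemma orth_inv E f : eigenvectors E -> orth E f -> orth E (T f).
Proof.
move=> hE [Hf fE]; split; first exact: TH.
move=> e eE; have [He [s Te]] := hE _ eE.
by rewrite psd_op_sym// Te (hf_antilinZ ipH)// fE// mulr0.
Qed.

Lemma n2_eq0_eps f : H f -> (forall eps : R, 0 < eps -> n2 f <= eps) -> f = 0.
Proof.
move=> Hf hf; apply: (ip_def Hf); apply/eqP; rewrite eq_le n2_ge0// andbT.
by apply/ler_addgt0Pl => e; rewrite addr0; exact: hf.
Qed.

(* A maximizing sequence f_n satisfies T f_n - lambda f_n -> 0, by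
   Cauchy-Schwarz for the positive form <(lambda - T) f, g>; compactness then
   gives a limit of lambda f_n, which is an eigenvector. *)
Lemma top_eigenvector E : eigenvectors E -> 0 < top_value E ->
  exists e, [/\ orth E e, n2 e = 1 & T e = ((top_value E)%:C : Cplx R) *: e].
Proof.
move=> hE; set lam := top_value E => lam0.
pose MB f g := (lam%:C : Cplx R) * ip f g - ip (T f) g.
have MBpsd : psd_form (orth E) MB.
  split; first split.
  - exact: orth0.
  - move=> a f g [Hf fE] [Hg gE]; split; first exact: (hfP ipH).
    move=> e eE; have [He _] := hE _ eE.
    by rewrite (hf_lin ipH)// fE// gE// mulr0 addr0.
  - move=> a f g k [Hf _] [Hg _] [Hk _].
    have := hf_lin T_psd.1 a Hf Hg Hk; rewrite /= /MB => ->.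
    by rewrite (hf_lin ipH)//; ring.
  - move=> f g [Hf _] [Hg _].
    have /= := hf_conj T_psd.1 Hf Hg; rewrite /MB => ->.
    by rewrite (hf_conj ipH Hf Hg) conjcB conjcM conjc_real.
  - move=> f fE; rewrite /MB Re_add Re_opp Re_mul /= mul0r subr0 subr_ge0.
    exact: le_top_value.
have /choice [f hf] n : exists f, [/\ orth E f, n2 f <= 1 &
    lam - n.+1%:R^-1 < complex.Re (ip (T f) f)].
  have : 0 < n.+1%:R^-1 :> R by [].
  move/sup_adherent => /(_ _ (has_sup_top hE)) [_ [f [fE f1] <-] lt].
  by exists f.
have Ef n : orth E (f n) by case: (hf n).
have Hf n : H (f n) by case: (Ef n).
have f1 n : n2 (f n) <= 1 by case: (hf n).
have flt n : lam - n.+1%:R^-1 < complex.Re (ip (T (f n)) (f n)) by case: (hf n).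
(* For g = lambda f_n - T f_n one has MB(f_n, g) = |g|^2, MB(f_n, f_n) <= 1 / (n + 1) and MB(g, g)
   <= lambda |g|^2; Cauchy-Schwarz leaves |g|^4 <= lambda |g|^2 / (n + 1). *)
have resid n : n2 ((lam%:C : Cplx R) *: f n - T (f n)) <= lam / n.+1%:R.
  set g := _ - _.
  have Eg : orth E g.
    rewrite /g addrC -scaleN1r; apply: (hfP MBpsd.1); last exact: orthZ.
    exact: orth_inv.
  have Hg : H g by case: Eg.
  have fgE : MB (f n) g = (n2 g)%:C.
    rewrite /MB -(hf_linZ ipH lam%:C (Hf n) Hg) -(hf_linB ipH)//; last exact: TH.
      by rewrite -/g -(hf_real ipH).
    exact: (hfZ ipH).
  have := psd_cauchy_schwarz MBpsd (Ef n) Eg.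
  rewrite fgE normc_real ger0_norm ?n2_ge0//.
  have ggle : complex.Re (MB g g) <= lam * n2 g.
    rewrite /MB Re_add Re_opp Re_mul /= mul0r subr0 gerBl.
    exact: T_psd.2.
  have ffle : complex.Re (MB (f n) (f n)) <= n.+1%:R^-1.
    rewrite /MB Re_add Re_opp Re_mul /= mul0r subr0.
    have : lam * n2 (f n) <= lam by exact: ler_piMr (ltW lam0) (f1 n).
    by have := flt n; set a := n.+1%:R^-1; lra.
  have ff0 := MBpsd.2 _ (Ef n).
  have g0 := n2_ge0 Hg.
  have [->|gN0] := eqVneq (n2 g) 0; first by move=> _; rewrite divr_ge0// ltW.
  have gp : 0 < n2 g by rewrite lt_neqAle eq_sym gN0.
  move=> le2.
  rewrite -(ler_pM2r gp) -expr2; apply: (le_trans le2).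
  have -> : lam / n.+1%:R * n2 g = n.+1%:R^-1 * (lam * n2 g) by rewrite mulrCA mulrA.
  by rewrite ler_pM//; exact: MBpsd.2.
have [phi [g [phi_ge _ Hg cvg]]] := compact_n2 Hf f1.
pose q n := (lam%:C : Cplx R) *: f (phi n) - g.
have Hlf n : H ((lam%:C : Cplx R) *: f n) by exact: (hfZ ipH).
have Hq n : H (q n) by exact: (hfB ipH).
have HTf n : H (T (f n)) by exact: TH.
have qE n : q n = ((lam%:C : Cplx R) *: f (phi n) - T (f (phi n))) + (T (f (phi n)) - g).
  by rewrite addrA subrK.
have hq eps : 0 < eps -> exists N, forall n, (N <= n)%N -> n2 (q n) < eps.
  move=> eps0.
  have [N hN] := cvg (eps / 4) ltac:(by rewrite divr_gt0).
  exists (maxn N (Num.bound (4 * lam / eps))) => n; rewrite geq_max => /andP[Nn bn].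
  rewrite qE; apply: le_lt_trans (n2D_le _ _) _; [exact: (hfB ipH)|exact: (hfB ipH)|].
  have : lam / (phi n).+1%:R <= eps / 4.
    rewrite ler_pdivrMr// mulrAC ler_pdivlMr// mulrC [eps * _]mulrC -ler_pdivrMr//.
    apply: (le_trans (ltW (archi_boundP _))); first by rewrite divr_ge0 ?mulr_ge0 ?ltW.
    by rewrite ler_nat (leq_trans bn)// (leq_trans (phi_ge n)).
  by move=> le1; have := le_trans (resid (phi n)) le1; have := hN _ Nn; lra.
have Eg : orth E g.
  split=> // e eE; have [He _] := hE _ eE.
  apply: eq0_normc; apply/eqP; rewrite -sqrf_eq0 eq_le sqr_ge0 andbT.
  apply/ler_addgt0Pl => d d0; rewrite addr0.
  have [N hN] := hq (d / (n2 e + 1)) ltac:(by rewrite divr_gt0// ltr_wpDl ?n2_ge0).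
  have -> : ip g e = - ip (q N) e.
    rewrite (hf_linB ipH)// (hf_linZ ipH)//.
    by have [_ /(_ _ eE) ->] := Ef (phi N); rewrite mulr0 sub0r opprK.
  rewrite normcN; apply: (le_trans (cs (Hq N) He)).
  have := hN N (leqnn N); rewrite ltr_pdivlMr ?ltr_wpDl ?n2_ge0//.
  have := n2_ge0 (Hq N); have := n2_ge0 He; nra.
have Tg : T g = (lam%:C : Cplx R) *: g.
  apply/eqP; rewrite -subr_eq0; apply/eqP.
  have HTg := TH Hg; have Hlg : H (lam%:C *: g) by exact: (hfZ ipH).
  apply: n2_eq0_eps; first exact: (hfB ipH).
  move=> d d0.
  have [C C0 hC] := compact_op_bounded.
  have [N1 hN1] := hq (d / (4 * (C + 1))) ltac:(by rewrite divr_gt0 ?mulr_gt0 ?ltr_wpDl).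
  have [N2 hN2] := cvg (d / (4 * (lam ^+ 2))) ltac:(by rewrite divr_gt0 ?mulr_gt0 ?exprn_gt0).
  pose n := maxn N1 N2.
  have -> : T g - (lam%:C : Cplx R) *: g = - T (q n) + (lam%:C : Cplx R) *: (T (f (phi n)) - g).
    rewrite /q TB// TZ// scalerBr opprB.
    by rewrite addrA subrK.
  have HTq : H (T (q n)) by exact: TH.
  have HTfg : H (T (f (phi n)) - g) by exact: (hfB ipH).
  apply: (le_trans (n2D_le _ _)); [|exact: (hfZ ipH)|].
    by rewrite -scaleN1r; apply: (hfZ ipH).
  rewrite n2N// n2Z// normc_real (gtr0_norm lam0).
  have := hN1 n (leq_maxl _ _); have := hN2 n (leq_maxr _ _).
  rewrite !ltr_pdivlMr ?mulr_gt0 ?exprn_gt0 ?ltr_wpDl//.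
  have := hC _ (Hq n); have := n2_ge0 (Hq n).
  move: (n2 (q n)) (n2 (T (q n))) (n2 (T (f (phi n)) - g)) (lam ^+ 2) => a b c l; nra.
(* The limit is not zero: far along the sequence <T f, f> > lambda / 2 with |f| <= 1, which forces
   |T f|^2 > lambda^2 / 4, while T f is close to g. *)
have gp : 0 < n2 g.
  rewrite lt_neqAle eq_sym n2_ge0// andbT; apply/eqP => /(ip_def Hg) g0.
  have [N hN] := cvg (lam ^+ 2 / 4) ltac:(by rewrite divr_gt0 ?exprn_gt0).
  pose n := maxn N (Num.bound (2 / lam)).
  have := hN n (leq_maxl _ _); rewrite g0 subr0.
  have := flt (phi n).
  have le2 : (phi n).+1%:R^-1 <= lam / 2.
    rewrite -[leRHS]invrK lef_pV2 ?posrE ?invr_gt0 ?divr_gt0// invf_div.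
    apply: (le_trans (ltW (archi_boundP _))); first by rewrite divr_ge0// ltW.
    by rewrite ler_nat (leq_trans _ (leq_trans (phi_ge n) (leqnSn _)))// leq_maxr.
  have h1 := cs (HTf (phi n)) (Hf (phi n)).
  have h2 : complex.Re (ip (T (f (phi n))) (f (phi n))) <= normc (ip (T (f (phi n))) (f (phi n))).
    exact: le_trans (ler_norm _) (normc_Re _).
  have h3 := f1 (phi n).
  have h4 := n2_ge0 (HTf (phi n)).
  move=> h5 h6.
  move: le2 h5; set inv := (phi n).+1%:R^-1 => le2 h5.
  have h7 : lam / 2 < normc (ip (T (f (phi n))) (f (phi n))) by lra.
  have : (lam / 2) ^+ 2 < normc (ip (T (f (phi n))) (f (phi n))) ^+ 2.
    by rewrite ltrXn2r// ?nnegrE ?normc_ge0 ?divr_ge0 ?ltW.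
  rewrite expr_div_n => h8; nra.
exists (((Num.sqrt (n2 g))^-1)%:C *: g); split.
- exact: orthZ.
- rewrite n2Z// normc_real ger0_norm ?invr_ge0 ?sqrtr_ge0// exprVn sqr_sqrtr; last exact: ltW.
  by rewrite mulVf// gt_eqF.
- by rewrite TZ// Tg !scalerA mulrC.
Qed.

End compact_positive_operators.

Section hermitian_sums.
Context {R : realType} {V : lmodType (Cplx R)}.
Variables (H : set V) (B : V -> V -> Cplx R).
Hypothesis hB : hermitian_form H B.

Lemma hf_sum (P : pred nat) (c : nat -> Cplx R) (e : nat -> V) N :
  (forall n, P n -> H (e n)) -> H (\sum_(0 <= n < N | P n) c n *: e n).
Proof.
move=> He; elim: N => [|N IH]; first by rewrite big_geq//; exact: hf0 hB.
rewrite big_mkcond big_nat_recr//= -big_mkcond /=; case: ifP => PN; last by rewrite addr0.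
exact: (hfD hB IH (hfZ hB _ (He _ PN))).
Qed.

Lemma hf_lin_sum (P : pred nat) (c : nat -> Cplx R) (e : nat -> V) N k :
  H k -> (forall n, P n -> H (e n)) ->
  B (\sum_(0 <= n < N | P n) c n *: e n) k = \sum_(0 <= n < N | P n) c n * B (e n) k.
Proof.
move=> Hk He; elim: N => [|N IH].
  by rewrite !big_geq//; have := hf_linZ hB 0 (hf0 hB) Hk; rewrite scale0r mul0r.
rewrite [in LHS]big_mkcond [in RHS]big_mkcond !big_nat_recr//= -!big_mkcond /=.
case: ifP => PN; last by rewrite !addr0.
by rewrite (hf_linD hB (hf_sum _ _ He) (hfZ hB _ (He _ PN)) Hk) IH (hf_linZ hB _ (He _ PN) Hk).
Qed.

End hermitian_sums.

(** * Singular values of a positive operator as a list of eigenvalues *)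

Section singular_values_of_positive_operators.
Context {R : realType} {V : lmodType (Cplx R)}.
Variables (H : set V) (ip : V -> V -> Cplx R) (T : V -> V).
Hypothesis ip_psd : psd_form H ip.
Hypothesis ip_def : forall f, H f -> complex.Re (ip f f) = 0 -> f = 0.
Hypothesis T_psd : psd_form H (fun f g => ip (T f) g).
Hypothesis T_compact : compact_op H ip T.

Local Notation n2 f := (complex.Re (ip f f)).
Let ipH := ip_psd.1.
Let TH f : H f -> H (T f). Proof. by case: T_compact => -[+ _] _; apply. Qed.
Let H0 : H 0 := hf0 ipH.

Let n2_ge0 f : H f -> 0 <= n2 f. Proof. exact: ip_psd.2. Qed.

Let TZ (a : Cplx R) f : H f -> T (a *: f) = a *: T f.
Proof.
move=> Hf; case: T_compact => -[_ Tl] _.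
have T0 : T 0 = 0.
  have := Tl 1 0 0 H0 H0; rewrite !scale1r !addr0 => /eqP.
  by rewrite -subr_eq subrr eq_sym => /eqP.
by rewrite -[_ *: f]addr0 Tl// T0 addr0.
Qed.

Let TB f g : H f -> H g -> T (f - g) = T f - T g.
Proof.
move=> Hf Hg; case: T_compact => -[_ Tl] _.
by rewrite addrC -scaleN1r Tl// scaleN1r addrC.
Qed.

Let Tsym f g : H f -> H g -> ip (T f) g = ip f (T g).
Proof. exact: (psd_op_sym ip_psd T_psd T_compact). Qed.

(** [singular_values] leaves the adjoint existentially quantified; definiteness of the inner product
    makes it unique on H, so it may be replaced by T. *)
Lemma adjoint_psd_op Ts : adjoint H ip T Ts -> forall g, H g -> Ts g = T g.
Proof.
move=> [[TsH _] adj] g Hg; apply/eqP; rewrite -subr_eq0; apply/eqP.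
have HTs := TsH _ Hg; have HT := TH Hg; have Hd := hfB ipH HTs HT.
apply: ip_def => //.
by rewrite (hf_antilinB ipH Hd HTs HT) -adj// -Tsym// subrr.
Qed.

(* T^2 - s^2 = (T + s)(T - s) and T + s is injective. *)
Lemma psd_op_eigen_sqrt (s : R) f : 0 < s -> H f ->
  T (T f) = ((s ^+ 2)%:C : Cplx R) *: f -> T f = (s%:C : Cplx R) *: f.
Proof.
move=> s0 Hf TTf; apply/eqP; rewrite -subr_eq0; apply/eqP.
have Hsf : H ((s%:C : Cplx R) *: f) by exact: (hfZ ipH).
have HTf := TH Hf.
set g := _ - _; have Hg : H g by exact: (hfB ipH).
have Tg : T g = - ((s%:C : Cplx R) *: g).
  rewrite /g TB// TTf TZ// scalerBr opprB scalerA expr2.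
  by congr (_ *: _ - _); exact: rmorphM.
apply: ip_def => //.
have := T_psd.2 _ Hg; rewrite Tg -scaleN1r (hf_linZ ipH) ?(hf_linZ ipH)//; last exact: (hfZ ipH).
rewrite mulN1r Re_opp Re_mul /= mul0r subr0 oppr_ge0 pmulr_rle0// => le0.
by apply/eqP; rewrite eq_le le0 n2_ge0.
Qed.

(** For a positive operator |T| = T, so the eigenvector equation is stated for T itself instead of
    T^* T. Nothing is asked of [e n] when [s n] is 0. *)
Record eigenlist (s : nat -> R) (e : nat -> V) : Prop := {
  el_ge0 : forall n, 0 <= s n;
  el_dec : forall m n, (m <= n)%N -> s n <= s m;
  el_H : forall n, 0 < s n -> H (e n);
  el_orth : forall m n, 0 < s m -> 0 < s n -> ip (e m) (e n) = (m == n)%:R;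
  el_eig : forall n, 0 < s n -> T (e n) = ((s n)%:C : Cplx R) *: e n }.

(** If all s_n stayed above d, the vectors T e_n = s_n e_n would satisfy |T e_m - T e_n|^2 = s_m^2 +
    s_n^2 >= 2 d^2, and no subsequence could converge. *)
Lemma eigenlist_cvg0 s e : eigenlist s e ->
  forall d : R, 0 < d -> exists N, s N < d.
Proof.
move=> hs d d0; apply: contrapT => nex.
have sd n : d <= s n by rewrite leNgt; apply/negP => lt; apply: nex; exists n.
have sp n : 0 < s n by exact: lt_le_trans (sd n).
have He n : H (e n) by exact: (el_H hs).
have e1 n : n2 (e n) <= 1 by rewrite (el_orth hs)// eqxx.
have [phi [g [_ hphi Hg cv]]] := compact_n2 T_compact He e1.
have [N hN] := cv (d ^+ 2 / 4) ltac:(by rewrite divr_gt0 ?exprn_gt0).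
have := hN N (leqnn N); have := hN N.+1 (leqnSn N).
set m := phi N; set n := phi N.+1.
have mn : (m == n) = false by apply: ltn_eqF; exact: hphi.
have HTe k : H (T (e k)) by exact: TH.
have HA : H (T (e m) - g) by exact: (hfB ipH).
have HB : H (T (e n) - g) by exact: (hfB ipH).
have := n2D_le ip_psd HA (hfZ ipH (-1) HB).
rewrite (n2Z ip_psd _ HB) normcN normc1 expr1n mul1r scaleN1r opprB addrA subrK.
have -> : n2 (T (e m) - T (e n)) = s m ^+ 2 + s n ^+ 2.
  rewrite !(el_eig hs)// (hf_sqrB_scale ipH (s n)%:C (hfZ ipH (s m)%:C (He m)) (He n)).
  rewrite (hf_sqrZ ipH (s m)%:C (He m)) (hf_linZ ipH (s m)%:C (He m) (He n)).
  rewrite !(el_orth hs)// mn !eqxx !normc_real !real_normK ?num_real//.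
  by rewrite mulr0 mulr0 /= mulr0 subr0 !mulr1.
have := sd m; have := sd n.
move: (n2 _) (n2 _) (s m) (s n) => A B a b *.
nra.
Qed.

(** The component of f orthogonal to those of e_0, ..., e_(N-1) whose eigenvalue is positive.
    Removing one coefficient at a time turns Bessel's inequality and its analogue for <T f, f> into
    an induction. *)
Fixpoint residual (s : nat -> R) (e : nat -> V) (f : V) (N : nat) : V :=
  if N is n.+1 then
    let g := residual s e f n in if 0 < s n then g - ip g (e n) *: e n else g
  else f.

Definition weight_on (s : nat -> R) (e : nat -> V) (f : V) (n : nat) : R :=
  if 0 < s n then normc (ip f (e n)) ^+ 2 else 0.

Lemma weight_on_ge0 s e f n : 0 <= weight_on s e f n.
Proof. by rewrite /weight_on; case: ifP => // _; rewrite sqr_ge0. Qed.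

Lemma residualP s e f N : eigenlist s e -> H f ->
  [/\ H (residual s e f N),
   forall m, (m < N)%N -> 0 < s m -> ip (residual s e f N) (e m) = 0,
   forall m, (N <= m)%N -> 0 < s m -> ip (residual s e f N) (e m) = ip f (e m),
   n2 (residual s e f N) = n2 f - \sum_(0 <= n < N) weight_on s e f n &
   complex.Re (ip (T (residual s e f N)) (residual s e f N)) =
   complex.Re (ip (T f) f) - \sum_(0 <= n < N) s n * weight_on s e f n].
Proof.
move=> hs Hf; elim: N => [|N [Hg g0 gf ng Tg]] /=.
  by split=> //; rewrite big_geq// subr0.
set g := residual s e f N in Hg g0 gf ng Tg *.
rewrite !big_nat_recr//= /weight_on; case: ifP => sN; last first.
  split=> //.
  - move=> m; rewrite ltnS leq_eqVlt => /orP[/eqP ->|]; first by rewrite sN.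
    exact: g0.
  - by move=> m Nm; apply: gf; exact: ltnW.
  - by rewrite addr0 ng.
  - by rewrite mulr0 addr0 Tg.
have HeN := el_H hs sN; have Hce := hfZ ipH (ip g (e N)) HeN.
rewrite !opprD !addrA -ng -Tg; split.
- exact: (hfB ipH).
- move=> m; rewrite ltnS leq_eqVlt => /orP[/eqP -> _|mN sm].
    by rewrite (hf_linB ipH)// (hf_linZ ipH)// (el_orth hs)// eqxx mulr1 subrr.
  have Hem := el_H hs sm.
  by rewrite (hf_linB ipH)// (hf_linZ ipH)// (el_orth hs)// (gtn_eqF mN) mulr0 subr0 g0.
- move=> m Nm sm; have Hem := el_H hs sm.
  by rewrite (hf_linB ipH)// (hf_linZ ipH)// (el_orth hs)// (ltn_eqF Nm) mulr0 subr0 gf// ltnW.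
- rewrite (hf_sqrB_scale ipH)// (el_orth hs)// eqxx /= mulr1 (gf N)// [_^* * _]mulrC mulc_conj /=.
  ring.
- have := hf_sqrB_scale T_psd.1 (ip g (e N)) Hg HeN; rewrite /= => ->.
  rewrite (Tsym Hg HeN) (el_eig hs)// (hf_antilinZ ipH)// (hf_linZ ipH)// (el_orth hs)// eqxx mulr1 conjc_real.
  rewrite (gf N)// mulrCA [_^* * _]mulrC mulc_conj Re_mul /=; ring.
Qed.

Lemma bessel s e f N : eigenlist s e -> H f ->
  \sum_(0 <= n < N) weight_on s e f n <= n2 f.
Proof.
move=> hs Hf; have [Hg _ _ ng _] := residualP N hs Hf.
by have := n2_ge0 Hg; rewrite ng subr_ge0.
Qed.

Definition eigenlist_complete (s : nat -> R) (e : nat -> V) :=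
  forall (lambda : R) (f : V), 0 < lambda -> H f ->
  T f = (lambda%:C : Cplx R) *: f ->
  exists (N : nat) (c : nat -> Cplx R),
    f = \sum_(0 <= n < N | s n == lambda) c n *: e n.

(** Were the top value on the complement of the first N vectors larger than s_N, it would have an
    eigenvector there. Completeness writes it through those e_n with s_n equal to that value, and
    monotonicity places these n below N, so the eigenvector is orthogonal to itself. *)
Lemma eigenlist_tail s e f N : eigenlist s e -> eigenlist_complete s e -> H f ->
  (forall m, (m < N)%N -> 0 < s m -> ip f (e m) = 0) ->
  complex.Re (ip (T f) f) <= s N * n2 f.
Proof.
move=> hs hc Hf fe.
pose E := [seq e m | m <- [seq m <- iota 0 N | 0 < s m]].
have EP x : x \in E -> exists m, [/\ (m < N)%N, 0 < s m & x = e m].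
  by move=> /mapP[m]; rewrite mem_filter mem_iota /= => /andP[sm mN] ->; exists m.
have hE : eigenvectors H T E.
  move=> x /EP [m [mN sm ->]]; split; first exact: (el_H hs).
  by exists (s m); exact: (el_eig hs).
have fE : orth H ip E f by split=> // x /EP [m [mN sm ->]]; exact: fe.
apply: (le_trans (le_top_value ip_psd ip_def T_psd T_compact hE fE)).
apply: ler_wpM2r; first exact: n2_ge0.
rewrite leNgt; apply/negP => lt.
have top0 := le_lt_trans (el_ge0 hs N) lt.
have [g [gE g1 Tg]] := top_eigenvector ip_psd ip_def T_psd T_compact hE top0.
have [Hg _] := gE.
have [M [c gc]] := hc _ _ top0 Hg Tg.
have : ip g g = 0.
  rewrite {1}gc (hf_lin_sum ipH)//; last first.
    by move=> n /eqP sn; apply: (el_H hs); rewrite sn.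
  rewrite big1// => n /eqP sn.
  have sn0 : 0 < s n by rewrite sn.
  rewrite (hf_conj ipH Hg (el_H hs sn0)).
  have [_ ->] := gE; first by rewrite conjc0 mulr0.
  apply: map_f; rewrite mem_filter sn0 mem_iota /=.
  rewrite ltnNge; apply/negP => /(el_dec hs); rewrite sn leNgt.
  by rewrite lt.
by move=> /(congr1 (@complex.Re R)) /=; rewrite g1 => /eqP; rewrite oner_eq0.
Qed.

(** This is the truncated form of <T f, f> = sum_n s_n |<f, e_n>|^2: the residual inherits the tail
    bound, and its norm is at most that of f. *)
Lemma eigenlist_form_le s e f N : eigenlist s e -> eigenlist_complete s e -> H f ->
  complex.Re (ip (T f) f) <= \sum_(0 <= n < N) s n * weight_on s e f n + s N * n2 f.
Proof.
move=> hs hc Hf; have [Hg g0 _ ng Tg] := residualP N hs Hf.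
have := eigenlist_tail hs hc Hg g0; rewrite Tg lerBlDr addrC => /le_trans; apply.
rewrite lerD2l ler_wpM2l ?(el_ge0 hs)// ng gerBl.
by apply: sumr_ge0 => n _; exact: weight_on_ge0.
Qed.

Lemma singular_values_eigenlist s : singular_values H ip T s ->
  exists2 e, eigenlist s e & eigenlist_complete s e.
Proof.
move=> [s0 sdec [Ts [adj [e [eH eo eeig ec]]]]].
have TsE := adjoint_psd_op adj.
exists e.
  split=> // n sn; apply: psd_op_eigen_sqrt => //; first exact: eH.
  by rewrite -(eeig n sn) TsE//; apply: TH; exact: eH.
move=> l f l0 Hf Tf; apply: ec => //; rewrite TsE; last exact: TH.
rewrite Tf TZ// Tf scalerA expr2; congr (_ *: _).
by apply/esym; exact: rmorphM.
Qed.

(** When no unit vector qualifies, the default 0 is chosen. It still satisfies [eigenvectors], as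
    that predicate does not ask for nonzero vectors. *)
Let next (E : seq V) : V := xget 0 [set e | [/\ orth H ip E e, n2 e = 1 &
  T e = ((top_value H ip T E)%:C : Cplx R) *: e]].

Let Es n := iter n (fun E => rcons E (next E)) [::].

Let T0 : T 0 = 0.
Proof. by have := TZ 0 H0; rewrite !scale0r. Qed.

Let EsP n : eigenvectors H T (Es n).
Proof.
elim: n => [|n IH] // x; rewrite /= mem_rcons inE => /orP[/eqP ->|]; last exact: IH.
rewrite /next; case: xgetP => [y -> [[Hy _] _ Ty]|_].
  by split=> //; exists (top_value H ip T (Es n)).
by split=> //; exists 0; rewrite T0 scale0r.
Qed.

Let mem_Es m n : (m < n)%N -> next (Es m) \in Es n.
Proof.
elim: n => // n IH; rewrite ltnS leq_eqVlt => /orP[/eqP ->|mn].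
  by rewrite /= mem_rcons mem_head.
by rewrite /= mem_rcons inE IH ?orbT.
Qed.

Let EsE n x : x \in Es n -> exists2 m, (m < n)%N & x = next (Es m).
Proof.
elim: n => // n IH; rewrite /= mem_rcons inE => /orP[/eqP ->|/IH[m mn ->]].
  by exists n.
by exists m => //; exact: ltnW.
Qed.

(** The list is greedy: each s_n is the top value on the complement of the vectors already chosen,
    so it decreases. The real content is completeness, that an eigenvector with eigenvalue l > 0 has
    no component outside the finitely many e_n with s_n = l. *)
Lemma singular_values_exist :
  exists s e, singular_values H ip T s /\ eigenlist s e.
Proof.
pose s n := top_value H ip T (Es n); pose e n := next (Es n).
have s0 n : 0 <= s n by exact: (top_value_ge0 ip_psd ip_def T_compact).
have sdec m n : (m <= n)%N -> s n <= s m.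
  have sS k : s k.+1 <= s k.
    apply: ge_sup; first by case: (has_sup_top ip_psd ip_def T_compact (@EsP k.+1)).
    move=> _ [f [[Hf fE] f1] <-]; apply: ub_le_sup.
      by case: (has_sup_top ip_psd ip_def T_compact (@EsP k)).
    exists f => //; split=> //; split=> // x xE; apply: fE.
    by rewrite /= mem_rcons inE xE orbT.
  move/subnK <-; elim: (n - m)%N => [//|k IH].
  by rewrite addSn; exact: le_trans (sS _) IH.
have eP n : 0 < s n -> [/\ orth H ip (Es n) (e n), n2 (e n) = 1 &
    T (e n) = ((s n)%:C : Cplx R) *: e n].
  move=> sn; rewrite /e /next; case: xgetP => [y _ //|no].
  have [y yP] := top_eigenvector ip_psd ip_def T_psd T_compact (@EsP n) sn.
  by have := no y; rewrite /= => /(_ yP).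
have eH n : 0 < s n -> H (e n) by move=> /eP [[]].
have orth_lt m n : (m < n)%N -> 0 < s n -> ip (e n) (e m) = 0.
  by move=> mn /eP [[_ +] _ _]; apply; exact: mem_Es.
have eo m n : 0 < s m -> 0 < s n -> ip (e m) (e n) = (m == n)%:R.
  move=> sm sn; case: ltngtP => [mn|nm|<-].
  - by rewrite (hf_conj ipH (eH _ sn) (eH _ sm)) orth_lt// conjc0.
  - by rewrite orth_lt.
  - by rewrite (hf_real ipH (eH _ sm)); have [_ -> _] := eP _ sm.
have hs : eigenlist s e by split=> // n /eP [].
exists s, e; split=> //; split=> //.
exists T; split; first by split; [case: T_compact|exact: Tsym].
exists e; split=> //.
  move=> n sn; rewrite (el_eig hs)// TZ ?(el_eig hs)//; last exact: eH.
  by rewrite scalerA expr2; congr (_ *: _); apply/esym; exact: rmorphM.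
move=> l f l0 Hf /psd_op_eigen_sqrt -/(_ l0 Hf) Tf.
have exN : exists n, s n < l by exact: (eigenlist_cvg0 hs).
(* N is the first index with s_N < l, so every index with s_n = l lies below N. *)
case: (ex_minnP exN) => N sN minN.
have lt_l m : (m < N)%N -> l <= s m.
  by move=> mN; rewrite leNgt; apply/negP => /minN; rewrite leqNgt mN.
exists N, (fun n => ip f (e n)); apply/eqP; rewrite -subr_eq0; apply/eqP.
set S := \sum_(_ <= _ < _ | _) _; set g := f - S.
have HeP n : s n == l -> H (e n) by move=> /eqP sn; apply: eH; rewrite sn.
have HS : H S by exact: (hf_sum ipH).
have Hg : H g by exact: (hfB ipH).
have TS : T S = (l%:C : Cplx R) *: S.
  have HSS M : H (\sum_(0 <= n < M | s n == l) ip f (e n) *: e n) by exact: (hf_sum ipH).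
  rewrite /S; elim: N {sN minN lt_l S g HS Hg} => [|M IH].
    by rewrite big_geq// T0 scaler0.
  rewrite big_mkcond big_nat_recr//= -big_mkcond /=.
  case: ifP => [sM|_]; last by rewrite addr0.
  have HM := hfZ ipH (ip f (e M)) (HeP _ sM).
  rewrite -{1}[_ *: e M]opprK -scaleNr TB//; last exact: (hfZ ipH _ (HeP _ sM)).
  rewrite IH TZ ?(el_eig hs); [|by rewrite (eqP sM)|exact: HeP].
  by rewrite (eqP sM) scaleNr opprK scalerDr !scalerA [_ * l%:C]mulrC.
have Tg : T g = (l%:C : Cplx R) *: g by rewrite /g TB// TS Tf scalerBr.
(* For s_m = l the coefficient has been subtracted; for other s_m, eigenvectors of a symmetric
   operator with distinct eigenvalues are orthogonal. Then l |g|^2 <= s_N |g|^2 with s_N < l forces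
   g = 0. *)
have gE : orth H ip (Es N) g.
  split=> // x /EsE [m mN ->]; rewrite -/(e m).
  have sm0 : 0 < s m by exact: lt_le_trans (lt_l _ mN).
  have Hem := eH _ sm0.
  rewrite (hf_linB ipH)// (hf_lin_sum ipH)//.
  have -> : \sum_(0 <= n < N | s n == l) ip f (e n) * ip (e n) (e m) =
      if s m == l then ip f (e m) else 0.
    rewrite big_mkcond (eq_big_nat _ _ (F2 := fun n => if n == m then
        (if s m == l then ip f (e m) else 0) else 0)); last first.
      move=> n _; case: ifP => [sn|sn]; last by case: eqP => [<-|//]; rewrite sn.
      rewrite eo//; last by rewrite (eqP sn).
      by case: eqP => [<-|_]; rewrite ?mulr0// sn mulr1.
    by rewrite -big_mkcond big_nat1_eq mN.
  case: ifPn => [_|sml]; first by rewrite subrr.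
  rewrite subr0; have := Tsym Hf Hem; rewrite Tf (el_eig hs)//.
  rewrite (hf_linZ ipH)// (hf_antilinZ ipH)// conjc_real => /eqP.
  rewrite -subr_eq0 -mulrBl mulf_eq0 => /orP[|/eqP//].
  rewrite subr_eq0 => /eqP /complexI ls.
  by rewrite ls eqxx in sml.
apply: ip_def => //; apply/eqP; rewrite eq_le n2_ge0// andbT leNgt; apply/negP => g0.
have := le_top_value ip_psd ip_def T_psd T_compact (@EsP N) gE.
rewrite Tg (hf_linZ ipH)// Re_mul /= mul0r subr0 -/(s N) ler_pM2r// leNgt.
by rewrite sN.
Qed.

End singular_values_of_positive_operators.

(** * Supporting lines of an increasing convex function *)

Section supporting_line.
Context {R : realType}.
Variable h : R -> R.
Hypothesis h_incr : {in `[0, +oo[ &, {homo h : x y / x <= y}}.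
Hypothesis h_conv : convex_function (`[0, +oo[%classic : set R^o) h.

Lemma convex_three_points (y x z : R) : 0 <= y -> y <= x -> x <= z ->
  (z - y) * h x <= (z - x) * h y + (x - y) * h z.
Proof.
move=> y0 yx xz.
have [zy|zN] := eqVneq z y.
  have xy : x = y by apply/eqP; rewrite eq_le yx -zy xz.
  by rewrite zy xy subrr !mul0r addr0.
have zy : 0 < z - y by rewrite subr_gt0 lt_neqAle eq_sym zN (le_trans yx).
have t0 : 0 <= (z - x) / (z - y) by rewrite divr_ge0 ?subr_ge0// ltW// -subr_gt0.
have t1 : (z - x) / (z - y) <= 1 by rewrite ler_pdivrMr// mul1r; lra.
have z0 : 0 <= z by rewrite (le_trans y0)// (le_trans yx).
set t := (z - x) / (z - y) in t0 t1 *.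
have hin a : 0 <= a -> a \in (`[0, +oo[%classic : set R).
  by move=> a0; rewrite inE /= in_itv /= andbT.
have : h (t * y + (1 - t) * z) <= t * h y + (1 - t) * h z.
  exact: (h_conv (Itv01 t0 t1) (hin _ y0) (hin _ z0)).
rewrite /t.
have -> : (z - x) / (z - y) * y + (1 - (z - x) / (z - y)) * z = x.
  by field; rewrite gt_eqF.
rewrite -(ler_pM2l zy).
by have -> : (z - y) * ((z - x) / (z - y) * h y + (1 - (z - x) / (z - y)) * h z) =
  (z - x) * h y + (x - y) * h z by field; rewrite gt_eqF.
Qed.

(** The slope is the supremum of the left difference quotients at x, which every right quotient
    bounds. It is nonnegative because h increases; at x = 0, where there is nothing to the left,
    slope 0 works for the same reason. *)
Lemma convex_supporting_line (x : R) : 0 <= x ->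
  exists2 m, 0 <= m & forall y, 0 <= y -> h x + m * y <= h y + m * x.
Proof.
move=> x0.
have hmono a b : 0 <= a -> a <= b -> h a <= h b.
  by move=> a0 ab; apply: h_incr => //; rewrite in_itv /= andbT// (le_trans a0).
have [->|xN0] := eqVneq x 0.
  by exists 0 => // y y0; rewrite !mul0r !addr0 hmono.
have xp : 0 < x by rewrite lt_neqAle eq_sym xN0.
pose S := [set (h x - h y) / (x - y) | y in [set y | 0 <= y < x]].
have ubS z : x < z -> ubound S ((h z - h x) / (z - x)).
  move=> xz _ [y /= /andP[y0 yx] <-].
  rewrite ler_pdivrMr ?subr_gt0// mulrAC ler_pdivlMr ?subr_gt0//.
  have := convex_three_points y0 (ltW yx) (ltW xz); nra.
have S0 : S ((h x - h 0) / (x - 0)) by exists 0 => //=; rewrite lexx.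
have hS : has_sup S.
  split; first by exists ((h x - h 0) / (x - 0)).
  by exists ((h (x + 1) - h x) / (x + 1 - x)); apply: ubS; rewrite ltrDl.
have m0 : 0 <= sup S.
  apply: le_trans (ub_le_sup hS.2 S0).
  by rewrite divr_ge0 ?subr0 ?subr_ge0// hmono.
exists (sup S) => // y y0; case: (ltgtP y x) => [yx|xy|->] //.
  have : (h x - h y) / (x - y) <= sup S.
    by apply: (ub_le_sup hS.2); exists y => //=; rewrite y0.
  rewrite ler_pdivrMr ?subr_gt0//; lra.
have : sup S <= (h y - h x) / (y - x) by apply: ge_sup (ubS _ xy); case: hS.
rewrite ler_pdivlMr ?subr_gt0//; lra.
Qed.

End supporting_line.

(** * Mean values of analytic functions *)

Section strict_differentiability.
Context {R : realType}.
Local Notation C := (Cplx R).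
Implicit Types (f : C -> C) (z w : C).

Lemma cplx_cvgP (s : nat -> C) (l : C) :
  (s @ \oo --> l) <-> forall eps : R, 0 < eps ->
    exists N, forall n, (N <= n)%N -> normc (l - s n) < eps.
Proof.
split=> [/cvgrPdist_lt cv eps eps0|cv].
  have [|N _ hN] := cv (eps%:C : R[i]); first by rewrite ltcR.
  by exists N => n /hN /=; rewrite normc_def ltcR; case: (l - s n).
apply/cvgrPdist_lt => -[e i]; rewrite ltcE /= => /andP[/eqP -> e0].
have [N hN] := cv _ e0; exists N => // n /= /hN.
by rewrite normc_def ltcE eqxx /=; case: (l - s n).
Qed.

(* Strict differentiability makes the derivative continuous without
   differentiating the power series term by term. *)
Definition strict_deriv f z (b : C) : Prop :=
  exists s L : R, [/\ 0 < s, 0 <= L & forall w w' : C,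
    normc w < s -> normc w' < s ->
    normc (f (z + w) - f (z + w') - b * (w - w')) <=
      L * (normc w + normc w') * normc (w - w')].

Lemma normc_subX_le (w w' : C) (s : R) n : normc w <= s -> normc w' <= s ->
  normc (w ^+ n.+1 - w' ^+ n.+1) <= n.+1%:R * s ^+ n * normc (w - w').
Proof.
move=> ws ws'; have s0 : 0 <= s by rewrite (le_trans _ ws)// normc_ge0.
elim: n => [|n IH]; first by rewrite !expr1 expr0 !mul1r.
have -> : w ^+ n.+2 - w' ^+ n.+2 =
    w * (w ^+ n.+1 - w' ^+ n.+1) + (w - w') * w' ^+ n.+1.
  by rewrite !(exprS _ n.+1); ring.
apply: (le_trans (normcD _ _)); rewrite !normcM.
have h1 : normc w * normc (w ^+ n.+1 - w' ^+ n.+1) <=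
    s * (n.+1%:R * s ^+ n * normc (w - w')).
  by rewrite ler_pM ?normc_ge0.
have h2 : normc (w - w') * normc (w' ^+ n.+1) <= normc (w - w') * s ^+ n.+1.
  by rewrite ler_wpM2l ?normc_ge0// normcX lerXn2r ?nnegrE ?normc_ge0.
apply: (le_trans (lerD h1 h2)).
rewrite (_ : n.+2%:R = n.+1%:R + 1 :> R); last by rewrite -natr1.
rewrite exprS le_eqVlt; apply/orP; left; apply/eqP; ring.
Qed.

Lemma series_terms_bounded (a : nat -> C) (x : C) (l : C) :
  series (fun n => a n * x ^+ n) @ \oo --> l ->
  exists2 M : R, 0 <= M & forall n, normc (a n) * normc x ^+ n <= M.
Proof.
move=> /cplx_cvgP /(_ 1 ltr01) [N hN].
pose M : R := 2 + \sum_(0 <= n < N) normc (a n) * normc x ^+ n.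
have t0 n : 0 <= normc (a n) * normc x ^+ n.
  by rewrite mulr_ge0 ?exprn_ge0 ?normc_ge0.
have S0 : 0 <= \sum_(0 <= n < N) normc (a n) * normc x ^+ n by exact: sumr_ge0.
exists M => [|n]; first by rewrite addr_ge0.
have [nN|Nn] := ltnP n N.
  rewrite /M big_mkord (bigD1 (Ordinal nN))//= addrCA lerDl addr_ge0//.
  exact: sumr_ge0.
rewrite -normcX -normcM.
have -> : a n * x ^+ n = (l - series (fun n => a n * x ^+ n) n) -
    (l - series (fun n => a n * x ^+ n) n.+1).
  by rewrite !seriesEnat /= big_nat_recr //=; ring.
have h1 := hN _ Nn; have h2 := hN _ (leqW Nn).
have := normcD (l - series (fun n => a n * x ^+ n) n)
  (- (l - series (fun n => a n * x ^+ n) n.+1)).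
rewrite normcN /M => h3; apply: (le_trans h3); lra.
Qed.

(** The terms of the series are bounded at one point x0 inside the disk of convergence, so for
    arguments below x0 / 8 the terms of degree at least 2 change by a geometric series times (|w| +
    |w'|) |w - w'|. The estimate is made on partial sums and passed to the limit at the end. *)
Lemma analytic_strict_deriv (D : set C) f z : analytic_on D f -> D z ->
  exists b, strict_deriv f z b.
Proof.
move=> + Dz => /(_ _ Dz) [rho rho0 [a ha]].
pose x0 : R := rho / 2.
have x00 : 0 < x0 by rewrite divr_gt0.
have x0rho : x0 < rho by rewrite ltr_pdivrMr// ltr_pMr// ltr1n.
clearbody x0.
have [M M0 hM] : exists2 M : R, 0 <= M & forall n, normc (a n) * x0 ^+ n <= M.
  have := ha (z + x0%:C); rewrite addrAC subrr add0r normc_real gtr0_norm//.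
  move=> /(_ x0rho) /series_terms_bounded [M M0].
  by rewrite normc_real gtr0_norm// => hM; exists M.
(* Degree k + 2 contributes 4 M / x0^2 times 2^(-k), from k + 2 <= 4 2^k and |w| + |w'| <= x0 / 4;
   summing over k doubles the constant. *)
pose L : R := 8 * M / x0 ^+ 2.
exists (a 1), (x0 / 8), L; split; [by rewrite divr_gt0|by rewrite divr_ge0 ?mulr_ge0 ?exprn_ge0// ltW|].
move=> w w' ws ws'; set s := normc w + normc w'.
have sw : normc w <= s by rewrite lerDl normc_ge0.
have sw' : normc w' <= s by rewrite lerDr normc_ge0.
have s0 : 0 <= s by rewrite addr_ge0 ?normc_ge0.
have s4 : s <= x0 / 4 by rewrite /s; lra.
have cvw (v : C) : normc v < x0 / 8 ->
    series (fun n => a n * v ^+ n) @ \oo --> f (z + v).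
  move=> vs; have := ha (z + v); rewrite addrAC subrr add0r; apply.
  by apply: (lt_trans vs); lra.
pose S (v : C) n := series (fun n => a n * v ^+ n) n.
have termle k : normc (a k.+2 * (w ^+ k.+2 - w' ^+ k.+2)) <=
    4 * M / x0 ^+ 2 * s * normc (w - w') * 2^-1 ^+ k.
  rewrite normcM; apply: (le_trans (ler_wpM2l (normc_ge0 _) (normc_subX_le _ sw sw'))).
  have akle : normc (a k.+2) <= M / x0 ^+ k.+2 by rewrite ler_pdivlMr ?exprn_gt0.
  have sle : s ^+ k.+1 <= s * (x0 / 4) ^+ k.
    by rewrite exprS ler_wpM2l// lerXn2r ?nnegrE// divr_ge0// ltW.
  have x0N : x0 != 0 by rewrite gt_eqF.
  have k2 : k.+2%:R <= 4 * 2 ^+ k :> R.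
    elim: k {akle sle} => [|k IH]; first by rewrite expr0 mulr1 ler_nat.
    have e1 : 1 <= 2 ^+ k :> R by rewrite exprn_ege1// ler1n.
    rewrite exprS -natr1; lra.
  rewrite mulrA.
  have -> : 4 * M / x0 ^+ 2 * s * normc (w - w') * 2^-1 ^+ k =
    M / x0 ^+ k.+2 * (4 * 2 ^+ k * (s * (x0 / 4) ^+ k)) * normc (w - w').
    rewrite (exprS x0 k.+1) (exprS x0 k) expr_div_n exprVn.
    have -> : 4 ^+ k = 2 ^+ k * 2 ^+ k :> R by rewrite -exprMn -natrM.
    move: (expf_neq0 k x0N) (expf_neq0 k (lt0r_neq0 (ltr0Sn R 1))).
    move: (x0 ^+ k) (2 ^+ k) (normc (w - w')) => X Y v X0 Y0.
    by field; rewrite X0 Y0 x0N.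
  apply: ler_wpM2r; first exact: normc_ge0.
  apply: ler_pM => //; rewrite ?normc_ge0 ?mulr_ge0 ?exprn_ge0//.
  by apply: ler_pM => //; rewrite exprn_ge0.
have Sdiff n : normc (S w n.+2 - S w' n.+2 - a 1 * (w - w')) <=
    L * s * normc (w - w') * (1 - 2^-1 ^+ n).
  elim: n => [|n IH].
    rewrite expr0 subrr mulr0 /S !seriesEnat /= !big_nat_recr //= !big_geq//.
    have zero (A X Y : C) : 0 + A * 1 + a 1 * X - (0 + A * 1 + a 1 * Y) - a 1 * (X - Y) = 0.
      by ring.
    by rewrite !expr0 !expr1 zero normc0.
  have -> : S w n.+3 - S w' n.+3 - a 1 * (w - w') =
    (S w n.+2 - S w' n.+2 - a 1 * (w - w')) + a n.+2 * (w ^+ n.+2 - w' ^+ n.+2).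
    have step (A X B Y c d : C) : A + c * X - (B + c * Y) - d = A - B - d + c * (X - Y).
      by ring.
    by rewrite /S !seriesEnat /= ![\sum_(0 <= k < n.+3) _]big_nat_recr //= step.
  apply: (le_trans (normcD _ _)); apply: (le_trans (lerD IH (termle n))).
  rewrite /L (exprS 2^-1 n); move: (2^-1 ^+ n) (normc _) => q v.
  by rewrite le_eqVlt; apply/orP; left; apply/eqP; field; rewrite gt_eqF.
apply/ler_addgt0Pr => eps eps0.
have e2 : 0 < eps / 2 by rewrite divr_gt0.
have [N1 hN1] := (cplx_cvgP _ _).1 (cvw _ ws) _ e2.
have [N2 hN2] := (cplx_cvgP _ _).1 (cvw _ ws') _ e2.
pose n := maxn N1 N2.
have h1 := hN1 n.+2 (leqW (leqW (leq_maxl _ _))).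
have h2 := hN2 n.+2 (leqW (leqW (leq_maxr _ _))).
have split_diff (A B A' B' E : C) :
    A - B - E = (A' - B' - E) + ((A - A') - (B - B')) by ring.
rewrite (split_diff _ _ (S w n.+2) (S w' n.+2)).
apply: (le_trans (normcD _ _)); apply: lerD.
  apply: (le_trans (Sdiff n)); apply: ler_piMr.
    by rewrite !mulr_ge0 ?invr_ge0 ?exprn_ge0 ?normc_ge0// ltW.
  by rewrite gerBl exprn_ge0// invr_ge0.
apply: (le_trans (normcD _ _)); rewrite normcN [leRHS]splitr.
exact: lerD (ltW h1) (ltW h2).
Qed.

Definition econt (f : C -> C) (z : C) : Prop := forall eps : R, 0 < eps ->
  exists2 d : R, 0 < d & forall w, normc (w - z) < d -> normc (f w - f z) < eps.

Lemma strict_deriv_cont f z b : strict_deriv f z b -> econt f z.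
Proof.
move=> [s [L [s0 L0 h]]] eps eps0.
pose K : R := L * s + normc b + 1.
have K0 : 0 < K by rewrite ltr_wpDl// addr_ge0 ?normc_ge0// mulr_ge0// ltW.
exists (Num.min s (eps / K)) => [|w]; first by rewrite lt_min s0 divr_gt0.
rewrite lt_min ltr_pdivlMr// => /andP[ws we].
have := h (w - z) 0 ws; rewrite normc0 => /(_ s0).
rewrite !addr0 subr0 [z + _]addrC subrK => h1.
have -> : f w - f z = (f w - f z - b * (w - z)) + b * (w - z) by rewrite subrK.
apply: (le_lt_trans (normcD _ _)); rewrite normcM; apply: le_lt_trans we.
apply: (le_trans (lerD h1 (lexx _))); rewrite /K.
have := normc_ge0 (w - z); have := normc_ge0 b.
have : L * normc (w - z) <= L * s by rewrite ler_wpM2l// ltW.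
nra.
Qed.

(** Both g(v) t and g(z) t approximate f(v + t) - f(v), the latter with error L (2 |v - z| + t) t by
    strict differentiability at z. Dividing by t and letting t -> 0 gives |g(v) - g(z)| <= 2 L |v -
    z|. *)
Lemma strict_deriv_deriv_cont (D : set C) f g z :
  (forall z, D z -> strict_deriv f z (g z)) ->
  (exists2 d : R, 0 < d & forall w, normc (w - z) < d -> D w) -> econt g z.
Proof.
move=> fg [d d0 hd] eps eps0.
have Dz : D z by apply: hd; rewrite subrr normc0.
have [s [L [s0 L0 h]]] := fg z Dz.
pose K := 4 * L + 1.
have K0 : 0 < K by rewrite ltr_wpDl// mulr_ge0.
exists (Num.min (d) (Num.min (s / 2) (eps / K))) => [|v].
  by rewrite !lt_min d0 !divr_gt0.
rewrite !lt_min => /and3P[vd vs ve].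
have [s1 [L1 [s10 L10 h1]]] := fg v (hd _ vd).
set w := v - z in vd vs ve.
have vE : v = z + w by rewrite /w addrC subrK.
apply: le_lt_trans (_ : 2 * L * normc w < _); last first.
  move: ve; rewrite ltr_pdivlMr// /K; have := normc_ge0 w; nra.
apply/ler_addgt0Pr => e e0.
pose t := Num.min (s / 2) (Num.min (s1 / 2) (e / (L + L1 + 1))).
have t0 : 0 < t by rewrite !lt_min !divr_gt0// ltr_wpDl// addr_ge0.
have : t <= s / 2 /\ t <= s1 / 2 /\ t <= e / (L + L1 + 1) by rewrite !ge_min !lexx !orbT.
rewrite [t <= e / _]ler_pdivlMr ?ltr_wpDl ?addr_ge0// => -[ts [ts1 te]].
have nt : normc (t%:C : C) = t by rewrite normc_real gtr0_norm.
have := h (w + t%:C) w ltac:(by apply: le_lt_trans (normcD _ _) _; rewrite nt; lra) ltac:(lra).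
have := h1 t%:C 0 ltac:(by rewrite nt; lra) ltac:(by rewrite normc0).
rewrite normc0 !addr0 subr0 nt addrA -vE [w + _]addrC addrK => ha hb.
have : normc (g v - g z) * t <= (2 * L * normc w + e) * t.
  rewrite -{1}nt -normcM.
  have -> : (g v - g z) * t%:C = (f (v + t%:C) - f v - g z * t%:C) -
    (f (v + t%:C) - f v - g v * t%:C) by ring.
  apply: (le_trans (normcD _ _)); rewrite normcN.
  have hb' : normc (f (v + t%:C) - f v - g z * t%:C) <= L * (normc w + t + normc w) * t.
    rewrite [t%:C + w]addrC nt in hb; apply: (le_trans hb).
    rewrite ler_wpM2r ?(ltW t0)// ler_wpM2l// lerD2r.
    by rewrite -{2}nt normcD.
  apply: (le_trans (lerD hb' ha)).
  rewrite -mulrDl ler_wpM2r ?(ltW t0)//; nra.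
by rewrite ler_pM2r.
Qed.

Lemma analytic_deriv (D : set C) f :
  (forall z, D z -> exists2 d : R, 0 < d & forall w, normc (w - z) < d -> D w) ->
  analytic_on D f ->
  exists g, forall z, D z -> strict_deriv f z (g z) /\ econt g z.
Proof.
move=> Do fa.
have /choice [g hg] z : exists b, D z -> strict_deriv f z b.
  have [Dz|nD] := pselect (D z); last by exists 0.
  by have [b hb] := analytic_strict_deriv fa Dz; exists b.
exists g => z Dz; split; first exact: hg.
exact: strict_deriv_deriv_cont hg (Do _ Dz).
Qed.

End strict_differentiability.

(** * Measurability, iterated integrals and derivatives on the plane *)

Section plane_measurability.
Context {R : realType}.
Local Notation leb := (@lebesgue_measure R).
Local Notation leb2 := (leb \x leb)%E.

Lemma open_plane_measurable (O : set (R * R)) : open O ->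
  measurable (O : set (plane R)).
Proof.
move=> oO.
pose box (q : rat * rat * (rat * rat)) : set (plane R) :=
  (`]ratr q.1.1, ratr q.1.2[%classic `*` `]ratr q.2.1, ratr q.2.2[%classic).
have -> : O = \bigcup_q (if `[< box q `<=` O >] then box q else set0).
  apply/seteqP; split=> [[x y] Oxy|[x y] [q _]]; last first.
    by case: ifPn => // /asboolP; apply.
  have /= [[A B] [/= nA nB] AB] : nbhs (x, y) O by exact: open_nbhs_nbhs.
  move: nA nB => /nbhs_ballP[e /= e0 eA] /nbhs_ballP[e' /= e'0 e'B].
  have [q1] := rat_in_itvoo (ltac:(by rewrite ltrBlDr ltrDl) : x - e < x).
  have [q2] := rat_in_itvoo (ltac:(by rewrite ltrDl) : x < x + e).
  have [q3] := rat_in_itvoo (ltac:(by rewrite ltrBlDr ltrDl) : y - e' < y).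
  have [q4] := rat_in_itvoo (ltac:(by rewrite ltrDl) : y < y + e').
  rewrite !in_itv /= => /andP[h1 h2] /andP[h3 h4] /andP[h5 h6] /andP[h7 h8].
  exists (q1, q2, (q3, q4)); first by [].
  rewrite asboolT; first by split; rewrite /= in_itv /=; apply/andP; split.
  move=> [a b] [/=]; rewrite !in_itv /= => /andP[a1 a2] /andP[b1 b2].
  apply: AB; split => /=.
    by apply: eA; rewrite /ball /= ltr_distl; apply/andP; split; lra.
  by apply: e'B; rewrite /ball /= ltr_distl; apply/andP; split; lra.
apply: countable_bigcupT_measurable; first exact: countableP.
move=> q; case: ifP => // _; apply: measurableX; exact: measurable_itv.
Qed.

(** Continuity is assumed at the points of D within the whole plane, so on D the preimage of an open
    ray coincides with its own interior, a measurable set. *)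
Lemma plane_continuous_measurable (D : set (plane R)) (F : R * R -> R) :
  measurable D -> (forall p, D p -> {for p, continuous F}) -> measurable_fun D F.
Proof.
move=> mD cF; apply: (measurability _ (RGenOInfty.measurableE R)) => //.
move=> _ [_ [x ->] <-].
have -> : D `&` F @^-1` `]x, +oo[%classic =
    D `&` (F @^-1` `]x, +oo[%classic)^°.
  apply/seteqP; split=> [p [Dp Fp]|p [Dp Fp]]; split => //; last exact: interior_subset Fp.
  by apply: (cF p Dp); apply: open_nbhs_nbhs; split => //; exact: interval_open.
apply: measurableI => //; apply: open_plane_measurable; exact: open_interior.
Qed.

Section box.
Variables a b c d : R.
Hypotheses (ab : a < b) (cd : c < d).
Let I : set R := `[a, b]%classic.
Let J : set R := `[c, d]%classic.

Lemma measurable_box : measurable (I `*` J : set (plane R)).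
Proof. by apply: measurableX; exact: measurable_itv. Qed.

Lemma box_measure : leb2 (I `*` J : set (plane R)) = ((b - a) * (d - c))%:E.
Proof.
rewrite product_measure1E; [|exact: measurable_itv|exact: measurable_itv].
have lI : leb I = (b - a)%:E by rewrite /I lebesgue_measure_itv /= lte_fin ab.
have lJ : leb J = (d - c)%:E by rewrite /J lebesgue_measure_itv /= lte_fin cd.
exact: (f_equal2 mule lI lJ).
Qed.

Lemma box_bounded (F : R * R -> R) :
  (forall p, (I `*` J) p -> {for p, continuous F}) ->
  exists2 M, 0 <= M & forall p, (I `*` J) p -> `|F p| <= M.
Proof.
move=> cF.
have cI : compact (I `*` J : set (R * R)).
  by apply: compact_setX; exact: segment_compact.
have : {within I `*` J, continuous F}.
  by apply: continuous_in_subspaceT => p; rewrite inE; exact: cF.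
move=> /(@continuous_compact _ _ F _) /(_ cI) /compact_bounded [M [_ hM]].
exists (`|M| + 1); first by rewrite addr_ge0.
move=> p Ip; apply: (hM (`|M| + 1)); first by rewrite ltr_pwDr// ler_norm.
by exists p.
Qed.

Lemma box_integrable (F : R * R -> R) :
  (forall p, (I `*` J) p -> {for p, continuous F}) ->
  leb2.-integrable (I `*` J : set (plane R)) (EFin \o F).
Proof.
move=> cF; apply: measurable_bounded_integrable.
- exact: measurable_box.
- by have := ltry ((b - a) * (d - c)); rewrite -box_measure.
- by apply: plane_continuous_measurable => //; exact: measurable_box.
- have [M M0 hM] := box_bounded cF.
  exists M; split; first exact: num_real.
  by move=> x Mx p Ip; apply: le_trans (ltW Mx); exact: hM.
Qed.

Lemma box_integral_zero_y (F : R * R -> R) :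
  (forall p, (I `*` J) p -> {for p, continuous F}) ->
  (forall x, I x -> \int[leb]_(y in J) (F (x, y))%:E = 0)%E ->
  (\int[leb2]_(p in (I `*` J : set (plane R))) (F p)%:E = 0)%E.
Proof.
move=> cF F0; rewrite integral_mkcond.
have /(integrable_mkcond _ measurable_box) h := box_integrable cF.
rewrite -(integral12_prod_meas1 h).
apply: integral0_eq => x _; rewrite /fubini_F.
have [Ix|nIx] := pselect (I x).
  rewrite -(F0 x Ix) [in RHS]integral_mkcond; apply: eq_integral => y _.
  rewrite /patch; congr (if _ then _ else _).
  by apply/idP/idP; rewrite !inE => //; [case].
by apply: integral0_eq => y _; rewrite /patch ifF//; apply/negP; rewrite inE => -[].
Qed.

Lemma box_integral_zero_x (F : R * R -> R) :
  (forall p, (I `*` J) p -> {for p, continuous F}) ->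
  (forall y, J y -> \int[leb]_(x in I) (F (x, y))%:E = 0)%E ->
  (\int[leb2]_(p in (I `*` J : set (plane R))) (F p)%:E = 0)%E.
Proof.
move=> cF F0; rewrite integral_mkcond.
have /(integrable_mkcond _ measurable_box) h := box_integrable cF.
rewrite -(integral21_prod_meas1 h).
apply: integral0_eq => y _; rewrite /fubini_G.
have [Jy|nJy] := pselect (J y).
  rewrite -(F0 y Jy) [in RHS]integral_mkcond; apply: eq_integral => x _.
  rewrite /patch; congr (if _ then _ else _).
  by apply/idP/idP; rewrite !inE => //; [case].
by apply: integral0_eq => x _; rewrite /patch ifF//; apply/negP; rewrite inE => -[].
Qed.

End box.

Lemma integral_derivative_zero (a b : R) (F f : R -> R) : a < b ->
  (forall s, a <= s <= b -> is_derive s 1 F (f s)) ->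
  (forall s, a <= s <= b -> {for s, continuous f}) -> F a = F b ->
  (\int[leb]_(s in `[a, b]) (f s)%:E = 0)%E.
Proof.
move=> ab dF cf Fab.
have cF s : a <= s <= b -> {for s, continuous F}.
  by move=> /dF h; apply: differentiable_continuous; apply/derivable1_diffP; case: h.
rewrite (@continuous_FTC2 _ f F)//.
- by rewrite Fab -EFinD subrr.
- by apply: continuous_in_subspaceT => s; rewrite inE /= in_itv; exact: cf.
- split=> [s||].
  + by rewrite in_itv /= => /andP[/ltW h1 /ltW h2]; case: (dF s); rewrite ?h1.
  + apply: cvg_at_right_filter; apply: cF; by rewrite lexx ltW.
  + apply: cvg_at_left_filter; apply: cF; by rewrite lexx ltW.
- move=> s; rewrite in_itv /= => /andP[/ltW h1 /ltW h2]; rewrite derive1E.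
  by case: (dF s); rewrite ?h1.
Qed.

(** A quadratic error bound is what strict differentiability leaves along a line, and what max(0,
    s)^2 satisfies uniformly, at the corner as well. *)
Lemma is_derive_quadratic (F : R -> R) (s dF e L : R) : 0 < e -> 0 <= L ->
  (forall h, `|h| < e -> `|F (s + h) - F s - dF * h| <= L * h ^+ 2) ->
  is_derive s 1 F dF.
Proof.
move=> e0 L0 hF.
have cv : h^-1 *: (F (h *: 1 + s) - F s) @[h --> 0^'] --> dF.
  apply/cvgrPdist_le => eps eps0; near=> h.
  have h0 : h != 0 by near: h; exact: nbhs_dnbhs_neq.
  have he : `|h| < e by near: h; apply: dnbhs0_lt.
  have hL : `|h| < eps / (L + 1) by near: h; apply: dnbhs0_lt; rewrite divr_gt0// ltr_wpDl.
  have hp : 0 < `|h| by rewrite normr_gt0.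
  rewrite -(ler_pM2r hp) -normrM.
  have -> : (dF - h^-1 *: (F (h *: 1 + s) - F s)) * h = - (F (s + h) - F s - dF * h).
    rewrite /GRing.scale /= mulr1 [h + s]addrC.
    by move: (F (s + h)) (F s) => A B; field.
  rewrite normrN; apply: (le_trans (hF _ he)).
  rewrite -real_normK ?num_real// expr2 mulrA ler_wpM2r//.
  move: hL; rewrite ltr_pdivlMr ?ltr_wpDl//; nra.
split; first by apply/cvg_ex; exists dF.
exact: cvg_lim.
Unshelve. all: by end_near. Qed.

(** Squaring removes the corner of the positive part, which is why the averaging kernel is the
    square of [cap]. *)
Lemma is_derive_sqr_max0 (s : R) :
  is_derive s 1 (fun s => Num.max 0 s ^+ 2) (2 * Num.max 0 s).
Proof.
apply: (@is_derive_quadratic _ _ _ 1 1) => // h _; rewrite ler_norml mul1r.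
by apply/andP; split; case: (leP 0 s) => ?; case: (leP 0 (s + h)) => ?; nra.
Qed.

End plane_measurability.

(** * A mean value property for a differentiable averaging kernel *)

Section mean_value.
Context {R : realType}.
Local Notation C := (Cplx R).
Local Notation leb := (@lebesgue_measure R).
Local Notation leb2 := (leb \x leb)%E.

Lemma strict_deriv_curve (f : C -> C) (gam : R -> C) (s : R) (b d : C) :
  (forall h, gam (s + h) = gam s + h%:C * b) -> strict_deriv f (gam s) d ->
  is_derive s 1 (fun s => complex.Re (f (gam s))) (complex.Re (d * b)) /\
  is_derive s 1 (fun s => complex.Im (f (gam s))) (complex.Im (d * b)).
Proof.
move=> hgam [e [L [e0 L0 hf]]].
have b1 : 0 < normc b + 1 by rewrite ltr_wpDl ?normc_ge0.
have est h : `|h| < e / (normc b + 1) ->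
    normc (f (gam (s + h)) - f (gam s) - h%:C * (d * b)) <= L * normc b ^+ 2 * h ^+ 2.
  rewrite ltr_pdivlMr// => he.
  have := hf (h%:C * b) 0; rewrite normc0 normcM normc_real => hf'.
  have {}he : `|h| * normc b < e.
    by apply: le_lt_trans he; rewrite ler_wpM2l// lerDl.
  have := hf' he e0; rewrite !addr0 subr0 -hgam mulrCA => /le_trans; apply.
  by rewrite normcM normc_real -(real_normK (num_real h)) le_eqVlt;
    apply/orP; left; apply/eqP; ring.
have L0' : 0 <= L * normc b ^+ 2 by rewrite mulr_ge0// sqr_ge0.
have e0' : 0 < e / (normc b + 1) by rewrite divr_gt0.
split; apply: (is_derive_quadratic e0' L0') => h /est; apply: le_trans.
  apply: le_trans (normc_Re _); rewrite !Re_add !Re_opp [complex.Re (h%:C * _)]Re_mul /=.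
  by rewrite mul0r subr0 mulrC.
apply: le_trans (normc_Im _); rewrite !Im_add !Im_opp [complex.Im (h%:C * _)]Im_mul /=.
by rewrite mul0r addr0 mulrC.
Qed.

Lemma econt_plane_continuous (g : C -> C) (l : R * R -> C) (p : R * R) (K : R) :
  econt g (l p) -> 0 <= K ->
  (forall q, normc (l q - l p) <= K * (`|q.1 - p.1| + `|q.2 - p.2|)) ->
  {for p, continuous (fun q => complex.Re (g (l q)))} /\
  {for p, continuous (fun q => complex.Im (g (l q)))}.
Proof.
move=> cg K0 hl.
have key eps : 0 < eps -> \forall q \near p, normc (g (l q) - g (l p)) < eps.
  move=> eps0; have [d d0 hd] := cg _ eps0.
  have e0 : 0 < d / (2 * K + 1) by rewrite divr_gt0// ltr_wpDl// mulr_ge0.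
  apply: filterS (nbhsx_ballx p _ e0) => q [].
  rewrite /ball /= distrC => h1; rewrite distrC => h2; apply: hd.
  apply: (le_lt_trans (hl q)); move: h1 h2.
  rewrite !ltr_pdivlMr ?ltr_wpDl ?mulr_ge0//.
  have := normr_ge0 (q.1 - p.1); have := normr_ge0 (q.2 - p.2); nra.
split; apply/cvgrPdist_lt => eps /key; apply: filterS => q; apply: le_lt_trans.
  by rewrite -Re_opp -Re_add normc_distC; exact: normc_Re.
by rewrite -Im_opp -Im_add normc_distC; exact: normc_Im.
Qed.

Lemma fst_cont (p : R * R) : {for p, continuous (fun q : R * R => q.1)}.
Proof. exact: cvg_fst. Qed.

Lemma snd_cont (p : R * R) : {for p, continuous (fun q : R * R => q.2)}.
Proof. exact: cvg_snd. Qed.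

(* [cap rho z] is the positive part of rho^2 - |p - z|^2; its square is the
   averaging kernel. *)
Definition cap (rho : R) (z : C) (p : R * R) : R :=
  Num.max 0 (rho ^+ 2 - (p.1 - complex.Re z) ^+ 2 - (p.2 - complex.Im z) ^+ 2).

Lemma cap_ge0 rho z p : 0 <= cap rho z p.
Proof. by rewrite /cap le_max lexx. Qed.

Lemma cap_cont rho z p : {for p, continuous (cap rho z)}.
Proof.
apply: continuous_max; first exact: cst_continuous.
have c1 : {for p, continuous (fun q : R * R => q.1 - complex.Re z)}.
  by apply: continuousB; [exact: fst_cont|exact: cst_continuous].
have c2 : {for p, continuous (fun q : R * R => q.2 - complex.Im z)}.
  by apply: continuousB; [exact: snd_cont|exact: cst_continuous].
apply: continuousB; first apply: continuousB; first exact: cst_continuous.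
  exact: (continuousM c1 c1).
exact: (continuousM c2 c2).
Qed.

Lemma cap2_cont rho z p : {for p, continuous (fun q => cap rho z q ^+ 2)}.
Proof. exact: (continuousM (@cap_cont rho z p) (@cap_cont rho z p)). Qed.

Variables (f g : C -> C) (z0 : C) (rho : R).
Hypothesis rho0 : 0 < rho.
Hypothesis fg : forall z, normc (z - z0) < 2 * rho ->
  strict_deriv f z (g z) /\ econt g z.

Let x0 := complex.Re z0.
Let y0 := complex.Im z0.
Let I : set R := `[x0 - rho, x0 + rho]%classic.
Let J : set R := `[y0 - rho, y0 + rho]%classic.
Let Q := (I `*` J : set (plane R)).
Let xlt : x0 - rho < x0 + rho. Proof. by rewrite ltrBlDr -addrA ltrDl addr_gt0. Qed.
Let ylt : y0 - rho < y0 + rho. Proof. by rewrite ltrBlDr -addrA ltrDl addr_gt0. Qed.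

Let l (t : R) (p : R * R) : C := z0 + t%:C * (pt (p : plane R) - z0).

Let lE t p : l t p = (x0 + t * (p.1 - x0)) +i* (y0 + t * (p.2 - y0)).
Proof.
rewrite /l /x0 /y0; case: z0 => a b; case: p => x y /=.
by apply/eqP; rewrite eq_complex /=; apply/andP; split; apply/eqP => /=; ring.
Qed.

Let l_lip t p q : normc (l t q - l t p) <= `|t| * (`|q.1 - p.1| + `|q.2 - p.2|).
Proof.
have -> : l t q - l t p = (t%:C : C) * ((q.1 - p.1) +i* (q.2 - p.2)).
  rewrite !lE; apply/eqP; rewrite eq_complex /=.
  by apply/andP; split; apply/eqP => /=; ring.
rewrite normcM normc_real ler_wpM2l//.
rewrite -(@ler_pXn2r _ 2) ?nnegrE ?normc_ge0 ?addr_ge0// normc_sqr /=.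
rewrite -(real_normK (num_real (q.1 - p.1))) -(real_normK (num_real (q.2 - p.2))).
move: (normr_ge0 (q.1 - p.1)) (normr_ge0 (q.2 - p.2)).
move: `|q.1 - p.1| `|q.2 - p.2| => a b a0 b0.
by rewrite sqrrD lerD2r lerDl mulrn_wge0// mulr_ge0.
Qed.

Let QP p : Q p -> (`|p.1 - x0| <= rho) * (`|p.2 - y0| <= rho).
Proof.
by move=> []; rewrite /I /J /= !in_itv /= !ler_distl => -> ->.
Qed.

(** Corners of the square lie at distance sqrt(2) rho from z0, and 5/4 sqrt(2) < 2. Admitting |t| up
    to 5/4 leaves an open interval around [0, 1] for differentiation under the integral. *)
Let l_in t p : Q p -> `|t| <= 5 / 4 -> normc (l t p - z0) < 2 * rho.
Proof.
move=> /QP [hx hy] ht.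
have -> : l t p - z0 = (t%:C : C) * ((p.1 - x0) +i* (p.2 - y0)).
  rewrite lE /x0 /y0; case: z0 => a b; apply/eqP; rewrite eq_complex /=.
  by apply/andP; split; apply/eqP => /=; ring.
rewrite -(@ltr_pXn2r _ 2) ?nnegrE ?normc_ge0 ?mulr_ge0 ?ltW//.
rewrite normcM exprMn normc_real normc_sqr /=.
rewrite -(real_normK (num_real (p.1 - x0))) -(real_normK (num_real (p.2 - y0))).
have h1 : `|p.1 - x0| ^+ 2 <= rho ^+ 2 by rewrite lerXn2r ?nnegrE// ltW.
have h2 : `|p.2 - y0| ^+ 2 <= rho ^+ 2 by rewrite lerXn2r ?nnegrE// ltW.
have h3 : `|t| ^+ 2 <= (5 / 4) ^+ 2 by rewrite lerXn2r ?nnegrE.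
have r2 : 0 < rho ^+ 2 by rewrite exprn_gt0.
apply: (@le_lt_trans _ _ ((5 / 4) ^+ 2 * (rho ^+ 2 + rho ^+ 2))).
  by rewrite ler_pM ?sqr_ge0 ?addr_ge0 ?sqr_ge0// lerD.
rewrite exprMn; lra.
Qed.

Let phi p := cap rho z0 p ^+ 2.
Let Dt t p := phi p * (complex.Re (g (l t p)) * (p.1 - x0) - complex.Im (g (l t p)) * (p.2 - y0)).

Let px_cont p : {for p, continuous (fun q : R * R => q.1 - x0)}.
Proof. by apply: continuousB; [exact: fst_cont|exact: cst_continuous]. Qed.

Let py_cont p : {for p, continuous (fun q : R * R => q.2 - y0)}.
Proof. by apply: continuousB; [exact: snd_cont|exact: cst_continuous]. Qed.

Let g_cont t p : Q p -> `|t| <= 5 / 4 ->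
  {for p, continuous (fun q => complex.Re (g (l t q)))} /\
  {for p, continuous (fun q => complex.Im (g (l t q)))}.
Proof.
move=> Qp ht; apply: (@econt_plane_continuous _ _ _ `|t|) => //.
by have [] := fg (l_in Qp ht).
Qed.

Let f_cont t p : Q p -> `|t| <= 5 / 4 ->
  {for p, continuous (fun q => complex.Re (f (l t q)))} /\
  {for p, continuous (fun q => complex.Im (f (l t q)))}.
Proof.
move=> Qp ht; apply: (@econt_plane_continuous _ _ _ `|t|) => //.
by have [/strict_deriv_cont] := fg (l_in Qp ht).
Qed.

Let cap0x p : Q p -> (p.1 = x0 - rho) \/ (p.1 = x0 + rho) -> cap rho z0 p = 0.
Proof.
move=> _ h; rewrite /cap; apply/max_idPl; rewrite -/x0 -/y0.
have : (p.1 - x0) ^+ 2 = rho ^+ 2 by case: h => ->; ring.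
by move=> ->; rewrite subrr sub0r oppr_le0 sqr_ge0.
Qed.

Let cap0y p : Q p -> (p.2 = y0 - rho) \/ (p.2 = y0 + rho) -> cap rho z0 p = 0.
Proof.
move=> _ h; rewrite /cap; apply/max_idPl; rewrite -/x0 -/y0.
have : (p.2 - y0) ^+ 2 = rho ^+ 2 by case: h => ->; ring.
by move=> ->; rewrite addrAC subrr sub0r oppr_le0 sqr_ge0.
Qed.

Let cap_dx (x y : R) : is_derive x 1 (fun x => cap rho z0 (x, y) ^+ 2)
  (- 4 * (x - x0) * cap rho z0 (x, y)).
Proof.
have h : is_derive x 1 (fun x : R => rho ^+ 2 - (x - x0) ^+ 2 - (y - y0) ^+ 2)
    (- 2 * (x - x0)).
  apply: (@is_derive_quadratic _ _ _ _ 1 1) => // h _.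
  rewrite mul1r -[leRHS]ger0_norm ?sqr_ge0// -[leRHS]normrN le_eqVlt.
  by apply/orP; left; apply/eqP; congr `|_|; ring.
apply: (is_derive_eq (is_derive1_comp (is_derive_sqr_max0 _) h)).
rewrite /cap /= -/x0 -/y0; ring.
Qed.

Let cap_dy (x y : R) : is_derive y 1 (fun y => cap rho z0 (x, y) ^+ 2)
  (- 4 * (y - y0) * cap rho z0 (x, y)).
Proof.
have h : is_derive y 1 (fun y : R => rho ^+ 2 - (x - x0) ^+ 2 - (y - y0) ^+ 2)
    (- 2 * (y - y0)).
  apply: (@is_derive_quadratic _ _ _ _ 1 1) => // h _.
  rewrite mul1r -[leRHS]ger0_norm ?sqr_ge0// -[leRHS]normrN le_eqVlt.
  by apply/orP; left; apply/eqP; congr `|_|; ring.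
apply: (is_derive_eq (is_derive1_comp (is_derive_sqr_max0 _) h)).
rewrite /cap /= -/x0 -/y0; ring.
Qed.

Let slice_y (F : R * R -> R) (x y : R) : {for (x, y), continuous F} ->
  {for y, continuous (fun y => F (x, y))}.
Proof.
move=> cF; apply: (@continuous_comp _ _ _ (fun y => (x, y)) F) => //.
exact: (cvg_pair (cvg_cst x) (@cvg_id _ (nbhs y))).
Qed.

Let slice_x (F : R * R -> R) (x y : R) : {for (x, y), continuous F} ->
  {for x, continuous (fun x => F (x, y))}.
Proof.
move=> cF; apply: (@continuous_comp _ _ _ (fun x => (x, y)) F) => //.
exact: (cvg_pair (@cvg_id _ (nbhs x)) (cvg_cst y)).
Qed.

(* t times the integrand is d/dy (W A) - d/dx (W B), where W = Im f o l, and
   A = (x - x0) phi and B = (y - y0) phi satisfy dA/dy = dB/dx and vanish on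
   the horizontal, resp. vertical, sides of the square. *)
Let Fy t (p : R * R) := complex.Im (g (l t p) * (t%:C * (0 +i* 1) : C)) * ((p.1 - x0) * phi p)
  + complex.Im (f (l t p)) * ((p.1 - x0) * (- 4 * (p.2 - y0) * cap rho z0 p)).
Let Fx t (p : R * R) := complex.Im (g (l t p) * (t%:C : C)) * ((p.2 - y0) * phi p)
  + complex.Im (f (l t p)) * ((p.2 - y0) * (- 4 * (p.1 - x0) * cap rho z0 p)).

Let FyE t p : Fy t p = t * complex.Re (g (l t p)) * ((p.1 - x0) * phi p)
  + complex.Im (f (l t p)) * ((p.1 - x0) * (- 4 * (p.2 - y0) * cap rho z0 p)).
Proof. by rewrite /Fy Im_mul /=; congr (_ * _ + _); ring. Qed.

Let FxE t p : Fx t p = t * complex.Im (g (l t p)) * ((p.2 - y0) * phi p)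
  + complex.Im (f (l t p)) * ((p.2 - y0) * (- 4 * (p.1 - x0) * cap rho z0 p)).
Proof. by rewrite /Fx Im_mul /=; congr (_ * _ + _); ring. Qed.

Let Fy_cont t p : Q p -> `|t| <= 5 / 4 -> {for p, continuous (Fy t)}.
Proof.
move=> Qp ht; have [gR gI] := g_cont Qp ht; have [fR fI] := f_cont Qp ht.
have -> : Fy t = (fun p => t * complex.Re (g (l t p)) * ((p.1 - x0) * phi p)
  + complex.Im (f (l t p)) * ((p.1 - x0) * (- 4 * (p.2 - y0) * cap rho z0 p))).
  by apply/funext => q; exact: FyE.
have cp := @cap_cont rho z0 p; have cp2 := @cap2_cont rho z0 p.
have c4 : {for p, continuous (fun _ : R * R => - 4 : R)} by exact: cst_continuous.
have ct : {for p, continuous (fun _ : R * R => t)} by exact: cst_continuous.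
apply: continuousD.
  by apply: continuousM; apply: continuousM => //; exact: px_cont.
apply: continuousM => //; apply: continuousM; first exact: px_cont.
by apply: continuousM => //; apply: continuousM => //; exact: py_cont.
Qed.

Let Fx_cont t p : Q p -> `|t| <= 5 / 4 -> {for p, continuous (Fx t)}.
Proof.
move=> Qp ht; have [gR gI] := g_cont Qp ht; have [fR fI] := f_cont Qp ht.
have -> : Fx t = (fun p => t * complex.Im (g (l t p)) * ((p.2 - y0) * phi p)
  + complex.Im (f (l t p)) * ((p.2 - y0) * (- 4 * (p.1 - x0) * cap rho z0 p))).
  by apply/funext => q; exact: FxE.
have cp := @cap_cont rho z0 p; have cp2 := @cap2_cont rho z0 p.
have c4 : {for p, continuous (fun _ : R * R => - 4 : R)} by exact: cst_continuous.
have ct : {for p, continuous (fun _ : R * R => t)} by exact: cst_continuous.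
apply: continuousD.
  by apply: continuousM; apply: continuousM => //; exact: py_cont.
apply: continuousM => //; apply: continuousM; first exact: py_cont.
by apply: continuousM => //; apply: continuousM => //; exact: px_cont.
Qed.

Let Fy_int t : `|t| <= 5 / 4 -> (\int[leb2]_(p in Q) (Fy t p)%:E = 0)%E.
Proof.
move=> ht; apply: (box_integral_zero_y xlt ylt) => [p Qp|x Ix]; first exact: Fy_cont.
have Jy y : y0 - rho <= y <= y0 + rho -> Q (x, y).
  by move=> h; split=> //=; rewrite in_itv.
apply: (@integral_derivative_zero _ _ _
  (fun y => complex.Im (f (l t (x, y))) * ((x - x0) * phi (x, y)))) => //.
- move=> y /Jy Qy; have [fgy _] := fg (l_in Qy ht).
  have hl h : l t (x, y + h) = l t (x, y) + h%:C * (t%:C * (0 +i* 1) : C).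
    rewrite !lE; apply/eqP; rewrite eq_complex /=.
    by apply/andP; split; apply/eqP => /=; ring.
  have [_ d1] := strict_deriv_curve (gam := fun y => l t (x, y)) hl fgy.
  have d2 : is_derive y 1 (fun y => (x - x0) * phi (x, y))
     ((x - x0) * (- 4 * (y - y0) * cap rho z0 (x, y))).
    exact: (is_deriveZ (x - x0) (cap_dy x y)).
  apply: (is_derive_eq (is_deriveM d1 d2)); rewrite /GRing.scale /=.
  by rewrite /Fy /=; ring.
- by move=> y /Jy Qy; apply: slice_y; exact: Fy_cont.
- rewrite /phi !cap0y ?expr0n ?mulr0//; try by [right|left].
    by apply: Jy; rewrite lexx andbT ltW.
  by apply: Jy; rewrite lexx ltW.
Qed.

Let Fx_int t : `|t| <= 5 / 4 -> (\int[leb2]_(p in Q) (Fx t p)%:E = 0)%E.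
Proof.
move=> ht; apply: (box_integral_zero_x xlt ylt) => [p Qp|y Jy]; first exact: Fx_cont.
have Ix x : x0 - rho <= x <= x0 + rho -> Q (x, y).
  by move=> h; split=> //=; rewrite in_itv.
apply: (@integral_derivative_zero _ _ _
  (fun x => complex.Im (f (l t (x, y))) * ((y - y0) * phi (x, y)))) => //.
- move=> x /Ix Qx; have [fgx _] := fg (l_in Qx ht).
  have hl h : l t (x + h, y) = l t (x, y) + h%:C * (t%:C : C).
    rewrite !lE; apply/eqP; rewrite eq_complex /=.
    by apply/andP; split; apply/eqP => /=; ring.
  have [_ d1] := strict_deriv_curve (gam := fun x => l t (x, y)) hl fgx.
  have d2 : is_derive x 1 (fun x => (y - y0) * phi (x, y))
     ((y - y0) * (- 4 * (x - x0) * cap rho z0 (x, y))).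
    exact: (is_deriveZ (y - y0) (cap_dx x y)).
  apply: (is_derive_eq (is_deriveM d1 d2)); rewrite /GRing.scale /=.
  by rewrite /Fx /=; ring.
- by move=> x /Ix Qx; apply: slice_x; exact: Fx_cont.
- rewrite /phi !cap0x ?expr0n ?mulr0//; try by [right|left].
    by apply: Ix; rewrite lexx andbT ltW.
  by apply: Ix; rewrite lexx ltW.
Qed.

(** The divergence integrates to zero on the square, but it equals t times the integrand, hence t <>
    0. The case t = 0 does not arise later, because the mean value theorem looks only at interior
    points of [0, 1]. *)
Let Dt_int t : `|t| <= 5 / 4 -> t != 0 -> Rintegral leb2 Q (Dt t) = 0.
Proof.
move=> ht tN.
have iy : leb2.-integrable Q (EFin \o Fy t).
  by apply: (box_integrable xlt ylt) => p Qp; exact: Fy_cont.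
have ix : leb2.-integrable Q (EFin \o Fx t).
  by apply: (box_integrable xlt ylt) => p Qp; exact: Fx_cont.
have mQ : measurable Q by exact: measurable_box.
have h : Rintegral leb2 Q (fun p => t^-1 * (Fy t p - Fx t p)) = 0.
  rewrite RintegralZl//; last first.
    have := integrableB mQ iy ix; apply: eq_integrable => // p _.
  by rewrite RintegralB// /Rintegral Fy_int// Fx_int//= subrr mulr0.
rewrite -[RHS]h; apply: eq_Rintegral => p _.
by rewrite FyE FxE /Dt; field.
Qed.

Let cap_le p : cap rho z0 p <= rho ^+ 2.
Proof.
rewrite /cap ge_max sqr_ge0 /= -addrA gerDl -opprD oppr_le0.
by rewrite addr_ge0 ?sqr_ge0.
Qed.

Let G t p := complex.Re (f (l t p)) * phi p.

Let G_cont t p : Q p -> `|t| <= 5 / 4 -> {for p, continuous (G t)}.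
Proof.
move=> Qp ht; have [fR _] := f_cont Qp ht.
by apply: continuousM => //; exact: (@cap2_cont rho z0 p).
Qed.

Let G_derive (t : R) (p : R * R) : Q p -> `|t| <= 5 / 4 -> is_derive t 1 (G ^~ p) (Dt t p).
Proof.
move=> Qp ht; have [fgp _] := fg (l_in Qp ht).
have hl h : l (t + h) p = l t p + h%:C * (pt (p : plane R) - z0).
  rewrite /l; have -> : (t + h)%:C = t%:C + h%:C :> C by exact: rmorphD.
  by ring.
have [d1 _] := strict_deriv_curve (gam := fun t => l t p) hl fgp.
apply: (is_derive_eq (is_deriveM d1 (is_derive_cst (phi p) t 1))).
rewrite /GRing.scale /= mulr0 add0r /Dt Re_mul Re_add Im_add Re_opp Im_opp.
by rewrite -/x0 -/y0; ring.
Qed.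

Let Dt_bounded : exists2 M, 0 <= M & forall t p, Q p -> `|t| <= 5 / 4 -> `|Dt t p| <= M.
Proof.
pose s := 5 / 4 * rho.
have s0 : 0 < s by rewrite /s mulr_gt0.
have gc q : (`[x0 - s, x0 + s]%classic `*` `[y0 - s, y0 + s]%classic) q ->
    {for q, continuous (fun q => complex.Re (g (pt (q : plane R))))} /\
    {for q, continuous (fun q => complex.Im (g (pt (q : plane R))))}.
  move=> Q2; apply: (@econt_plane_continuous g (fun q => pt (q : plane R)) q 1) => //.
    apply: (fg _).2.
    move: Q2 => [] /=; rewrite !in_itv /= -!ler_distl => hx hy.
    rewrite -(@ltr_pXn2r _ 2) ?nnegrE ?normc_ge0 ?mulr_ge0 ?ltW//.
    rewrite normc_sqr Re_add Im_add Re_opp Im_opp -/x0 -/y0 /=.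
    rewrite -(real_normK (num_real (q.1 - x0))) -(real_normK (num_real (q.2 - y0))).
    have h1 : `|q.1 - x0| ^+ 2 <= s ^+ 2 by rewrite lerXn2r ?nnegrE// ltW.
    have h2 : `|q.2 - y0| ^+ 2 <= s ^+ 2 by rewrite lerXn2r ?nnegrE// ltW.
    apply: (le_lt_trans (lerD h1 h2)); rewrite /s !exprMn.
    have r2 : 0 < rho ^+ 2 by rewrite exprn_gt0.
    lra.
  move=> q'; rewrite mul1r.
  have -> : pt (q' : plane R) - pt (q : plane R) = ((q'.1 - q.1) +i* (q'.2 - q.2) : C).
    by apply/eqP; rewrite eq_complex /=; apply/andP; split; apply/eqP.
  rewrite -(@ler_pXn2r _ 2) ?nnegrE ?normc_ge0 ?addr_ge0// normc_sqr /=.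
  rewrite -(real_normK (num_real (q'.1 - q.1))) -(real_normK (num_real (q'.2 - q.2))).
  by rewrite sqrrD lerD2r lerDl mulrn_wge0// mulr_ge0.
have [M1 M10 hM1] := box_bounded (fun q Q2 => (gc q Q2).1).
have [M2 M20 hM2] := box_bounded (fun q Q2 => (gc q Q2).2).
exists (rho ^+ 2 ^+ 2 * ((M1 + M2) * rho)).
  by rewrite !mulr_ge0 ?sqr_ge0 ?addr_ge0// ltW.
move=> t p Qp ht; have [hx hy] := QP Qp.
have lbox : (`[x0 - s, x0 + s]%classic `*` `[y0 - s, y0 + s]%classic)
    (x0 + t * (p.1 - x0), y0 + t * (p.2 - y0)).
  split; rewrite /= in_itv /= -ler_distl addrAC subrr add0r normrM /s.
    by rewrite ler_pM.
  by rewrite ler_pM.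
have h1 := hM1 _ lbox; have h2 := hM2 _ lbox.
rewrite /Dt normrM ler_pM//.
  rewrite ger0_norm ?sqr_ge0// lerXn2r ?nnegrE ?sqr_ge0 ?cap_ge0//.
rewrite lE; apply: (le_trans (ler_normB _ _)).
by rewrite !normrM mulrDl lerD// ler_pM.
Qed.

(** The average of Re f(z0 + t (p - z0)) against the kernel has zero derivative in t on (0, 1). At t
    = 1 it is the average of Re f, and at t = 0 it is Re f(z0) times the mass of the kernel. *)
Lemma mean_value : Rintegral leb2 Q (fun p => complex.Re (f (pt p)) * cap rho z0 p ^+ 2) =
  complex.Re (f z0) * Rintegral leb2 Q (fun p => cap rho z0 p ^+ 2).
Proof.
have mQ : measurable Q by exact: measurable_box.
have [M M0 hM] := Dt_bounded.
pose F t := Rintegral leb2 Q (G t).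
have It (t : R) : `](- (5 / 4)), (5 / 4)[%classic t -> `|t| <= 5 / 4.
  by rewrite /= in_itv /= => /andP[h1 h2]; rewrite ler_norml !ltW.
have intG (t : R) : `](- (5 / 4)), (5 / 4)[%classic t -> leb2.-integrable Q (EFin \o G t).
  by move=> /It ht; apply: (box_integrable xlt ylt) => p Qp; exact: G_cont.
have derG (t : R) p : `](- (5 / 4)), (5 / 4)[%classic t -> Q p -> derivable (G ^~ p) t 1.
  by move=> /It ht Qp; case: (G_derive Qp ht).
have intM : leb2.-integrable Q (EFin \o cst M).
  by apply: (box_integrable xlt ylt) => p _; exact: cst_continuous.
have d1E (t : R) p : `](- (5 / 4)), (5 / 4)[%classic t -> Q p -> partial1of2 G t p = Dt t p.
  by move=> /It ht Qp; rewrite partial1of2E; case: (G_derive Qp ht).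
have ubG (t : R) p : `](- (5 / 4)), (5 / 4)[%classic t -> Q p -> `|partial1of2 G t p| <= cst M p.
  by move=> It' Qp; rewrite d1E//; apply: hM => //; exact: It.
have dF (t : R) : `](- (5 / 4)), (5 / 4)[%classic t -> derivable F t 1 /\
    (t != 0 -> 'D_1 F t = 0).
  move=> ht; split.
    exact: (derivable_under_integral mQ ht intG derG (fun=> M0) intM ubG).
  move=> tN; rewrite -derive1E.
  rewrite (differentiation_under_integral mQ ht intG derG (fun=> M0) intM ubG).
  rewrite -[RHS](Dt_int (It _ ht) tN); apply: eq_Rintegral => p; rewrite inE => Qp.
  exact: d1E.
have sub01 (t : R) : 0 <= t <= 1 -> `](- (5 / 4)), (5 / 4)[%classic t.
  by rewrite /= in_itv /= => /andP[h1 h2]; apply/andP; split; lra.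
have F01 : F 1 = F 0.
  have [||c + hc] := @MVT _ F (fun=> 0) 0 1 ltr01.
  - move=> t; rewrite in_itv /= => /andP[h1 h2].
    have [d1 d2] := dF t (sub01 t ltac:(by rewrite !ltW)).
    by split => //; rewrite d2// gt_eqF.
  - apply: continuous_in_subspaceT => t; rewrite inE /= in_itv /= => ht.
    have [d1 _] := dF t (sub01 t ht).
    by apply: differentiable_continuous; exact/derivable1_diffP.
  - by move=> _; apply/eqP; rewrite -subr_eq0 hc mul0r.
have G1 : F 1 = Rintegral leb2 Q (fun p => complex.Re (f (pt p)) * cap rho z0 p ^+ 2).
  apply: eq_Rintegral => p _; rewrite /G /l /phi.
  have -> : (1 : R)%:C = 1 :> C by [].
  by rewrite mul1r addrC subrK.
rewrite -G1 F01 -RintegralZl//.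
  apply: eq_Rintegral => p _; rewrite /G /l /phi.
  have -> : (0 : R)%:C = 0 :> C by [].
  by rewrite mul0r addr0.
by apply: (box_integrable xlt ylt) => p _; exact: (@cap2_cont rho z0 p).
Qed.

End mean_value.

Section integral_comparison.
Context d (T : measurableType d) (R : realType) (mu : {measure set T -> \bar R}).

(* No measurability is required: the integral of a nonnegative function is a
   supremum over the simple functions below it. *)
Lemma ge0_le_integral_patch (A B : set T) (f g : T -> \bar R) :
  (forall x, A x -> 0 <= f x)%E -> (forall x, B x -> 0 <= g x)%E ->
  (forall x, (f \_ A) x <= (g \_ B) x)%E ->
  (\int[mu]_(x in A) f x <= \int[mu]_(x in B) g x)%E.
Proof.
move=> f0 g0 fg; rewrite !ge0_integralE//.
apply: ge_ereal_sup => _ [h hf <-]; apply: ereal_sup_ubound.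
by exists h => // x; apply: le_trans (hf x) (fg x).
Qed.

Lemma ge0_le_integral_in (A : set T) (f g : T -> \bar R) :
  (forall x, A x -> 0 <= f x)%E -> (forall x, A x -> f x <= g x)%E ->
  (\int[mu]_(x in A) f x <= \int[mu]_(x in A) g x)%E.
Proof.
move=> f0 fg; apply: ge0_le_integral_patch => //.
  by move=> x Ax; apply: le_trans (f0 x Ax) (fg x Ax).
by move=> x; rewrite /patch; case: ifPn => //; rewrite inE; exact: fg.
Qed.

End integral_comparison.

(** * Submean and Lipschitz estimates on Euclidean disks *)

Section local_estimates.
Context {R : realType}.
Local Notation C := (Cplx R).
Local Notation leb := (@lebesgue_measure R).
Local Notation leb2 := (leb \x leb)%E.

Definition eball (z : C) (r : R) : set C := [set w | normc (w - z) < r].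

Definition square (z : C) (r : R) : set (plane R) :=
  (`[complex.Re z - r, complex.Re z + r]%classic `*`
   `[complex.Im z - r, complex.Im z + r]%classic).

Lemma squareP z r p : square z r p <->
  `|p.1 - complex.Re z| <= r /\ `|p.2 - complex.Im z| <= r.
Proof. by rewrite /square /= !in_itv /= !ler_distl; split=> [[-> ->]|[-> ->]]. Qed.

Definition smooth_on (D : set C) (f : C -> C) : Prop :=
  exists g, forall z, D z -> strict_deriv f z (g z) /\ econt g z.

Lemma smooth_on_sub (D D' : set C) f : D' `<=` D -> smooth_on D f -> smooth_on D' f.
Proof. by move=> DD' [g hg]; exists g => z /DD'; exact: hg. Qed.

Lemma smooth_on_affine (D : set C) f (c k : C) : smooth_on D f ->
  smooth_on D (fun z => c * (f z - k)).
Proof.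
move=> [g hg]; exists (fun z => c * g z) => z Dz; have [[s [L [s0 L0 h]]] cg] := hg z Dz.
split.
  exists s, (normc c * L); split=> // [|w w' ws ws'].
    by rewrite mulr_ge0 ?normc_ge0.
  have -> : c * (f (z + w) - k) - c * (f (z + w') - k) - c * g z * (w - w') =
    c * (f (z + w) - f (z + w') - g z * (w - w')) by ring.
  rewrite normcM -!mulrA ler_wpM2l ?normc_ge0// mulrA; exact: h.
move=> eps eps0.
have c1 : 0 < normc c + 1 by rewrite ltr_wpDl ?normc_ge0.
have [d d0 hd] := cg (eps / (normc c + 1)) (divr_gt0 eps0 c1).
exists d => // w /hd; rewrite -mulrBr normcM ltr_pdivlMr//.
have := normc_ge0 c; have := normc_ge0 (g w - g z); nra.
Qed.

Lemma pt_lip (p q : R * R) :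
  normc (pt (q : plane R) - pt (p : plane R)) <= 1 * (`|q.1 - p.1| + `|q.2 - p.2|).
Proof.
rewrite mul1r.
have -> : pt (q : plane R) - pt (p : plane R) = ((q.1 - p.1) +i* (q.2 - p.2) : C).
  by apply/eqP; rewrite eq_complex /=; apply/andP; split; apply/eqP.
rewrite -(@ler_pXn2r _ 2) ?nnegrE ?normc_ge0 ?addr_ge0// normc_sqr /=.
rewrite -(real_normK (num_real (q.1 - p.1))) -(real_normK (num_real (q.2 - p.2))).
by rewrite sqrrD lerD2r lerDl mulrn_wge0// mulr_ge0.
Qed.

Lemma econt_pt_cont (f : C -> C) p : econt f (pt (p : plane R)) ->
  {for p, continuous (fun q : R * R => complex.Re (f (pt (q : plane R))))} /\
  {for p, continuous (fun q : R * R => complex.Im (f (pt (q : plane R))))}.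
Proof. by move=> cf; apply: (@econt_plane_continuous R f (fun q => pt (q : plane R)) p 1) => // q; exact: pt_lip. Qed.

Lemma econt_normc2_cont (f : C -> C) p : econt f (pt (p : plane R)) ->
  {for p, continuous (fun q : R * R => normc (f (pt (q : plane R))) ^+ 2)}.
Proof.
move=> /econt_pt_cont [cR cI].
have -> : (fun q : R * R => normc (f (pt (q : plane R))) ^+ 2) =
  (fun q : R * R => complex.Re (f (pt (q : plane R))) * complex.Re (f (pt (q : plane R)))
    + complex.Im (f (pt (q : plane R))) * complex.Im (f (pt (q : plane R)))).
  by apply/funext => q; rewrite normc_sqr !expr2.
by apply: continuousD; apply: continuousM.
Qed.

Lemma measurable_square z r : measurable (square z r).
Proof. exact: measurable_box. Qed.

Lemma square_integrable z r (F : R * R -> R) : 0 < r ->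
  (forall p, square z r p -> {for p, continuous F}) ->
  leb2.-integrable (square z r) (EFin \o F).
Proof. by move=> r0; apply: box_integrable; lra. Qed.

Lemma square_ball z r p : 0 < r -> square z r p -> normc (pt p - z) < 2 * r.
Proof.
move=> r0 /squareP [hx hy].
rewrite -(@ltr_pXn2r _ 2) ?nnegrE ?normc_ge0 ?mulr_ge0 ?ltW//.
rewrite normc_sqr Re_add Im_add Re_opp Im_opp /=.
rewrite -(real_normK (num_real (p.1 - complex.Re z))) -(real_normK (num_real (p.2 - complex.Im z))).
have h1 : `|p.1 - complex.Re z| ^+ 2 <= r ^+ 2 by rewrite lerXn2r ?nnegrE// ltW.
have h2 : `|p.2 - complex.Im z| ^+ 2 <= r ^+ 2 by rewrite lerXn2r ?nnegrE// ltW.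
apply: (le_lt_trans (lerD h1 h2)); rewrite exprMn.
have r2 : 0 < r ^+ 2 by rewrite exprn_gt0.
lra.
Qed.

Lemma normc_pt_sub z (p : plane R) :
  normc (pt p - z) ^+ 2 = (p.1 - complex.Re z) ^+ 2 + (p.2 - complex.Im z) ^+ 2.
Proof. by rewrite normc_sqr Re_add Im_add Re_opp Im_opp. Qed.

Lemma ball_square z r p : normc (pt p - z) <= r -> square z r p.
Proof.
move=> h; apply/squareP.
have := normc_Re (pt p - z); have := normc_Im (pt p - z).
by rewrite Re_add Im_add Re_opp Im_opp => h1 h2; split; apply: le_trans h.
Qed.

Lemma cap_out (r : R) z (p : plane R) : r <= normc (pt p - z) -> 0 <= r -> cap r z p = 0.
Proof.
move=> h r0; apply/max_idPl; rewrite -addrA -opprD -normc_pt_sub subr_le0.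
by rewrite lerXn2r ?nnegrE ?normc_ge0.
Qed.

Lemma cap_le (r : R) z p : cap r z p <= r ^+ 2.
Proof.
rewrite /cap ge_max sqr_ge0 /= -addrA gerDl -opprD oppr_le0.
by rewrite addr_ge0 ?sqr_ge0.
Qed.

Lemma Rintegral_square_cst z r (k : R) : 0 < r ->
  Rintegral leb2 (square z r) (fun=> k) = k * (4 * r ^+ 2).
Proof.
move=> r0; rewrite /Rintegral integral_cst; last exact: measurable_square.
have := @box_measure R (complex.Re z - r) (complex.Re z + r) (complex.Im z - r) (complex.Im z + r) ltac:(lra) ltac:(lra).
rewrite -/(square z r) => h.
transitivity (fine (k%:E * ((complex.Re z + r - (complex.Re z - r)) * (complex.Im z + r - (complex.Im z - r)))%:E)%E).
  by rewrite -h.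
by rewrite /=; ring.
Qed.

(** On the concentric square of half the size the cap is at least r^2 / 2, and that square has area
    r^2. *)
Lemma cap_integral_ge z r : 0 < r ->
  r ^+ 6 / 4 <= Rintegral leb2 (square z r) (fun p => cap r z p ^+ 2).
Proof.
move=> r0.
have r20 : 0 < r / 2 by rewrite divr_gt0.
have icap : leb2.-integrable (square z r) (EFin \o (fun p => cap r z p ^+ 2)).
  by apply: square_integrable => // p _; exact: cap2_cont.
have -> : r ^+ 6 / 4 = Rintegral leb2 (square z (r / 2)) (fun=> r ^+ 4 / 4).
  by rewrite Rintegral_square_cst//; field.
rewrite /Rintegral; apply: fine_le.
- apply: integrable_fin_num; first exact: measurable_square.
  by apply: square_integrable => // p _; exact: cst_continuous.
- by apply: integrable_fin_num => //; exact: measurable_square.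
apply: ge0_le_integral_patch.
- by move=> p _; rewrite lee_fin divr_ge0// exprn_ge0// ltW.
- by move=> p _; rewrite lee_fin sqr_ge0.
move=> p; rewrite /patch.
case: ifPn => [|_]; last by case: ifP => // _; rewrite lee_fin sqr_ge0.
rewrite inE => /squareP [h1 h2].
have s : square z r p by apply/squareP; split; [apply: le_trans h1 _|apply: le_trans h2 _]; lra.
rewrite ifT ?inE// lee_fin.
have -> : r ^+ 4 / 4 = (r ^+ 2 / 2) ^+ 2 by field.
rewrite lerXn2r ?nnegrE ?cap_ge0 ?divr_ge0 ?sqr_ge0// /cap le_max; apply/orP; right.
rewrite -(real_normK (num_real (p.1 - complex.Re z))) -(real_normK (num_real (p.2 - complex.Im z))).
have h3 : `|p.1 - complex.Re z| ^+ 2 <= (r / 2) ^+ 2 by rewrite lerXn2r ?nnegrE// ltW.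
have h4 : `|p.2 - complex.Im z| ^+ 2 <= (r / 2) ^+ 2 by rewrite lerXn2r ?nnegrE// ltW.
have -> : r ^+ 2 / 2 = r ^+ 2 - (r / 2) ^+ 2 - (r / 2) ^+ 2 by field.
lra.
Qed.

Lemma smooth_econt (D : set C) f z : smooth_on D f -> D z -> econt f z.
Proof. by move=> [g hg] /hg [/strict_deriv_cont]. Qed.

Lemma measurable_eball z r : measurable (pt @^-1` eball z r).
Proof.
apply: open_plane_measurable; rewrite openE => p pB.
have h0 : 0 < (r - normc (pt p - z)) / 2 by rewrite divr_gt0// subr_gt0.
rewrite /interior; apply: filterS (nbhsx_ballx p _ h0) => q [].
rewrite /ball /= distrC => h1; rewrite distrC => h2.
apply: (le_lt_trans (normc_dist_triangle (pt p) _ _)).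
by have := pt_lip p q; lra.
Qed.

(** The mean value property is applied to conj(f(z)) f; then 2 Re(conj(a) b) <= |a|^2 + |b|^2 under
    the average brings in |f|^2. The kernel is at most r^4, vanishes off the disk of radius r and
    has mass at least r^6 / 4, whence 4 / r^2. *)
Lemma submean f z r : 0 < r -> smooth_on (eball z (2 * r)) f ->
  ((normc (f z) ^+ 2)%:E <= (4 / r ^+ 2)%:E *
    \int[leb2]_(p in pt @^-1` eball z r) (normc (f (pt p)) ^+ 2)%:E)%E.
Proof.
move=> r0 sf.
have fc p : square z r p -> econt f (pt p).
  by move=> /(square_ball r0) pz; exact: smooth_econt sf pz.
pose f1 w := conjc (f z) * (f w - 0).
have sf1 : smooth_on (eball z (2 * r)) f1 by exact: smooth_on_affine.
have mS := measurable_square z r.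
pose c0 := Rintegral leb2 (square z r) (fun p => cap r z p ^+ 2).
have c0_ge : r ^+ 6 / 4 <= c0 by exact: cap_integral_ge.
have mv : Rintegral leb2 (square z r) (fun p => complex.Re (f1 (pt p)) * cap r z p ^+ 2) =
    normc (f z) ^+ 2 * c0.
  have [g hg] := sf1.
  rewrite (mean_value r0 hg); congr (_ * _).
  by rewrite /f1 subr0 mulrC mulc_conj.
have i1 : leb2.-integrable (square z r)
    (EFin \o (fun p => complex.Re (f1 (pt p)) * cap r z p ^+ 2)).
  apply: square_integrable => // p Sp; apply: continuousM; last exact: (@cap2_cont R r z p).
  by apply: (econt_pt_cont _).1; apply: smooth_econt sf1 _; exact: square_ball.
have i2 : leb2.-integrable (square z r) (EFin \o (fun p => normc (f (pt p)) ^+ 2 * cap r z p ^+ 2)).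
  apply: square_integrable => // p Sp; apply: continuousM; last exact: (@cap2_cont R r z p).
  by apply: econt_normc2_cont; exact: fc.
have i3 : leb2.-integrable (square z r) (EFin \o (fun p => cap r z p ^+ 2)).
  by apply: square_integrable => // p _; exact: cap2_cont.
pose I2 := Rintegral leb2 (square z r) (fun p => normc (f (pt p)) ^+ 2 * cap r z p ^+ 2).
have le1 : normc (f z) ^+ 2 * c0 <= 2^-1 * (normc (f z) ^+ 2 * c0 + I2).
  have i4 : leb2.-integrable (square z r) (EFin \o (fun p => normc (f z) ^+ 2 * cap r z p ^+ 2)).
    apply: square_integrable => // p _.
    by apply: continuousM; [exact: cst_continuous|exact: cap2_cont].
  rewrite -{1}mv /c0 /I2 -RintegralZl// -RintegralD// -RintegralZl//; last first.
    have := integrableD mS i4 i2.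
    by apply: eq_integrable.
  apply: le_Rintegral => //.
    have := integrableZl mS 2^-1 (integrableD mS i4 i2).
    by apply: eq_integrable.
  move=> p _; rewrite -mulrDl mulrA ler_wpM2r ?sqr_ge0//.
  apply: (le_trans (ler_norm _)); apply: (le_trans (normc_Re _)).
  rewrite /f1 subr0 normcM normc_conj.
  have := sqr_ge0 (normc (f z) - normc (f (pt p))).
  by move: (normc (f z)) (normc (f (pt p))) => a b; lra.
have le2 : normc (f z) ^+ 2 * (r ^+ 6 / 4) <= I2.
  apply: (@le_trans _ _ (normc (f z) ^+ 2 * c0)); first by rewrite ler_wpM2l ?sqr_ge0.
  lra.
have r6 : 0 < r ^+ 6 / 4 by rewrite divr_gt0 ?exprn_gt0.
have le3 : (I2%:E <= (r ^+ 4)%:E * \int[leb2]_(p in pt @^-1` eball z r) (normc (f (pt p)) ^+ 2)%:E)%E.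
  rewrite /I2 /Rintegral fineK; last first.
    by apply: integrable_fin_num.
  have mB := measurable_eball z r.
  rewrite -ge0_integralZl//; first last.
  - by rewrite lee_fin exprn_ge0// ltW.
  - by move=> p _; rewrite lee_fin sqr_ge0.
  - apply/measurable_EFinP; apply: plane_continuous_measurable => // p Bp.
    apply: econt_normc2_cont; apply: smooth_econt sf _.
    by apply: lt_le_trans Bp _; lra.
  apply: ge0_le_integral_patch.
  - by move=> p _; rewrite lee_fin mulr_ge0 ?sqr_ge0.
  - by move=> p _; rewrite mule_ge0// lee_fin ?sqr_ge0 ?exprn_ge0// ltW.
  move=> p; rewrite /patch; case: ifPn => [_|]; last first.
    by move=> _; case: ifP => // _; rewrite mule_ge0// lee_fin ?sqr_ge0 ?exprn_ge0// ltW.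
  case: ifPn => [_|]; last first.
    rewrite notin_setE => /negP; rewrite -leNgt => rp.
    by rewrite (cap_out rp (ltW r0)) expr0n mulr0.
  rewrite -EFinM lee_fin mulrC ler_wpM2r ?sqr_ge0//.
  have -> : r ^+ 4 = (r ^+ 2) ^+ 2 by rewrite -exprM.
  by rewrite lerXn2r ?nnegrE ?cap_ge0 ?sqr_ge0 ?cap_le.
have : ((normc (f z) ^+ 2)%:E <= (4 / r ^+ 6)%:E * I2%:E)%E.
  rewrite -EFinM lee_fin; move: le2; rewrite -ler_pdivlMr// => /le_trans; apply.
  by rewrite mulrC invf_div.
move=> /le_trans; apply.
have -> : (4 / r ^+ 2 = 4 / r ^+ 6 * r ^+ 4)%R by field; rewrite gt_eqF.
rewrite (EFinM (4 / r ^+ 6)) -muleA; apply: lee_wpmul2l => //.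
by rewrite lee_fin divr_ge0// exprn_ge0// ltW.
Qed.

Lemma cap_lip z w r p : 0 < r -> normc (z - w) <= r -> square z (2 * r) p ->
  `|cap r z p ^+ 2 - cap r w p ^+ 2| <= 20 * r ^+ 3 * normc (z - w).
Proof.
move=> r0 zw /squareP [hx hy].
have hRe := normc_Re (z - w); have hIm := normc_Im (z - w).
move: hRe hIm; rewrite Re_add Im_add Re_opp Im_opp => hRe hIm.
have max_lip (a b : R) : `|Num.max 0 a - Num.max 0 b| <= `|a - b|.
  by case: (leP 0 a) => ?; case: (leP 0 b) => ?; rewrite ler_normr ?subrr ?normr0;
    rewrite ?ler_norml; lra.
have d1 : `|cap r z p - cap r w p| <= 10 * r * normc (z - w).
  apply: (le_trans (max_lip _ _)).
  have -> : r ^+ 2 - (p.1 - complex.Re z) ^+ 2 - (p.2 - complex.Im z) ^+ 2 -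
      (r ^+ 2 - (p.1 - complex.Re w) ^+ 2 - (p.2 - complex.Im w) ^+ 2) =
    (complex.Re z - complex.Re w) * ((p.1 - complex.Re z) + (p.1 - complex.Re z) + (complex.Re z - complex.Re w))
    + (complex.Im z - complex.Im w) * ((p.2 - complex.Im z) + (p.2 - complex.Im z) + (complex.Im z - complex.Im w)).
    ring.
  have bnd (a b : R) : `|a| <= 2 * r -> `|b| <= normc (z - w) -> `|b * (a + a + b)| <= normc (z - w) * (5 * r).
    move=> ha hb; rewrite normrM ler_pM//.
    apply: (le_trans (ler_normD _ _)); apply: (le_trans (lerD (ler_normD _ _) (lexx _))); lra.
  apply: (le_trans (ler_normD _ _)); have := lerD (bnd _ _ hx hRe) (bnd _ _ hy hIm).
  move=> h; apply: (le_trans h); lra.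
rewrite subr_sqr normrM.
have d2 : `|cap r z p + cap r w p| <= 2 * r ^+ 2.
  rewrite ger0_norm ?addr_ge0 ?cap_ge0//; have := cap_le r z p; have := cap_le r w p; lra.
apply: (le_trans (ler_pM _ _ d1 d2)) => //.
by rewrite le_eqVlt; apply/orP; left; apply/eqP; ring.
Qed.

(** The function conj(f(z) - f(w)) (f - f(w)) equals |f(z) - f(w)|^2 at z and 0 at w, so subtracting
    its averages around z and w leaves an integral against a difference of kernels, at most 20 r^3
    |z - w|. With the area 16 r^2, the bound 2 S and the mass r^6 / 4 the constant is 2 20 16 4 =
    2560. *)
Lemma lipschitz_estimate f z w r S : 0 < r -> smooth_on (eball z (4 * r)) f ->
  (forall v, eball z (4 * r) v -> normc (f v) <= S) -> normc (z - w) <= r ->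
  normc (f z - f w) <= 2560 * S / r * normc (z - w).
Proof.
move=> r0 sf fS zw.
have r20 : 0 < 2 * r by rewrite mulr_gt0.
have zin : eball z (4 * r) z by rewrite /eball /= subrr normc0 mulr_gt0.
have win : eball z (4 * r) w by rewrite /eball /= normc_distC; apply: le_lt_trans zw _; lra.
have S0 : 0 <= S by apply: le_trans (normc_ge0 _) (fS _ zin).
set d := normc (f z - f w).
pose f1 v := conjc (f z - f w) * (f v - f w).
have sf1 : smooth_on (eball z (4 * r)) f1 by exact: smooth_on_affine.
have mS v s := measurable_square v s.
have sqz : square z r `<=` square z (2 * r).
  by move=> p /squareP [h1 h2]; apply/squareP; split; [apply: le_trans h1 _|apply: le_trans h2 _]; lra.
have sqw : square w r `<=` square z (2 * r).
  move=> p /squareP [h1 h2]; apply/squareP.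
  have := normc_Re (z - w); have := normc_Im (z - w); rewrite Re_add Im_add Re_opp Im_opp => h3 h4.
  split.
    apply: (le_trans (ler_distD (complex.Re w) _ _)).
    by rewrite [`|complex.Re w - _|]distrC; lra.
  apply: (le_trans (ler_distD (complex.Im w) _ _)).
  by rewrite [`|complex.Im w - _|]distrC; lra.
have fc p : square z (2 * r) p -> econt f1 (pt p).
  move=> /(square_ball r20) pz; apply: smooth_econt sf1 _.
  by rewrite /eball /=; apply: lt_le_trans pz _; lra.
(* Both averages are moved to one square of half-side 2 r; each kernel vanishes outside its own
   disk. *)
have extend v : square v r `<=` square z (2 * r) ->
    Rintegral leb2 (square v r) (fun p => complex.Re (f1 (pt p)) * cap r v p ^+ 2) =
    Rintegral leb2 (square z (2 * r)) (fun p => complex.Re (f1 (pt p)) * cap r v p ^+ 2).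
  move=> sub; rewrite /Rintegral integral_mkcond [in RHS]integral_mkcond.
  congr (fine _); apply: eq_integral => p _; rewrite /patch.
  case: ifPn => [|pv]; first by rewrite inE => /sub h; rewrite ifT ?inE.
  case: ifP => // _; have rp : r <= normc (pt p - v).
    rewrite leNgt; apply/negP => /ltW /ball_square h.
    by move: pv; rewrite notin_setE; apply.
  by rewrite (cap_out rp (ltW r0)) expr0n mulr0.
have mvz : Rintegral leb2 (square z (2 * r)) (fun p => complex.Re (f1 (pt p)) * cap r z p ^+ 2) =
    d ^+ 2 * Rintegral leb2 (square z r) (fun p => cap r z p ^+ 2).
  rewrite -extend//; have [g hg] := sf1.
  rewrite (mean_value (g := g) r0); last first.
    by move=> v vz; apply: hg; rewrite /eball /=; apply: lt_le_trans vz _; lra.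
  by congr (_ * _); rewrite /f1 mulrC mulc_conj.
have mvw : Rintegral leb2 (square z (2 * r)) (fun p => complex.Re (f1 (pt p)) * cap r w p ^+ 2) = 0.
  rewrite -extend//; have [g hg] := sf1.
  rewrite (mean_value (g := g) r0); last first.
    move=> v vw; apply: hg; rewrite /eball /=.
    apply: le_lt_trans (normc_dist_triangle w _ _) _.
    by rewrite [normc (w - z)]normc_distC; lra.
  by rewrite /f1 subrr mulr0 /= mul0r.
have icap v : leb2.-integrable (square z (2 * r))
    (EFin \o (fun p => complex.Re (f1 (pt p)) * cap r v p ^+ 2)).
  apply: square_integrable => // p Sp; apply: continuousM; last exact: (@cap2_cont R r v p).
  by apply: (econt_pt_cont _).1; exact: fc.
have key : d ^+ 2 * Rintegral leb2 (square z r) (fun p => cap r z p ^+ 2) <=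
    d * (2 * S) * (20 * r ^+ 3 * normc (z - w)) * (4 * (2 * r) ^+ 2).
  rewrite -mvz -[leLHS]subr0 -mvw -RintegralB// -(@Rintegral_square_cst z)//.
  apply: le_Rintegral => //.
  - have := integrableB (mS _ _) (icap z) (icap w); exact: eq_integrable.
  - by apply: square_integrable => // p _; exact: cst_continuous.
  move=> p Sp; rewrite -mulrBr; apply: (le_trans (ler_norm _)).
  rewrite normrM ler_pM//; last exact: cap_lip.
  apply: (le_trans (normc_Re _)); rewrite /f1 normcM normc_conj ler_wpM2l ?normc_ge0//.
  apply: (le_trans (normcD _ _)); rewrite normcN.
  have pin : eball z (4 * r) (pt p).
    by rewrite /eball /=; apply: lt_le_trans (square_ball r20 Sp) _; lra.
  by have := fS _ pin; have := fS _ win; lra.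
have alg (x y s : R) : s != 0 -> x * (2 * y) * (20 * s ^+ 3 * normc (z - w)) * (4 * (2 * s) ^+ 2) =
    x * (2560 * y / s * normc (z - w) * (s ^+ 6 / 4)).
  by move: (normc _) => n sN; field.
have c0 := cap_integral_ge z r0.
have [->|dN0] := eqVneq d 0.
  apply: mulr_ge0 (normc_ge0 _); apply: divr_ge0 (ltW r0).
  exact: mulr_ge0 (ler0n _ _) S0.
have d0 : 0 < d by rewrite lt_neqAle eq_sym dN0 normc_ge0.
have r6 : 0 < r ^+ 6 / 4 by rewrite divr_gt0 ?exprn_gt0.
rewrite -(ler_pM2r r6) -(ler_pM2l d0) mulrA -expr2.
apply: (@le_trans _ _ (d ^+ 2 * Rintegral leb2 (square z r) (fun p => cap r z p ^+ 2))).
  by rewrite ler_wpM2l ?sqr_ge0.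
by apply: (le_trans key); rewrite (alg _ _ _ (lt0r_neq0 r0)).
Qed.

End local_estimates.

(** * Weighted Bergman spaces *)

Section weights.
Context {R : realType}.
Local Notation C := (Cplx R).
Local Notation leb := (@lebesgue_measure R).
Local Notation leb2 := (leb \x leb)%E.
Implicit Types (z w : C) (u : C -> R).

Definition bdist z : R := 1 - normc z ^+ 2.

Lemma bdist_gt0 z : disk z -> 0 < bdist z.
Proof.
by rewrite /disk /= /bdist subr_gt0 => z1; rewrite expr_lt1// normc_ge0.
Qed.

Lemma disk_bdist z : 0 < bdist z -> disk z.
Proof. by rewrite /disk /= /bdist subr_gt0 expr_lt1// normc_ge0. Qed.

Lemma normc_segment z w (s : R) : 0 <= s <= 1 ->
  normc (z + s%:C * (w - z)) <= Num.max (normc z) (normc w).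
Proof.
move=> /andP[s0 s1].
have -> : z + s%:C * (w - z) = ((1 - s)%:C : C) * z + s%:C * w.
  have -> : (1 - s)%:C = 1 - s%:C :> C by exact: rmorphB.
  by ring.
apply: (le_trans (normcD _ _)); rewrite !normcM !normc_real !ger0_norm ?subr_ge0//.
set m := Num.max _ _.
have h1 : normc z <= m by rewrite le_max lexx.
have h2 : normc w <= m by rewrite le_max lexx orbT.
have : (1 - s) * normc z <= (1 - s) * m by rewrite ler_wpM2l ?subr_ge0.
have : s * normc w <= s * m by rewrite ler_wpM2l.
lra.
Qed.

Lemma bdist_segment z w (s m : R) : 0 <= s <= 1 -> m <= bdist z -> m <= bdist w ->
  m <= bdist (z + s%:C * (w - z)).
Proof.
move=> s01 mz mw; have h := normc_segment z w s01.
rewrite /bdist lerBrDr addrC -lerBrDr.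
have : normc (z + s%:C * (w - z)) ^+ 2 <= Num.max (normc z) (normc w) ^+ 2.
  by rewrite lerXn2r ?nnegrE ?normc_ge0// le_max normc_ge0.
move/le_trans; apply; move: mz mw; rewrite /bdist.
by case: (leP (normc z) (normc w)) => _; lra.
Qed.

Lemma bdist_lip z w d : 0 <= d <= 1 -> disk z -> normc (w - z) <= d * bdist z / 4 ->
  [/\ disk w, bdist w <= 2 * bdist z, bdist z <= 2 * bdist w & `|bdist w - bdist z| <= d * bdist z].
Proof.
move=> /andP[d0 d1] Dz wz; have b0 := bdist_gt0 Dz.
have z1 : normc z < 1 by [].
have z0 := normc_ge0 z; have w0 := normc_ge0 w.
have b1 : bdist z <= 2 * (1 - normc z) by rewrite /bdist; nra.
have hw1 := normcB_ge w z; have hw2 := normcB_ge z w.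
rewrite normc_distC in hw2.
have db : d * bdist z <= bdist z by rewrite ler_piMl// ltW.
have Dw : disk w by rewrite /disk /=; lra.
have w1 : normc w < 1 by [].
have hd : `|bdist w - bdist z| <= d * bdist z / 2.
  have -> : bdist w - bdist z = (normc z - normc w) * (normc z + normc w).
    by rewrite /bdist; ring.
  rewrite normrM; have -> : d * bdist z / 2 = (d * bdist z / 4) * 2 by field.
  apply: ler_pM => //; first by rewrite ler_norml; lra.
  by rewrite ger0_norm ?addr_ge0//; lra.
have hd2 : `|bdist w - bdist z| <= bdist z / 2 by lra.
split=> //.
- by move: hd2; rewrite ler_norml; lra.
- by move: hd2; rewrite ler_norml; lra.
- by apply: (le_trans hd); rewrite ler_pdivrMr// ler_peMr ?ler1n// mulr_ge0// ltW.
Qed.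

Lemma derive_pair (F : R * R -> R) (p : R * R) (a b : R) : differentiable F p ->
  'D_(a, b) F p = a * 'D_(1, 0) F p + b * 'D_(0, 1) F p.
Proof.
move=> dF; rewrite !deriveE//.
have -> : (a, b) = a *: ((1, 0) : R * R) + b *: ((0, 1) : R * R).
  rewrite /GRing.scale /=; apply/eqP; rewrite xpair_eqE /= /GRing.scale /=.
  by apply/andP; split; apply/eqP; ring.
by rewrite linearP linearZ.
Qed.

Lemma complex_eta z : complex.Re z +i* complex.Im z = z.
Proof. by case: z. Qed.

(** The mean value theorem is applied along the segment from z to w. There [bdist] is at least m,
    because disks centred at 0 are convex, and C1 bounds the gradient of log u by L / m. *)
Lemma log_weight_lip u : condC1 u -> exists2 L, 0 < L & forall z w m,
  0 < m -> m <= bdist z -> m <= bdist w ->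
  `|ln (u w) - ln (u z)| <= L / m * normc (w - z).
Proof.
move=> [du [L L0 hL]]; exists L => // z w m m0 mz mw.
pose v z := ln (u z); pose vv (p : R * R) := v (p.1 +i* p.2).
pose a := complex.Re (w - z); pose b := complex.Im (w - z).
pose Z s : C := z + s%:C * (w - z).
pose seg (s : R) : R * R := (complex.Re (Z s), complex.Im (Z s)).
have segE s : seg s = (complex.Re z + s * a, complex.Im z + s * b).
  by rewrite /seg /Z Re_add Im_add Re_mul Im_mul /= !mul0r subr0 addr0.
have DZ (s : R) : 0 <= s <= 1 -> disk (Z s).
  by move=> s01; apply: disk_bdist; apply: lt_le_trans (bdist_segment s01 mz mw).
have der (s : R) : 0 <= s <= 1 -> is_derive s 1 (fun s => vv (seg s))
    (a * dx v (Z s) + b * dy v (Z s)).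
  move=> /DZ /du dv.
  have : derivable vv (seg s) (a, b) by exact: diff_derivable.
  have sh (h : R) : seg (h *: 1 + s) = h *: (a, b) + seg s.
    rewrite !segE /GRing.scale /=; apply/eqP; rewrite xpair_eqE /=.
    by apply/andP; split; apply/eqP; rewrite /GRing.scale /=; ring.
  have fE : (fun h : R => h^-1 *: (((fun s => vv (seg s)) \o shift s) (h *: 1) - vv (seg s))) =
      (fun h : R => h^-1 *: ((vv \o shift (seg s)) (h *: (a, b)) - vv (seg s))).
    by apply/funext => h; rewrite /= sh.
  move=> dab; split; first by rewrite /derivable fE; exact: dab.
  rewrite /derive fE -/(derive vv (seg s) (a, b)) derive_pair//; congr (_ * _ + _ * _).
    rewrite /dx /derive /derive1; set F1 := (fun h : R => _); set F2 := (fun h : R => _).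
    suff -> : F1 = F2 by [].
    apply/funext => h; rewrite /F1 /F2 /vv /v /seg /= /GRing.scale /=.
    by rewrite mulr0 add0r mulr1.
  rewrite /dy /derive /derive1; set F1 := (fun h : R => _); set F2 := (fun h : R => _).
  suff -> : F1 = F2 by [].
  apply/funext => h; rewrite /F1 /F2 /vv /v /seg /= /GRing.scale /=.
  by rewrite mulr0 add0r mulr1.
have dseg (x : R) : x \in `]0, 1[ -> is_derive x 1 (fun s => vv (seg s))
    (a * dx v (Z x) + b * dy v (Z x)).
  by rewrite in_itv /= => /andP[/ltW h1 /ltW h2]; apply: der; rewrite h1 h2.
have cseg : {within `[0, 1], continuous (fun s => vv (seg s))}.
  apply: continuous_in_subspaceT => s; rewrite inE /= in_itv /= => /der [ds _].
  by apply: differentiable_continuous; exact/derivable1_diffP.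
have [c c01 hc] := MVT_segment ler01 dseg cseg.
have vv0 : vv (seg 0) = v z.
  by rewrite /vv segE /= !mul0r !addr0 complex_eta.
have vv1 : vv (seg 1) = v w.
  have e (x y : R) : x + (y - x) = y by rewrite addrC subrK.
  by rewrite /vv segE /= !mul1r /a /b Re_add Im_add Re_opp Im_opp !e complex_eta.
move: hc; rewrite vv0 vv1 subr0 mulr1 /v => ->.
move: c01; rewrite in_itv /= => c01.
have Dc := DZ _ c01; have mc := bdist_segment c01 mz mw; have hLc := hL _ Dc.
set X := dx v (Z c); set Y := dy v (Z c).
have cs : `|a * X + b * Y| <= normc (w - z) * Num.sqrt (X ^+ 2 + Y ^+ 2).
  rewrite -(@ler_pXn2r _ 2) ?nnegrE ?mulr_ge0 ?normc_ge0 ?sqrtr_ge0//.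
  rewrite exprMn sqr_sqrtr ?addr_ge0 ?sqr_ge0// normc_sqr real_normK ?num_real//.
  by have := sqr_ge0 (a * Y - b * X); rewrite -/a -/b; nra.
apply: (le_trans cs); rewrite mulrC ler_wpM2r ?normc_ge0//.
rewrite ler_pdivlMr// mulrC; apply: le_trans hLc.
by apply: ler_wpM2r; rewrite ?sqrtr_ge0.
Qed.

Lemma expR_ln_ratio (x y c : R) : 0 < x -> 0 < y -> `|ln x - ln y| <= c ->
  x <= expR c * y.
Proof.
move=> x0 y0; rewrite ler_norml => /andP[_ h].
have hx : expR (ln x) = x by rewrite lnK ?posrE.
have hy : expR (ln y) = y by rewrite lnK ?posrE.
rewrite -hx -hy -expRD ler_expR; lra.
Qed.

Lemma weight_comparable u : is_weight u -> condC1 u ->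
  exists2 A, 1 <= A & forall z w, disk z -> normc (w - z) <= bdist z / 4 ->
    u w <= A * u z /\ u z <= A * u w.
Proof.
move=> [u0 _ _] /log_weight_lip [L L0 hL]; exists (expR L).
  by rewrite -expR0 ler_expR ltW.
move=> z w Dz wz.
have h01 : 0 <= (1 : R) <= 1 by rewrite ler01 lexx.
have wz1 : normc (w - z) <= 1 * bdist z / 4 by rewrite mul1r.
have [Dw w2 z2 _] := bdist_lip h01 Dz wz1.
have b0 := bdist_gt0 Dz.
have h : `|ln (u w) - ln (u z)| <= L.
  apply: (le_trans (hL z w (bdist z / 2) _ _ _)); [by rewrite divr_gt0|lra|lra|].
  apply: (@le_trans _ _ (L / (bdist z / 2) * (bdist z / 4))).
    by rewrite ler_wpM2l// divr_ge0 ?ltW// divr_gt0.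
  have -> : L / (bdist z / 2) * (bdist z / 4) = L / 2 by field; rewrite gt_eqF.
  lra.
split; apply: expR_ln_ratio => //; try exact: u0.
by rewrite distrC.
Qed.

(* From 1 - |(z-w)/q|^2 = (1-|z|^2)(1-|w|^2)/|q|^2 with q = 1 - conj(w) z. *)
Lemma pseudohyp_bounds z w r : 0 < r -> r < 1 -> disk z -> pseudohyp_disk z r w ->
  [/\ disk w, (1 - r ^+ 2) / 4 * bdist z <= bdist w,
    bdist w <= 4 / (1 - r ^+ 2) * bdist z &
    normc (w - z) <= 2 / (1 - r ^+ 2) * bdist z].
Proof.
move=> r0 r1 Dz [Dw]; rewrite normcM normcV => hr.
have z1 : normc z < 1 by [].
have w1 : normc w < 1 by [].
have z0 := normc_ge0 z; have w0 := normc_ge0 w.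
have bz := bdist_gt0 Dz; have bw := bdist_gt0 Dw.
set q := 1 - conjc w * z in hr *.
have nwz : normc (conjc w * z) = normc w * normc z by rewrite normcM normc_conj.
have qge : 1 - normc w * normc z <= normc q.
  by rewrite -nwz; have := normcB_ge (1 : C) (conjc w * z); rewrite normc1.
have q0 : 0 < normc q by apply: lt_le_trans qge; rewrite subr_gt0; nra.
have id : normc q ^+ 2 - normc (z - w) ^+ 2 = bdist z * bdist w.
  rewrite /bdist /q !normc_sqr !Re_add !Im_add !Re_opp !Im_opp Re_mul Im_mul Re_conjc Im_conjc /=.
  ring.
have r2 : 0 < 1 - r ^+ 2 by rewrite subr_gt0 expr_lt1// ltW.
have hzw : normc (z - w) < r * normc q by rewrite -ltr_pdivrMr.
have hsq : (1 - r ^+ 2) * normc q ^+ 2 <= bdist z * bdist w.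
  have : normc (z - w) ^+ 2 <= (r * normc q) ^+ 2.
    by rewrite lerXn2r ?nnegrE ?normc_ge0 ?mulr_ge0 ?ltW.
  rewrite exprMn; lra.
have qz : bdist z / 2 <= normc q.
  by apply: le_trans qge; rewrite /bdist; nra.
have qw : bdist w / 2 <= normc q.
  by apply: le_trans qge; rewrite /bdist; nra.
have h1 : (1 - r ^+ 2) / 4 * bdist z <= bdist w.
  rewrite -(ler_pM2l bz); apply: le_trans hsq.
  have -> : bdist z * ((1 - r ^+ 2) / 4 * bdist z) = (1 - r ^+ 2) * (bdist z / 2) ^+ 2 by field.
  by rewrite ler_pM2l// lerXn2r ?nnegrE ?normc_ge0// divr_ge0// ltW.
have h2 : bdist w <= 4 / (1 - r ^+ 2) * bdist z.
  rewrite mulrAC ler_pdivlMr// -(ler_pM2l bw).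
  have : (1 - r ^+ 2) * (bdist w / 2) ^+ 2 <= bdist z * bdist w.
    apply: le_trans hsq.
    by rewrite ler_pM2l// lerXn2r ?nnegrE ?normc_ge0// divr_ge0// ltW.
  have -> : (1 - r ^+ 2) * (bdist w / 2) ^+ 2 = bdist w * (bdist w * (1 - r ^+ 2)) / 4 by field.
  lra.
split=> //.
have qle : normc q <= 2 / (1 - r ^+ 2) * bdist z.
  have nn : 0 <= 2 / (1 - r ^+ 2) * bdist z by rewrite mulr_ge0 ?divr_ge0 ?ltW.
  rewrite -(@ler_pXn2r _ 2) ?nnegrE ?normc_ge0//.
  rewrite -(ler_pM2l r2); apply: (le_trans hsq).
  apply: (@le_trans _ _ (bdist z * (4 / (1 - r ^+ 2) * bdist z))); first by rewrite ler_pM2l.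
  by rewrite le_eqVlt; apply/orP; left; apply/eqP; field; rewrite gt_eqF.
rewrite normc_distC; apply: le_trans qle; apply: (le_trans (ltW hzw)).
by rewrite ler_piMl ?normc_ge0// ltW.
Qed.

(** The denominator satisfies |1 - conj(w) z| >= 1 - |z| >= bdist(z) / 2. *)
Lemma pseudohyp_ball z w r : 0 < r -> r < 1 -> disk z ->
  normc (w - z) < r * bdist z / 4 -> pseudohyp_disk z r w.
Proof.
move=> r0 r1 Dz wz.
have h01 : 0 <= (1 : R) <= 1 by rewrite ler01 lexx.
have wz1 : normc (w - z) <= 1 * bdist z / 4.
  by rewrite (le_trans (ltW wz))// ler_pM2r// ler_pM2r ?bdist_gt0// ltW.
have [Dw _ _ _] := bdist_lip h01 Dz wz1.
split=> //; rewrite normcM normcV.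
have z1 : normc z < 1 by [].
have w1 : normc w < 1 by [].
have z0 := normc_ge0 z; have w0 := normc_ge0 w.
have bz := bdist_gt0 Dz.
have qge : 1 - normc w * normc z <= normc (1 - conjc w * z).
  by have := normcB_ge (1 : C) (conjc w * z); rewrite normc1 normcM normc_conj.
have qz : bdist z / 2 <= normc (1 - conjc w * z).
  by apply: le_trans qge; rewrite /bdist; nra.
rewrite ltr_pdivrMr; last by apply: lt_le_trans qz; rewrite divr_gt0.
rewrite normc_distC; apply: lt_le_trans (_ : r * (bdist z / 2) <= _); last by rewrite ler_pM2l.
apply: (lt_le_trans wz); have := mulr_gt0 r0 bz; lra.
Qed.

Lemma measurable_disk : measurable (pt @^-1` (disk : set C)).
Proof.
have -> : (disk : set C) = eball 0 1.
  by apply/seteqP; split=> z; rewrite /disk /eball /= subr0.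
exact: measurable_eball.
Qed.

Lemma measurable_cplx_disk (F : C -> R) :
  (forall z, disk z -> forall eps, 0 < eps -> exists2 d : R, 0 < d &
     forall w, normc (w - z) < d -> `|F w - F z| < eps) ->
  measurable_fun (pt @^-1` disk) (F \o pt).
Proof.
move=> cF; apply: plane_continuous_measurable; first exact: measurable_disk.
move=> p Dp; apply/cvgrPdist_lt => eps eps0.
have [d d0 hd] := cF _ Dp _ eps0.
have d2 : 0 < d / 2 by rewrite divr_gt0.
apply: filterS (nbhsx_ballx p _ d2) => q [].
rewrite /ball /= distrC => h1; rewrite distrC => h2; rewrite distrC.
by apply: hd; have := pt_lip p q; lra.
Qed.

Lemma area_integral (D : set (plane R)) (f : plane R -> \bar R) : measurable D ->
  measurable_fun D f -> (forall p, D p -> 0 <= f p)%E ->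
  (\int[area]_(p in D) f p = (pi^-1)%:E * \int[leb2]_(p in D) f p)%E.
Proof. by move=> mD mf f0; rewrite ge0_integral_mscale. Qed.

Lemma areaE (D : set (plane R)) : (area D = (pi^-1)%:E * leb2 D)%E.
Proof. by []. Qed.

Lemma leb2_square z r : 0 < r -> leb2 (square z r) = (4 * r ^+ 2)%:E.
Proof.
move=> r0; rewrite box_measure; [|lra|lra].
by congr (_%:E); ring.
Qed.

Lemma area_eball_le z r : 0 < r -> (area (pt @^-1` eball z r) <= (pi^-1 * (4 * r ^+ 2))%:E)%E.
Proof.
move=> r0; rewrite areaE EFinM -(leb2_square z r0).
apply: lee_wpmul2l; first by rewrite lee_fin pi_inv_ge0.
apply: le_measure; rewrite ?inE; [exact: measurable_eball|exact: measurable_square|].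
by move=> p /= /ltW; exact: ball_square.
Qed.

Lemma area_eball_ge z r : 0 < r -> ((pi^-1 * r ^+ 2)%:E <= area (pt @^-1` eball z r))%E.
Proof.
move=> r0; have r20 : 0 < r / 2 by rewrite divr_gt0.
rewrite areaE.
have -> : (pi^-1 * r ^+ 2)%:E = ((pi^-1)%:E * leb2 (square z (r / 2)))%E.
  by rewrite leb2_square// -EFinM; congr (_%:E); congr (_ * _); field.
apply: lee_wpmul2l; first by rewrite lee_fin pi_inv_ge0.
apply: le_measure; rewrite ?inE; [exact: measurable_square|exact: measurable_eball|].
move=> p /(square_ball r20); rewrite /eball /=.
by have -> : 2 * (r / 2) = r by field.
Qed.

End weights.

Section complex_integrals.
Context {R : realType}.
Local Notation C := (Cplx R).
Variables (m : {measure set (plane R) -> \bar R}) (E : set C).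
Hypothesis mE : measurable (pt @^-1` E).
Implicit Types (F G : C -> C).
Local Notation D := (pt @^-1` E).

Let integrable_scale (x : R) (P : plane R -> R) : m.-integrable D (EFin \o P) ->
  m.-integrable D (EFin \o (fun p => x * P p)).
Proof. by move=> iP; have := integrableZl mE x iP; exact: eq_integrable. Qed.

Let integrable_add (P Q : plane R -> R) : m.-integrable D (EFin \o P) ->
  m.-integrable D (EFin \o Q) -> m.-integrable D (EFin \o (fun p => P p + Q p)).
Proof. by move=> iP iQ; have := integrableD mE iP iQ; exact: eq_integrable. Qed.

Lemma intC_linear (a : C) F G : Cintegrable m E F -> Cintegrable m E G ->
  Cintegrable m E (fun z => a * F z + G z) /\
  intC m E (fun z => a * F z + G z) = a * intC m E F + intC m E G.
Proof.
move=> [fr fi] [gr gi].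
have ReE z : complex.Re (a * F z + G z) =
   (complex.Re a * complex.Re (F z) + (- complex.Im a) * complex.Im (F z)) + complex.Re (G z).
  by rewrite Re_add Re_mul mulNr.
have ImE z : complex.Im (a * F z + G z) =
   (complex.Re a * complex.Im (F z) + complex.Im a * complex.Re (F z)) + complex.Im (G z).
  by rewrite Im_add Im_mul.
split.
  split.
    apply: (@eq_integrable _ _ _ m _ mE (EFin \o (fun p => (complex.Re a * complex.Re (F (pt p)) +
      (- complex.Im a) * complex.Im (F (pt p))) + complex.Re (G (pt p))))).
      by move=> p _ /=; rewrite ReE.
    by do !apply: integrable_add => //; exact: integrable_scale.
  apply: (@eq_integrable _ _ _ m _ mE (EFin \o (fun p => (complex.Re a * complex.Im (F (pt p)) +
    complex.Im a * complex.Re (F (pt p))) + complex.Im (G (pt p))))).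
    by move=> p _ /=; rewrite ImE.
  by do !apply: integrable_add => //; exact: integrable_scale.
rewrite /intC /intR.
have -> : Rintegral m D ((fun z => complex.Re (a * F z + G z)) \o pt) =
   Rintegral m D (fun p => (complex.Re a * complex.Re (F (pt p)) +
     (- complex.Im a) * complex.Im (F (pt p))) + complex.Re (G (pt p))).
  by apply: eq_Rintegral => p _; exact: ReE.
have -> : Rintegral m D ((fun z => complex.Im (a * F z + G z)) \o pt) =
   Rintegral m D (fun p => (complex.Re a * complex.Im (F (pt p)) +
     complex.Im a * complex.Re (F (pt p))) + complex.Im (G (pt p))).
  by apply: eq_Rintegral => p _; exact: ImE.
rewrite !RintegralD//; try exact: integrable_scale;
  try (by apply: integrable_add; exact: integrable_scale).
rewrite !RintegralZl//.
apply/eqP; rewrite eq_complex; apply/andP; split; apply/eqP.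
  by rewrite Re_add Re_mul /= mulNr.
by rewrite Im_add Im_mul.
Qed.

Lemma intC_conj F : Cintegrable m E F -> Cintegrable m E (fun z => conjc (F z)) /\
  intC m E (fun z => conjc (F z)) = conjc (intC m E F).
Proof.
move=> [fr fi]; split.
  split; first by apply: eq_integrable fr => // p _; rewrite Re_conjc.
  have := integrable_scale (-1) fi; apply: eq_integrable => // p _ /=.
  by rewrite Im_conjc mulN1r.
apply/eqP; rewrite eq_complex /=; apply/andP; split; apply/eqP.
  by apply: eq_Rintegral => p _ /=; rewrite Re_conjc.
rewrite /intR -[in RHS]mulN1r -RintegralZl//; apply: eq_Rintegral => p _ /=.
by rewrite Im_conjc mulN1r.
Qed.

Lemma Cintegrable_zero : Cintegrable m E (fun=> 0) /\ intC m E (fun=> 0) = 0.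
Proof.
split; first by split; exact: integrable0.
by rewrite /intC /intR /Rintegral !integral0_eq.
Qed.

End complex_integrals.

(** * The weighted Bergman space and its pointwise estimates *)

Section weighted_bergman_space.
Context {R : realType}.
Local Notation C := (Cplx R).
Local Notation leb := (@lebesgue_measure R).
Local Notation leb2 := (leb \x leb)%E.
Local Notation D := (pt @^-1` (disk : set C)).
Implicit Types (z w : C) (f g : C -> C).

Lemma disk_nbhd z : disk z -> exists2 d : R, 0 < d & forall w, normc (w - z) < d -> disk w.
Proof.
rewrite /disk /= => z1; exists (1 - normc z); first by rewrite subr_gt0.
by move=> w wz; have := normcB_ge w z; lra.
Qed.

Lemma analytic_smooth f : analytic_on disk f -> smooth_on disk f.
Proof. by move=> fa; apply: analytic_deriv => // z; exact: disk_nbhd. Qed.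

Lemma measurable_econt f : (forall z, disk z -> econt f z) ->
  [/\ measurable_fun D (fun p => complex.Re (f (pt p))),
      measurable_fun D (fun p => complex.Im (f (pt p))) &
      measurable_fun D (fun p => normc (f (pt p)) ^+ 2)].
Proof.
move=> fc; have mD := @measurable_disk R.
split; apply: plane_continuous_measurable => // p Dp.
- exact: (econt_pt_cont (fc _ Dp)).1.
- exact: (econt_pt_cont (fc _ Dp)).2.
- exact: (econt_normc2_cont (fc _ Dp)).
Qed.

Lemma analytic_linear (a : C) f g : analytic_on disk f -> analytic_on disk g ->
  analytic_on disk (fun z => a * f z + g z).
Proof.
move=> fa ga z0 Dz; have [r1 r10 [c hc]] := fa _ Dz; have [r2 r20 [d hd]] := ga _ Dz.
exists (Num.min r1 r2); first by rewrite lt_min r10.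
exists (fun n => a * c n + d n) => z; rewrite lt_min => /andP[/hc cv1 /hd cv2].
apply/cplx_cvgP => eps eps0.
have a1 : 0 < normc a + 1 by rewrite ltr_wpDl ?normc_ge0.
have e1 : 0 < eps / 2 / (normc a + 1) by rewrite !divr_gt0.
have e2 : 0 < eps / 2 by rewrite divr_gt0.
have [N1 hN1] := (cplx_cvgP _ _).1 cv1 _ e1.
have [N2 hN2] := (cplx_cvgP _ _).1 cv2 _ e2.
exists (maxn N1 N2) => n; rewrite geq_max => /andP[/hN1 h1 /hN2 h2].
have -> : series (fun n => (a * c n + d n) * (z - z0) ^+ n) n =
    a * series (fun n => c n * (z - z0) ^+ n) n + series (fun n => d n * (z - z0) ^+ n) n.
  rewrite !seriesEnat /= mulr_sumr -big_split /=.
  by apply: eq_bigr => i _; rewrite mulrDl mulrA.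
set s1 := series _ n in h1 *; set s2 := series _ n in h2 *.
have -> : a * f z + g z - (a * s1 + s2) = a * (f z - s1) + (g z - s2) by ring.
apply: (le_lt_trans (normcD _ _)); rewrite normcM [ltRHS]splitr.
apply: ler_ltD => //; move: h1; rewrite ltr_pdivlMr// => h1.
by have := normc_ge0 (f z - s1); nra.
Qed.

Lemma analytic_zero : analytic_on disk (fun=> 0 : C).
Proof.
move=> z0 _; exists 1 => //; exists (fun=> 0) => z _.
apply/cplx_cvgP => eps eps0; exists 0%N => n _.
rewrite seriesEnat /= big1 ?subrr ?normc0// => i _; exact: mul0r.
Qed.

Variable u : C -> R.
Hypothesis hu : is_weight u.

Let u0 z : disk z -> 0 < u z. Proof. by case: hu => + _ _; apply. Qed.
Let mu_u : measurable_fun D (u \o pt). Proof. by case: hu. Qed.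
Let mD := @measurable_disk R.

Lemma A2_econt f z : A2 u f -> disk z -> econt f z.
Proof. by move=> [/analytic_smooth sf _ _]; exact: smooth_econt. Qed.

Definition mass f (E : set C) : \bar R := intE area E (fun z => normc (f z) ^+ 2 * u z).

Lemma measurable_mass f : (forall z, disk z -> econt f z) ->
  measurable_fun D (fun p => normc (f (pt p)) ^+ 2 * u (pt p)).
Proof.
by move=> fc; apply: measurable_funM => //; have [] := measurable_econt fc.
Qed.

Lemma mass_ge0 f z : disk z -> 0 <= normc (f z) ^+ 2 * u z.
Proof. by move=> /u0 uz; rewrite mulr_ge0 ?sqr_ge0// ltW. Qed.

(** The integrand is dominated by (|f|^2 + |g|^2) u. *)
Lemma A2_integrable f g : A2 u f -> A2 u g ->
  Cintegrable area disk (fun z => f z * conjc (g z) * (u z)%:C).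
Proof.
move=> Af Ag.
have fc z : disk z -> econt f z by exact: A2_econt.
have gc z : disk z -> econt g z by exact: A2_econt.
have [fR fI _] := measurable_econt fc; have [gR gI _] := measurable_econt gc.
have int h : A2 u h -> area.-integrable D (EFin \o (fun p => normc (h (pt p)) ^+ 2 * u (pt p))).
  move=> Ah; apply/integrableP; split.
    by apply/measurable_EFinP; apply: measurable_mass => z; exact: A2_econt.
  case: Ah => _ _; apply: le_lt_trans; rewrite /intE.
  apply: ge0_le_integral_in => // p Dp.
  by rewrite /= ger0_norm ?mass_ge0.
have dom := integrableD mD (int _ Af) (int _ Ag).
have bnd z : disk z -> normc (f z * conjc (g z) * (u z)%:C) <=
    `|normc (f z) ^+ 2 * u z + normc (g z) ^+ 2 * u z|.
  move=> /u0 uz; rewrite !normcM normc_conj normc_real (gtr0_norm uz).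
  rewrite ger0_norm; last by rewrite addr_ge0// mulr_ge0 ?sqr_ge0// ltW.
  rewrite -mulrDl ler_wpM2r ?(ltW uz)//.
  have := sqr_ge0 (normc (f z) - normc (g z)).
  by have := normc_ge0 (f z); have := normc_ge0 (g z); nra.
have ReE z : complex.Re (f z * conjc (g z) * (u z)%:C) =
    (complex.Re (f z) * complex.Re (g z) + complex.Im (f z) * complex.Im (g z)) * u z.
  by rewrite !Re_mul !Im_mul Re_conjc Im_conjc /=; ring.
have ImE z : complex.Im (f z * conjc (g z) * (u z)%:C) =
    (complex.Im (f z) * complex.Re (g z) - complex.Re (f z) * complex.Im (g z)) * u z.
  by rewrite !Im_mul !Re_mul Re_conjc Im_conjc /=; ring.
split.
  apply: (le_integrable _ _ _ dom) => //.
    apply/measurable_EFinP; under eq_fun do rewrite ReE.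
    by apply: measurable_funM => //; apply: measurable_funD; apply: measurable_funM.
  move=> p Dp; rewrite /= lee_fin; apply: le_trans (bnd _ Dp); exact: normc_Re.
apply: (le_integrable _ _ _ dom) => //.
  apply/measurable_EFinP; under eq_fun do rewrite ImE.
  by apply: measurable_funM => //; apply: measurable_funB; apply: measurable_funM.
move=> p Dp; rewrite /= lee_fin; apply: le_trans (bnd _ Dp); exact: normc_Im.
Qed.

Lemma A2_norm f : A2 u f -> complex.Re (A2ip u f f) = fine (mass f disk).
Proof.
move=> Af; rewrite /A2ip /intC /= /intR /Rintegral /mass /intE; congr (fine _).
apply: eq_integral => p _; congr (_%:E).
by rewrite /= mulc_conj Re_mul /= mul0r subr0.
Qed.

Lemma A2_massE f : A2 u f -> mass f disk = (complex.Re (A2ip u f f))%:E.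
Proof.
move=> Af; rewrite A2_norm// fineK// ge0_fin_numE; first by case: Af.
by apply: integral_ge0 => p Dp; rewrite lee_fin mass_ge0.
Qed.

Lemma mass_parallelogram (a : C) f g z : disk z ->
  normc (a * f z + g z) ^+ 2 * u z <=
  2 * normc a ^+ 2 * (normc (f z) ^+ 2 * u z) + 2 * (normc (g z) ^+ 2 * u z).
Proof.
move=> /u0 uz.
rewrite [2 * normc a ^+ 2 * _]mulrA [2 * (normc (g z) ^+ 2 * _)]mulrA -mulrDl.
rewrite ler_wpM2r ?(ltW uz)//.
apply: (@le_trans _ _ ((normc (a * f z) + normc (g z)) ^+ 2)).
  by rewrite lerXn2r ?nnegrE ?addr_ge0 ?normc_ge0// normcD.
rewrite -mulrA -exprMn -normcM.
by have := sqr_ge0 (normc (a * f z) - normc (g z)); nra.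
Qed.

Lemma A2_linear (a : C) f g : A2 u f -> A2 u g -> A2 u (a *: f + g).
Proof.
move=> Af Ag; have [fa f0 fi] := Af; have [ga g0 gi] := Ag.
split.
- exact: analytic_linear.
- move=> z nz; have -> : (a *: f + g) z = a * f z + g z by [].
  by rewrite f0// g0// mulr0 addr0.
- have m1 := @measurable_mass f (fun z => @A2_econt f z Af).
  have m2 := @measurable_mass g (fun z => @A2_econt g z Ag).
  apply: (@le_lt_trans _ _ (\int[area]_(p in D)
    ((2 * normc a ^+ 2)%:E * (normc (f (pt p)) ^+ 2 * u (pt p))%:E +
     2%:E * (normc (g (pt p)) ^+ 2 * u (pt p))%:E))%E).
    apply: ge0_le_integral_in => p Dp.
      by rewrite lee_fin mulr_ge0 ?sqr_ge0// ltW// u0.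
    by rewrite -!EFinM -EFinD lee_fin; exact: mass_parallelogram.
  have a0 : (0 <= (2 * normc a ^+ 2)%:E)%E by rewrite lee_fin mulr_ge0 ?sqr_ge0.
  rewrite ge0_integralD//.
  + rewrite !ge0_integralZl//; try by move=> p Dp; rewrite lee_fin mass_ge0.
    * by rewrite lte_add_pinfty// lte_mul_pinfty.
    * exact/measurable_EFinP.
    * exact/measurable_EFinP.
  + by move=> p Dp; rewrite mule_ge0// lee_fin mass_ge0.
  + by apply: measurable_funeM; exact/measurable_EFinP.
  + by move=> p Dp; rewrite mule_ge0// lee_fin mass_ge0.
  + by apply: measurable_funeM; exact/measurable_EFinP.
Qed.

Lemma A2_zero : A2 u (0 : C -> C).
Proof.
split=> //; first exact: analytic_zero.
rewrite /intE integral0_eq// => p _.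
by have -> : (0 : C -> C) (pt p) = 0 by []; rewrite normc0 expr0n mul0r.
Qed.

Lemma A2_hermitian : hermitian_form (A2 u) (A2ip u).
Proof.
split.
- exact: A2_zero.
- by move=> a f g Af Ag; exact: A2_linear.
- move=> a f g k Af Ag Ak.
  have [_ <-] := intC_linear mD a (A2_integrable Af Ak) (A2_integrable Ag Ak).
  rewrite /A2ip; congr intC; apply/funext => z.
  have -> : (a *: f + g) z = a * f z + g z by [].
  by ring.
- move=> f g Af Ag; have [_ <-] := intC_conj mD (A2_integrable Af Ag).
  rewrite /A2ip; congr intC; apply/funext => z.
  by rewrite !conjcM conjcK conjc_real; ring.
Qed.

Lemma A2_psd : psd_form (A2 u) (A2ip u).
Proof.
split; first exact: A2_hermitian.
move=> f Af; rewrite A2_norm//; apply: fine_ge0.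
by apply: integral_ge0 => p Dp; rewrite lee_fin mass_ge0.
Qed.

Hypothesis huC1 : condC1 u.

Definition local_mass z : R := u z * bdist z ^+ 2.

Lemma local_mass_gt0 z : disk z -> 0 < local_mass z.
Proof. by move=> Dz; rewrite mulr_gt0 ?u0 ?exprn_gt0// bdist_gt0. Qed.

Lemma eball_disk z d : 0 < d <= 1 -> disk z -> eball z (d * bdist z / 4) `<=` disk.
Proof.
move=> /andP[d0 d1] Dz w /ltW wz.
have h : 0 <= d <= 1 by rewrite ltW.
by have [] := bdist_lip h Dz wz.
Qed.

(* delta <= 1/8 so that the ball of twice the radius stays in the disk. *)
Lemma A2_pointwise_local (d : R) : 0 < d <= 1 / 8 ->
  exists2 c, 0 < c & forall f z, A2 u f -> disk z ->
  ((normc (f z) ^+ 2)%:E <= (c / local_mass z)%:E * mass f (eball z (d * bdist z)))%E.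
Proof.
move=> /andP[d0 d8]; have [A A1 hA] := weight_comparable hu huC1.
have A0 : 0 < A by exact: lt_le_trans A1.
have pi0 := @pi_gt0 R.
exists (4 * pi * A / d ^+ 2); first by rewrite divr_gt0 ?exprn_gt0 ?mulr_gt0.
move=> f z Af Dz; have [fa _ _] := Af.
have b0 := bdist_gt0 Dz; have uz := u0 Dz.
set r := d * bdist z; have r0 : 0 < r by rewrite mulr_gt0.
have sub2 : eball z (2 * r) `<=` disk.
  move=> w wz; apply: (@eball_disk z (8 * d)); [apply/andP; split; lra|by []|].
  by move: wz; rewrite /eball /= /r; congr (_ < _); field.
have sub : eball z r `<=` disk.
  by move=> w wz; apply: sub2; move: wz; rewrite /eball /=; lra.
have sf := smooth_on_sub sub2 (analytic_smooth fa).
apply: (le_trans (submean r0 sf)).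
have mB := measurable_eball z r.
have subP : pt @^-1` eball z r `<=` D by move=> p; exact: sub.
have mf : measurable_fun (pt @^-1` eball z r) (fun p => normc (f (pt p)) ^+ 2).
  apply: (measurable_funS mD subP).
  by have [] := measurable_econt (fun z => @A2_econt f z Af).
have mfu : measurable_fun (pt @^-1` eball z r) (fun p => normc (f (pt p)) ^+ 2 * u (pt p)).
  by apply: (measurable_funS mD subP); apply: measurable_mass => w; exact: A2_econt.
have leB : (\int[leb2]_(p in pt @^-1` eball z r) (normc (f (pt p)) ^+ 2)%:E <=
    (A / u z)%:E * \int[leb2]_(p in pt @^-1` eball z r) (normc (f (pt p)) ^+ 2 * u (pt p))%:E)%E.
  rewrite -ge0_integralZl//; first last.
  - by rewrite lee_fin divr_ge0// ltW.
  - by move=> p Bp; rewrite lee_fin mass_ge0//; exact: sub.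
  - exact/measurable_EFinP.
  apply: ge0_le_integral_in => p Bp; first by rewrite lee_fin sqr_ge0.
  have [|_ uzle] := hA z (pt p) Dz; first by move: Bp; rewrite /= /eball /= /r; nra.
  rewrite -EFinM lee_fin mulrCA ler_peMr ?sqr_ge0//.
  by rewrite mulrAC ler_pdivlMr// mul1r.
have -> : mass f (eball z r) = ((pi^-1)%:E *
    \int[leb2]_(p in pt @^-1` eball z r) (normc (f (pt p)) ^+ 2 * u (pt p))%:E)%E.
  rewrite /mass /intE area_integral//; first exact/measurable_EFinP.
  by move=> p Bp; rewrite lee_fin mass_ge0//; exact: sub.
have r2 : (0 <= (4 / r ^+ 2)%:E)%E by rewrite lee_fin divr_ge0// exprn_ge0// ltW.
apply: (le_trans (lee_wpmul2l r2 leB)); rewrite !muleA -!EFinM.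
rewrite le_eqVlt; apply/orP; left; apply/eqP; congr (_%:E * _)%E.
have bN := lt0r_neq0 b0; have uN := lt0r_neq0 uz; have dN := lt0r_neq0 d0.
rewrite /local_mass /r; move: (pi : R) pi0 => P /lt0r_neq0 PN.
by field; rewrite PN bN uN dN.
Qed.

Lemma mass_eball_le f z d : A2 u f -> disk z -> 0 < d <= 1 / 8 ->
  (mass f (eball z (d * bdist z)) <= (complex.Re (A2ip u f f))%:E)%E.
Proof.
move=> Af Dz /andP[d0 d8]; rewrite -A2_massE//; apply: ge0_subset_integral => //.
- exact: measurable_eball.
- by apply/measurable_EFinP; apply: measurable_mass => w; exact: A2_econt.
- by move=> p Dp; rewrite lee_fin mass_ge0.
move=> p /= pz; apply: (@eball_disk z (4 * d)); [apply/andP; split; lra|by []|].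
by move: pz; rewrite /eball /=; congr (_ < _); field.
Qed.

Lemma A2_pointwise : exists2 c, 0 < c & forall f z, A2 u f -> disk z ->
  normc (f z) ^+ 2 <= c / local_mass z * complex.Re (A2ip u f f).
Proof.
have d8 : 0 < (1 / 8 : R) <= 1 / 8 by rewrite lexx divr_gt0.
have [c c0 hc] := A2_pointwise_local d8.
exists c => // f z Af Dz; rewrite -lee_fin (EFinM (c / local_mass z)).
apply: (le_trans (hc f z Af Dz)); apply: lee_wpmul2l.
  by rewrite lee_fin divr_ge0 ?ltW// local_mass_gt0.
exact: mass_eball_le.
Qed.

Lemma A2_definite f : A2 u f -> complex.Re (A2ip u f f) = 0 -> f = 0.
Proof.
move=> Af f0; have [c c0 hc] := A2_pointwise; apply/funext => z.
have [Dz|nD] := pselect (disk z); last by case: Af => _ + _; apply.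
apply: eq0_normc; apply/eqP; rewrite -sqrf_eq0 eq_le sqr_ge0 andbT.
by have := hc f z Af Dz; rewrite f0 mulr0.
Qed.

Lemma local_mass_comparable : exists2 A, 1 <= A & forall z w, disk z ->
  normc (w - z) <= bdist z / 4 -> local_mass w <= A * local_mass z /\ local_mass z <= A * local_mass w.
Proof.
have [A A1 hA] := weight_comparable hu huC1.
exists (4 * A); first lra.
move=> z w Dz wz; have [u1 u2] := hA z w Dz wz.
have h01 : 0 <= (1 : R) <= 1 by rewrite ler01 lexx.
have wz1 : normc (w - z) <= 1 * bdist z / 4 by rewrite mul1r.
have [Dw b1 b2 _] := bdist_lip h01 Dz wz1.
have bz := bdist_gt0 Dz; have bw := bdist_gt0 Dw; have uz := u0 Dz; have uw := u0 Dw.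
have e (x y : R) : 4 * A * (x * y ^+ 2) = A * x * (2 * y) ^+ 2 by ring.
rewrite /local_mass !e; split; apply: ler_pM; rewrite ?sqr_ge0 ?(ltW uz) ?(ltW uw)//.
  by rewrite lerXn2r ?nnegrE ?mulr_ge0 ?(ltW bz) ?(ltW bw).
by rewrite lerXn2r ?nnegrE ?mulr_ge0 ?(ltW bz) ?(ltW bw).
Qed.

(** [lipschitz_estimate] is used on the disk of radius bdist(z) / 8; the pointwise bound,
    transported to z by comparability of V, supplies the supremum S. *)
Lemma A2_lipschitz : exists2 c, 0 < c & forall f z w, A2 u f -> disk z ->
  normc (z - w) <= bdist z / 32 ->
  normc (f z - f w) ^+ 2 <=
    c * (normc (z - w) / bdist z) ^+ 2 * (complex.Re (A2ip u f f) / local_mass z).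
Proof.
have [c c0 hc] := A2_pointwise; have [A A1 hA] := local_mass_comparable.
have A0 : 0 < A by exact: lt_le_trans A1.
(* 2560 comes from [lipschitz_estimate] and 32 from the radius r = bdist(z) / 32. *)
have [K K0 KE] : exists2 K : R, 0 < K & K = 2560 * 32.
  by eexists; last reflexivity; apply: mulr_gt0; exact: ltr0Sn.
exists (K ^+ 2 * (A * c)) => [|f z w Af Dz zw]; first by rewrite !mulr_gt0// exprn_gt0.
have b0 := bdist_gt0 Dz; have V0 := local_mass_gt0 Dz.
have N0 := A2_psd.2 _ Af; have [fa _ _] := Af.
set r := bdist z / 32; have r0 : 0 < r by rewrite divr_gt0.
have r4 : 4 * r <= bdist z / 4 by rewrite /r; lra.
have sub : eball z (4 * r) `<=` disk.
  move=> v vz; apply: (@eball_disk z 1) => //; first by rewrite ltr01 lexx.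
  by rewrite /eball /= mul1r; apply: lt_le_trans vz r4.
have sf := smooth_on_sub sub (analytic_smooth fa).
set S := Num.sqrt (A * c * (complex.Re (A2ip u f f) / local_mass z)).
have S2 : 0 <= A * c * (complex.Re (A2ip u f f) / local_mass z).
  by rewrite !mulr_ge0 ?invr_ge0// ltW.
have fS v : eball z (4 * r) v -> normc (f v) <= S.
  move=> vz; have Dv := sub _ vz.
  rewrite -(@ler_pXn2r _ 2) ?nnegrE ?normc_ge0 ?sqrtr_ge0// sqr_sqrtr//.
  apply: (le_trans (hc f v Af Dv)).
  have [|_ h2] := hA z v Dz; first by apply: le_trans (ltW vz) r4.
  have -> : A * c * (complex.Re (A2ip u f f) / local_mass z) =
    c * (A / local_mass z) * complex.Re (A2ip u f f) by ring.
  rewrite ler_wpM2r// ler_wpM2l ?(ltW c0)//.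
  have Vv := local_mass_gt0 Dv.
  by rewrite ler_pdivlMr// mulrC ler_pdivrMr.
have := lipschitz_estimate r0 sf fS zw.
have -> : 2560 * S / r * normc (z - w) = K * S * (normc (z - w) / bdist z).
  rewrite KE /r; have [bN n32] : bdist z != 0 /\ (32 : R) != 0.
    by split; [rewrite gt_eqF|rewrite pnatr_eq0].
  move: (2560 : R) (normc _) => k n; field; by rewrite bN.
move=> h.
have n0 : 0 <= K * S * (normc (z - w) / bdist z).
  by apply: le_trans h; exact: normc_ge0.
apply: (@le_trans _ _ ((K * S * (normc (z - w) / bdist z)) ^+ 2)).
  by rewrite lerXn2r ?nnegrE ?normc_ge0.
rewrite [(K * S * _) ^+ 2]exprMn [(K * S) ^+ 2]exprMn /S sqr_sqrtr//.
by move: (K ^+ 2) (_ ^+ 2) => k2 n2; rewrite le_eqVlt; apply/orP; left; apply/eqP; ring.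
Qed.

End weighted_bergman_space.

(** * Test functions for B_p weights *)

Section carleson_regions.
Context {R : realType}.
Local Notation C := (Cplx R).
Implicit Types (z w a : C).

Lemma conjc_mul_normc a : conjc a * a = (normc a ^+ 2)%:C.
Proof. by rewrite mulrC mulc_conj. Qed.

Lemma mobius_den_neq0 a z : disk a -> disk z -> 1 - conjc a * z != 0.
Proof.
rewrite /disk /= => a1 z1; apply/eqP => h.
have : normc (conjc a * z) < 1.
  rewrite normcM normc_conj; have := normc_ge0 a; have := normc_ge0 z; nra.
have -> : conjc a * z = 1 by apply/eqP; rewrite eq_sym -subr_eq0 h.
by rewrite normc1 ltxx.
Qed.

Definition mobius a z : C := (a - z) / (1 - conjc a * z).

Lemma mobius_disk a z : disk a -> disk z -> disk (mobius a z).
Proof.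
move=> Da Dz; have q0 := mobius_den_neq0 Da Dz.
rewrite /disk /= /mobius normcM normcV.
have qp : 0 < normc (1 - conjc a * z).
  rewrite lt_neqAle normc_ge0 andbT eq_sym; apply: contra q0 => /eqP /eq0_normc ->.
  exact: eqxx.
rewrite ltr_pdivrMr// mul1r -(@ltr_pXn2r _ 2) ?nnegrE ?normc_ge0// -subr_gt0.
have -> : normc (1 - conjc a * z) ^+ 2 - normc (a - z) ^+ 2 = bdist a * bdist z.
  rewrite /bdist !normc_sqr !Re_add !Im_add !Re_opp !Im_opp Re_mul Im_mul Re_conjc Im_conjc /=.
  ring.
by rewrite mulr_gt0 ?bdist_gt0.
Qed.

Lemma mobiusK a z : disk a -> disk z -> mobius a (mobius a z) = z.
Proof.
move=> Da Dz; have q0 := mobius_den_neq0 Da Dz.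
have q1 := mobius_den_neq0 Da (mobius_disk Da Dz).
apply: (mulIf q1); rewrite {1}/mobius divfK// /mobius.
by move: (conjc a) q0 => b q0; field.
Qed.

(* The half-plane Re (conj(a) z) <= 0 in the coordinate z, written in terms of
   w = (a - z)/(1 - conj(a) z). *)
Lemma carleson_regionE a : disk a -> carleson_region a =
  [set w | disk w /\ normc a ^+ 2 * (1 + normc w ^+ 2) <=
    (1 + normc a ^+ 2) * complex.Re (conjc a * w)].
Proof.
move=> Da.
have key w : disk w -> (complex.Re (conjc a * mobius a w) <= 0) =
    (normc a ^+ 2 * (1 + normc w ^+ 2) <= (1 + normc a ^+ 2) * complex.Re (conjc a * w)).
  move=> Dw; have q0 := mobius_den_neq0 Da Dw.
  set q := 1 - conjc a * w in q0.
  have qp : 0 < normc q ^+ 2.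
    rewrite exprn_gt0// lt_neqAle normc_ge0 andbT eq_sym; apply: contra q0 => /eqP /eq0_normc ->.
    exact: eqxx.
  have E : (normc q ^+ 2)%:C * (conjc a * mobius a w) = conjc a * (a - w) * conjc q.
    by rewrite -mulc_conj /mobius -/q; field.
  have : normc q ^+ 2 * complex.Re (conjc a * mobius a w) =
      normc a ^+ 2 * (1 + normc w ^+ 2) - (1 + normc a ^+ 2) * complex.Re (conjc a * w).
    have := congr1 (@complex.Re R) E; rewrite [in LHS]Re_mul /= mul0r subr0 => ->.
    rewrite /q !normc_sqr !(Re_mul, Im_mul, Re_conjc, Im_conjc, Re_add, Im_add, Re_opp, Im_opp) /=.
    ring.
  move=> E2; rewrite -(pmulr_rle0 _ qp) E2 subr_le0//.
apply/seteqP; split=> w.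
  move=> [z [Dz hz] <-]; have Dw := mobius_disk Da Dz; split => //.
  by rewrite -key// mobiusK.
move=> [Dw hw]; exists (mobius a w); last exact: mobiusK.
by split; [exact: mobius_disk|rewrite key].
Qed.

Lemma carleson_region_sub a : disk a -> carleson_region a `<=` disk.
Proof. by move=> Da; rewrite carleson_regionE// => w []. Qed.

Lemma measurable_carleson a : disk a -> measurable (pt @^-1` carleson_region a).
Proof.
move=> Da; rewrite carleson_regionE//.
pose F (p : R * R) := (1 + normc a ^+ 2) * (complex.Re a * p.1 + complex.Im a * p.2) -
  normc a ^+ 2 * (1 + p.1 * p.1 + p.2 * p.2).
have -> : pt @^-1` [set w | disk w /\ normc a ^+ 2 * (1 + normc w ^+ 2) <=
    (1 + normc a ^+ 2) * complex.Re (conjc a * w)] =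
    (pt @^-1` (disk : set C)) `&` F @^-1` `[0, +oo[%classic.
  have E p : F p = (1 + normc a ^+ 2) * complex.Re (conjc a * pt (p : plane R)) -
      normc a ^+ 2 * (1 + normc (pt (p : plane R)) ^+ 2).
    rewrite /F [normc (pt _) ^+ 2]normc_sqr Re_mul Re_conjc Im_conjc /=.
    by move: (normc a ^+ 2) => n; ring.
  by apply/seteqP; split=> p /= [Dp]; rewrite in_itv /= andbT E subr_ge0.
have mF : measurable_fun (pt @^-1` (disk : set C)) F.
  apply: plane_continuous_measurable; first exact: measurable_disk.
  move=> p _; rewrite /F.
  have c1 := @fst_cont R p; have c2 := @snd_cont R p.
  have cc (k : R) : {for p, continuous (fun _ : R * R => k)} by exact: cst_continuous.
  apply: continuousB; apply: continuousM => //.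
    by apply: continuousD; apply: continuousM.
  by apply: continuousD; [apply: continuousD => //|]; apply: continuousM.
by apply: mF; [exact: measurable_disk|exact: measurable_itv].
Qed.

Section boundary_point.
Variable zeta : C.
Hypothesis zeta1 : normc zeta = 1.

Lemma disk_radial (t : R) : 0 < t <= 1 -> disk ((1 - t)%:C * zeta : C).
Proof.
move=> /andP[t0 t1]; rewrite /disk /= normcM zeta1 mulr1 normc_real.
by rewrite ger0_norm ?subr_ge0//; lra.
Qed.

Lemma normc_unit_sub w : normc (zeta - w) ^+ 2 =
  1 - 2 * complex.Re (conjc zeta * w) + normc w ^+ 2.
Proof.
have : complex.Re zeta ^+ 2 + complex.Im zeta ^+ 2 = 1 by rewrite -normc_sqr zeta1 expr1n.
rewrite !normc_sqr !(Re_mul, Re_conjc, Im_conjc, Re_add, Im_add, Re_opp, Im_opp) => h.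
transitivity ((complex.Re zeta ^+ 2 + complex.Im zeta ^+ 2) -
  2 * (complex.Re zeta * complex.Re w - - complex.Im zeta * complex.Im w) +
  (complex.Re w ^+ 2 + complex.Im w ^+ 2)); [ring|by rewrite h].
Qed.

(** The condition is rewritten through the distance to the boundary point zeta. The factor 1 - t is
    kept on both sides because t = 1, that is centre 0, is allowed; the region is then the whole
    disk. *)
Lemma carleson_radialP (t : R) w : 0 < t <= 1 ->
  carleson_region ((1 - t)%:C * zeta) w <->
  disk w /\ (1 - t) * ((1 - t) * normc (zeta - w) ^+ 2) <=
     (1 - t) * (t ^+ 2 * complex.Re (conjc zeta * w)).
Proof.
move=> t01; rewrite carleson_regionE /=; last exact: disk_radial.
have -> : normc ((1 - t)%:C * zeta) ^+ 2 = (1 - t) ^+ 2.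
  by rewrite normcM zeta1 mulr1 normc_real real_normK ?num_real.
have -> : complex.Re (conjc ((1 - t)%:C * zeta : C) * w) = (1 - t) * complex.Re (conjc zeta * w).
  by rewrite conjcM conjc_real -mulrA Re_mul /= mul0r subr0.
rewrite normc_unit_sub; move: (complex.Re _) (normc w ^+ 2) => x y.
have E : (1 + (1 - t) ^+ 2) * ((1 - t) * x) - (1 - t) ^+ 2 * (1 + y) =
  (1 - t) * (t ^+ 2 * x) - (1 - t) * ((1 - t) * (1 - 2 * x + y)) by ring.
by rewrite -subr_ge0 E subr_ge0.
Qed.

(** Within t / 2 of zeta one has Re(conj(zeta) w) >= 1 / 2, so (1 - t) |zeta - w|^2 <= t^2 / 4 stays
    below t^2 Re(conj(zeta) w). *)
Lemma carleson_near (t : R) w : 0 < t <= 1 -> disk w -> normc (zeta - w) <= t / 2 ->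
  carleson_region ((1 - t)%:C * zeta) w.
Proof.
move=> t01 Dw h; apply/(carleson_radialP _ t01); split=> //.
move: t01 => /andP[t0 t1].
have n0 := normc_ge0 (zeta - w).
apply: ler_wpM2l; first by rewrite subr_ge0.
have h2 : normc (zeta - w) ^+ 2 <= (t / 2) ^+ 2.
  by rewrite lerXn2r ?nnegrE// divr_ge0// ltW.
have x1 : 1 - t / 2 <= complex.Re (conjc zeta * w).
  have := normc_Re (conjc zeta * (zeta - w)).
  rewrite normcM normc_conj zeta1 mul1r mulrBr conjc_mul_normc zeta1 expr1n Re_add Re_opp /=.
  by rewrite ler_norml => /andP[_]; lra.
apply: (@le_trans _ _ (1 * (t / 2) ^+ 2)); first by rewrite ler_pM ?sqr_ge0 ?subr_ge0//; lra.
rewrite mul1r exprMn ler_wpM2l ?sqr_ge0//; lra.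
Qed.

(** For t <= 1 / 2 the condition gives |zeta - w|^2 <= 2 t^2; for larger t, 4 t exceeds the diameter
    2. *)
Lemma carleson_diam (t : R) w : 0 < t <= 1 ->
  carleson_region ((1 - t)%:C * zeta) w -> normc (zeta - w) <= 4 * t.
Proof.
move=> t01 /(carleson_radialP _ t01) [Dw h].
have w1 : normc w < 1 by [].
move: t01 => /andP[t0 t1]; have [t2|t2] := lerP t (1 / 2); last first.
  apply: (le_trans (normcD _ _)); rewrite zeta1 normcN; lra.
have n0 := normc_ge0 (zeta - w).
rewrite -(@ler_pXn2r _ 2) ?nnegrE ?mulr_ge0// ?(ltW t0)//.
move: h; rewrite ler_pM2l; last lra.
have x1 : complex.Re (conjc zeta * w) <= 1.
  apply: (le_trans (ler_norm _)); apply: (le_trans (normc_Re _)).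
  by rewrite normcM normc_conj zeta1 mul1r ltW.
have t2' : 0 < t ^+ 2 by rewrite exprn_gt0.
have n2 := sqr_ge0 (normc (zeta - w)).
rewrite exprMn; move: (normc (zeta - w) ^+ 2) (complex.Re _) (t ^+ 2) n2 x1 t2' => n x s n2 x1 t2'.
nra.
Qed.

Lemma carleson_full : carleson_region ((1 - 1 : R)%:C * zeta) = disk.
Proof.
have t01 : 0 < (1 : R) <= 1 by rewrite ltr01 lexx.
apply/seteqP; split=> w; first by move=> /(carleson_radialP _ t01) [].
by move=> Dw; apply/(carleson_radialP _ t01); split=> //; rewrite subrr !mul0r.
Qed.

End boundary_point.
End carleson_regions.

(** * Doubling of B_p weights on Carleson regions *)

Section bekolle_doubling.
Context {R : realType}.
Local Notation C := (Cplx R).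
Local Notation D := (pt @^-1` (disk : set C)).
Variables (u : C -> R) (p : R).
Hypotheses (hu : is_weight u) (p1 : 1 < p) (huB : Bp p u).

Let u0 z : disk z -> 0 < u z. Proof. by case: hu => + _ _; apply. Qed.
Let mu_u : measurable_fun D (u \o pt). Proof. by case: hu. Qed.
Let mD := @measurable_disk R.

Let q : R := (1 - p^-1)^-1 / p.
Let sigma z : R := u z `^ (- q).

Let qE : q * (p - 1) = 1.
Proof.
have pN : p != 0 by rewrite gt_eqF// (lt_trans _ p1).
have p1N : p - 1 != 0 by rewrite subr_eq0 gt_eqF.
rewrite /q; have -> : 1 - p^-1 = (p - 1) / p by field.
by field; rewrite pN p1N.
Qed.

Let msigma : measurable_fun D (sigma \o pt).
Proof.
rewrite /sigma; apply: (measurableT_comp (f := fun x => x `^ (- q))) => //.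
Qed.

(* Integrating 1 <= lambda u + (lambda u)^(-q) replaces Hoelder's inequality. *)
Let one_le (lam x : R) : 0 < lam -> 0 < x -> 1 <= lam * x + lam `^ (- q) * x `^ (- q).
Proof.
move=> l0 x0.
have lx : 0 < lam * x by rewrite mulr_gt0.
rewrite -powRM ?(ltW l0) ?(ltW x0)//.
have [h|h] := lerP 1 (lam * x); first by rewrite (le_trans h)// lerDl powR_ge0.
apply: (@le_trans _ _ ((lam * x) `^ (- q))); last by rewrite lerDr ltW.
rewrite powRN -[leLHS]invr1 lef_pV2 ?posrE ?powR_gt0//.
have pm0 : 0 < p - 1 by rewrite subr_gt0.
have q0 : 0 <= q by rewrite -(pmulr_lge0 q pm0) qE ler01.
rewrite -[leRHS](_ : 1 `^ q = 1); last by rewrite powR1.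
by rewrite ge0_ler_powR ?nnegrE ?(ltW lx) ?(ltW h).
Qed.

(** With sigma = u^(-q) and S the Carleson region, integration over E gives A(E) <= lambda u(E) +
    lambda^(-q) sigma(S). The lambda that makes the last term AE / 2 bounds u(E) from below, and B_p
    trades sigma(S) for u(S). [AE], [AS] and [UE] are one-sided bounds, so that areas enter only up
    to constants. *)
Lemma bekolle_doubling : exists2 M, 0 < M & forall a (E : set C) (AE AS UE : R),
  disk a -> E `<=` carleson_region a -> measurable (pt @^-1` E) ->
  0 < AE -> (AE%:E <= area (pt @^-1` E))%E ->
  (area (pt @^-1` carleson_region a) <= AS%:E)%E -> (intE area E u <= UE%:E)%E ->
  (intE area (carleson_region a) u <= (M * (2 * AS / AE) `^ p * UE)%:E)%E.
Proof.
have p0 : 0 < p by rewrite (lt_trans _ p1).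
have pm0 : 0 < p - 1 by rewrite subr_gt0.
move: huB; rewrite /Bp; set X := [set _ | _ in _] => hX.
have [M M0 hM] : exists2 M : R, 0 < M & (ereal_sup X <= M%:E)%E.
  case: (ereal_sup X) hX => [x _|//|_]; last by exists 1; rewrite ?leNye.
  by exists (`|x| + 1); [rewrite ltr_wpDl|rewrite lee_fin (le_trans (ler_norm _))// lerDl].
exists M => // a E AE AS UE Da ES mE AE0 hAE hAS hUE.
set S := carleson_region a in ES hAS *.
have SD : S `<=` disk by exact: carleson_region_sub.
have mS : measurable (pt @^-1` S) by exact: measurable_carleson.
pose sA := fine (area (pt @^-1` S)).
have : ((sA^-1)%:E * intE area S u * poweR ((sA^-1)%:E * intE area S sigma) (p - 1) <= M%:E)%E.
  by apply: le_trans hM; apply: ereal_sup_ubound; exists a.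
have sAfin : area (pt @^-1` S) = sA%:E.
  by rewrite /sA fineK// ge0_fin_numE// (le_lt_trans hAS)// ltry.
have AEs : AE <= sA.
  rewrite -lee_fin -sAfin; apply: (le_trans hAE); apply: le_measure; rewrite ?inE//.
  by move=> x; exact: ES.
have sA0 : 0 < sA by exact: lt_le_trans AEs.
have sAS : sA <= AS by rewrite -lee_fin -sAfin.
have mw (F : set C) (v : C -> R) : F `<=` disk -> measurable_fun D (v \o pt) ->
    measurable_fun (pt @^-1` F) (fun x => (v (pt x))%:E).
  move=> FD mv; apply/measurable_EFinP; apply: (measurable_funS mD _ mv).
  by move=> x; exact: FD.
have IS0 : (0 <= intE area S u)%E.
  by apply: integral_ge0 => x /SD Dx; rewrite lee_fin ltW// u0.
have SS0 : (0 <= intE area S sigma)%E.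
  by apply: integral_ge0 => x _; rewrite lee_fin powR_ge0.
have UE0 : 0 <= UE.
  rewrite -lee_fin; apply: le_trans hUE; apply: integral_ge0 => x /ES /SD Dx.
  by rewrite lee_fin ltW// u0.
have young lam : 0 < lam ->
    (AE%:E <= (lam * UE)%:E + (lam `^ (- q))%:E * intE area S sigma)%E.
  move=> l0; apply: (le_trans hAE).
  have -> : area (pt @^-1` E) = (\int[area]_(x in pt @^-1` E) (cst 1) x)%E.
    by rewrite integral_cst// mul1e.
  apply: (@le_trans _ _ (\int[area]_(x in pt @^-1` E)
      (lam%:E * (u (pt x))%:E + (lam `^ (- q))%:E * (sigma (pt x))%:E))%E).
    apply: ge0_le_integral_in => x Ex; first by [].
    by rewrite -!EFinM -EFinD lee_fin one_le// u0//; apply: SD; exact: ES.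
  have lq0 : (0 <= (lam `^ (- q))%:E)%E by rewrite lee_fin powR_ge0.
  have l0' : (0 <= lam%:E)%E by rewrite lee_fin ltW.
  have ED : E `<=` disk by exact: subset_trans ES SD.
  have ue0 x : (pt @^-1` E) x -> (0 <= (u (pt x))%:E)%E.
    by move=> /ED Dx; rewrite lee_fin ltW// u0.
  have se0 x : (pt @^-1` E) x -> (0 <= (sigma (pt x))%:E)%E.
    by move=> _; rewrite lee_fin powR_ge0.
  have mue := mw _ _ ED mu_u; have mse := mw _ _ ED msigma.
  have lue0 x : (pt @^-1` E) x -> (0 <= lam%:E * (u (pt x))%:E)%E.
    by move=> Ex; rewrite mule_ge0// ue0.
  have lse0 x : (pt @^-1` E) x -> (0 <= (lam `^ (- q))%:E * (sigma (pt x))%:E)%E.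
    by move=> Ex; rewrite mule_ge0// se0.
  have mlu := measurable_funeM lam%:E mue; have mls := measurable_funeM (lam `^ (- q))%:E mse.
  rewrite ge0_integralD// !ge0_integralZl//; apply: leeD.
    by rewrite EFinM; apply: lee_wpmul2l.
  apply: lee_wpmul2l => //; apply: ge0_subset_integral => //; first exact: mw.
    by move=> x _; rewrite lee_fin powR_ge0.
  by move=> x; exact: ES.
have sAi : 0 < sA^-1 by rewrite invr_gt0.
have pm1N : p - 1 != 0 by rewrite gt_eqF.
(* If sigma(S) is infinite, finiteness of the B_p product leaves only u(S) = 0. *)
case: (intE area S sigma) SS0 young => [s||//] s0 young; last first.
  rewrite gt0_muley ?lte_fin// poweRyr//.
  have [->|ISN] := eqVneq (intE area S u) 0%E.
    by rewrite lee_fin mulr_ge0// mulr_ge0 ?powR_ge0// ltW.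
  have ISp : (0 < intE area S u)%E by rewrite lt_neqAle eq_sym ISN.
  by rewrite gt0_muley ?mule_gt0// leye_eq.
rewrite lee_fin in s0.
(* If sigma(S) were 0, the choice lambda = AE / (2 (UE + 1)) would give AE < AE. *)
have sp : 0 < s.
  rewrite lt_neqAle s0 andbT eq_sym; apply/eqP => s_eq0.
  have U1 : 0 < 2 * (UE + 1) by rewrite mulr_gt0// ltr_wpDl.
  have := young (AE / (2 * (UE + 1))) (divr_gt0 AE0 U1).
  rewrite s_eq0 mule0 adde0 lee_fin; apply/negP; rewrite -ltNge.
  rewrite mulrAC ltr_pdivrMr// ltr_pM2l//; lra.
have powp : 0 < (sA^-1 * s) `^ (p - 1) by rewrite powR_gt0// mulr_gt0.
rewrite -EFinM poweR_EFin.
case: (intE area S u) IS0 => [i||//] i0; last first.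
  by rewrite gt0_muley ?lte_fin// gt0_mulye ?lte_fin// leye_eq.
rewrite -!EFinM !lee_fin => hB.
(* Since q (p - 1) = 1, this makes lambda^(-q) sigma(S) equal to AE / 2. *)
pose lam := (2 * s / AE) `^ (p - 1).
have sAE0 : 0 < 2 * s / AE by rewrite divr_gt0// mulr_gt0.
have lam0 : 0 < lam by rewrite powR_gt0.
have lamq : lam `^ (- q) = AE / (2 * s).
  by rewrite /lam -powRrM mulrN [(p - 1) * q]mulrC qE powRN powRr1 ?(ltW sAE0)// invf_div.
have := young lam lam0; rewrite lamq -EFinM -EFinD lee_fin => hy.
have {}hy : AE / 2 <= lam * UE.
  have e : AE / (2 * s) * s = AE / 2 by field; rewrite gt_eqF.
  rewrite e in hy; lra.
have X1 : 0 <= 2 * sA / AE by rewrite divr_ge0 ?mulr_ge0// ltW.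
apply: (@le_trans _ _ (M * (2 * sA / AE) `^ p * UE)); last first.
  rewrite ler_wpM2r// ler_pM2l// ge0_ler_powR ?nnegrE ?(ltW p0)//.
    by rewrite divr_ge0 ?mulr_ge0 ?(ltW AE0)// (le_trans _ sAS)// ltW.
  by rewrite ler_pM2r ?invr_gt0// ler_pM2l.
rewrite -mulr_powRB1//.
have e1 : lam = (sA^-1 * s) `^ (p - 1) * (2 * sA / AE) `^ (p - 1).
  rewrite /lam -powRM ?mulr_ge0 ?invr_ge0 ?ltW//; congr (_ `^ _).
  by field; rewrite !gt_eqF.
set Y := (sA^-1 * s) `^ (p - 1) in hB powp e1; set Z := (2 * sA / AE) `^ (p - 1) in e1 *.
rewrite -(ler_pM2r powp).
have e2 : M * (2 * sA / AE * Z) * UE * Y = M * (2 * sA / AE) * (lam * UE).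
  by rewrite e1; ring.
rewrite e2; have iY : i * Y <= M * sA.
  rewrite -(ler_pM2l sAi); apply: (@le_trans _ _ M).
    by rewrite mulrA.
  by rewrite mulrCA mulVf ?gt_eqF// mulr1.
apply: (le_trans iY); apply: (@le_trans _ _ (M * (2 * sA / AE) * (AE / 2))).
  by rewrite le_eqVlt; apply/orP; left; apply/eqP; field; rewrite gt_eqF.
by rewrite ler_wpM2l// mulr_ge0// ltW.
Qed.

End bekolle_doubling.

(** * Test functions bounding the kernel from below *)

Section test_functions.
Context {R : realType}.
Local Notation C := (Cplx R).
Local Notation D := (pt @^-1` (disk : set C)).
Implicit Types (z w : C).

(** Cut off outside the disk, as elements of [A2] are extended by 0. Polynomials have a finite power
    series at every centre, so analyticity is immediate. *)
Definition poly_on_disk (P : {poly C}) (w : C) : C := if `[< disk w >] then P.[w] else 0.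

Lemma poly_on_diskE P w : disk w -> poly_on_disk P w = P.[w].
Proof. by move=> Dw; rewrite /poly_on_disk asboolT. Qed.

Lemma analytic_poly (P : {poly C}) : analytic_on disk (poly_on_disk P).
Proof.
move=> z0 Dz0; have [r r0 hr] := disk_nbhd Dz0; exists r => //.
pose Q : {poly C} := P \Po ('X + z0%:P); exists (fun n => Q`_n) => z zr.
rewrite poly_on_diskE; last exact: hr.
have -> : P.[z] = Q.[z - z0] by rewrite /Q horner_comp hornerD hornerX hornerC subrK.
apply/cplx_cvgP => eps eps0; exists (size Q) => n Qn.
rewrite seriesEnat /= horner_coef (big_cat_nat (n := size Q))//= big_mkord.
have -> : \sum_(size Q <= i < n) Q`_i * (z - z0) ^+ i = 0.
  by rewrite big_nat_cond big1// => i /andP[/andP[Qi _] _]; rewrite nth_default ?mul0r.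
by rewrite addr0 subrr normc0.
Qed.

(** With N = n + 1, the decay 2^(-2kN) on the k-th shell beats the mass growth 4^(kn) by the
    summable factor 4^(-k). *)
Lemma half_pow_shell k n :
  (2 ^+ k)^-1 ^+ (2 * n.+1) = (1 / 4) ^+ k * ((4 ^+ (k * n))^-1) :> R.
Proof.
rewrite div1r !exprVn -invfM; congr (_^-1).
have -> : 4 = 2 ^+ 2 :> R by rewrite -natrX.
by rewrite -!exprM -exprD; congr (_ ^+ _); rewrite mulnS mulnDr mulnC mulnCA.
Qed.

Lemma geometric_quarter_le K : \sum_(0 <= k < K) (1 / 4 : R) ^+ k <= 2.
Proof.
suff h : \sum_(0 <= k < K) (1 / 4 : R) ^+ k <= 2 - 2 * (1 / 4) ^+ K.
  by apply: (le_trans h); rewrite gerBl mulr_ge0// exprn_ge0// divr_ge0.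
elim: K => [|K IH]; first by rewrite big_geq// expr0 mulr1 subrr.
rewrite big_nat_recr//= exprS.
have q0 : 0 <= (1 / 4 : R) ^+ K by rewrite exprn_ge0// divr_ge0.
by apply: (le_trans (lerD IH (lexx _))); lra.
Qed.

Lemma radial_direction z : exists2 zeta, normc zeta = 1 & z = (normc z)%:C * zeta.
Proof.
have [->|zN] := eqVneq z 0; first by exists 1; rewrite ?normc1// normc0 mul0r.
have nN : normc z != 0 by apply: contra zN => /eqP /eq0_normc ->; exact: eqxx.
exists (((normc z)^-1)%:C * z).
  by rewrite normcM normc_real ger0_norm ?invr_ge0 ?normc_ge0// mulVf.
rewrite mulrA; have -> : (normc z)%:C * ((normc z)^-1)%:C = 1 :> C.
  have -> : (normc z)%:C * ((normc z)^-1)%:C = (normc z * (normc z)^-1)%:C :> C.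
    by apply/esym; exact: rmorphM.
  by rewrite divff.
by rewrite mul1r.
Qed.

Variables (u : C -> R) (p : R).
Hypotheses (hu : is_weight u) (p1 : 1 < p) (huB : Bp p u) (huC1 : condC1 u).

Let u0 z : disk z -> 0 < u z. Proof. by case: hu => + _ _; apply. Qed.
Let mu_u : measurable_fun D (u \o pt). Proof. by case: hu. Qed.
Let mD := @measurable_disk R.

Let region (zeta : C) (s : R) : set C := disk `&` eball zeta s.

Let m_region zeta s : measurable (pt @^-1` region zeta s).
Proof. by rewrite preimage_setI; apply: measurableI => //; exact: measurable_eball. Qed.

(** Doubling is applied with S a Carleson region containing the dilate and E the disk of radius (1 -
    |z|) / 4 at z, where u is comparable to u(z). The ratio of areas is of order 4^k, and the
    exponent p is rounded up to N'. *)
Let region_mass (N' : nat) : p <= N'%:R -> exists2 c, 0 < c &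
  forall z zeta k, disk z -> normc zeta = 1 -> z = (normc z)%:C * zeta ->
  (intE area (region zeta (5 / 4 * 2 ^+ k * (1 - normc z))) u <=
    (c * 4 ^+ (k * N') * local_mass u z)%:E)%E.
Proof.
move=> pN; have [M M0 hM] := bekolle_doubling hu p1 huB.
have [A A1 hA] := weight_comparable hu huC1.
have A0 : 0 < A by exact: lt_le_trans A1.
(* 12800 = 128 (5/2)^2 16, where 128 is the 2 of the doubling estimate times the 64 of the area of a
   Carleson region. *)
have [kap kap1 hkap] : exists2 kap : R, 1 <= kap & forall P T d : R,
    P * (128 * (5 / 2 * T * d) ^+ 2) = kap * (T * T) * (P * (d / 4) ^+ 2).
  by exists 12800 => [|P T d]; [rewrite ler1n|field].
have kap0 : 0 < kap by exact: lt_le_trans kap1.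
have piv0 : 0 < (pi : R)^-1 by rewrite invr_gt0 pi_gt0.
exists (M * kap ^+ N' * (A * (pi^-1 / 4))).
  by rewrite !mulr_gt0// exprn_gt0.
move=> z zeta k Dz z1 zE; set dl := 1 - normc z.
have nz1 : normc z < 1 by [].
have nz0 := normc_ge0 z.
have dl0 : 0 < dl by rewrite subr_gt0.
have dl1 : dl <= 1 by rewrite lerBlDr lerDl.
have dlb : dl <= bdist z by rewrite /dl /bdist; nra.
have k1 : 1 <= 2 ^+ k :> R by rewrite exprn_ege1// ler1n.
(* Half of t is the radius of the dilate, as [carleson_near] requires; at t = 1 the region is the
   whole disk. The factor 5/4 in that radius makes room, already for k = 0, for the disk of radius
   (1 - |z|) / 4 around z. *)
pose t := Num.min 1 (5 / 2 * 2 ^+ k * dl).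
have t0 : 0 < t by rewrite lt_min ltr01 /= !mulr_gt0// (lt_le_trans _ k1).
have t1 : t <= 1 by rewrite ge_min lexx.
have t01 : 0 < t <= 1 by rewrite t0.
have tle : t <= 5 / 2 * 2 ^+ k * dl by rewrite ge_min lexx orbT.
pose a : C := (1 - t)%:C * zeta.
have Da : disk a by exact: disk_radial.
have zz : normc (zeta - z) = dl.
  rewrite zE; have -> : zeta - (normc z)%:C * zeta = dl%:C * zeta.
    have -> : dl%:C = 1 - (normc z)%:C :> C by exact: rmorphB.
    by ring.
  by rewrite normcM z1 mulr1 normc_real gtr0_norm.
have near w : disk w -> normc (zeta - w) <= 5 / 4 * 2 ^+ k * dl -> carleson_region a w.
  move=> Dw hw; rewrite /a /t; case: (leP 1 (5 / 2 * 2 ^+ k * dl)) => h.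
    by rewrite carleson_full.
  apply: carleson_near => //; last by apply: (le_trans hw); lra.
  by rewrite (ltW h) andbT !mulr_gt0// (lt_le_trans _ k1).
have kdl : dl <= 2 ^+ k * dl by rewrite ler_peMl// ltW.
pose Ez := eball z (dl / 4).
have Ezb w : Ez w -> normc (w - z) <= bdist z / 4.
  by rewrite /Ez /eball /= => h; apply: (le_trans (ltW h)); lra.
have EzS : Ez `<=` carleson_region a.
  move=> w wz; apply: near.
    have h01 : 0 <= (1 : R) <= 1 by rewrite ler01 lexx.
    have wb : normc (w - z) <= 1 * bdist z / 4 by rewrite mul1r; exact: Ezb.
    by have [] := bdist_lip h01 Dz wb.
  apply: (le_trans (normc_dist_triangle z _ _)); rewrite zz [normc (z - w)]normc_distC.
  by move: wz; rewrite /Ez /eball /=; lra.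
have dl40 : 0 < dl / 4 by rewrite divr_gt0.
have Sarea : (area (pt @^-1` carleson_region a) <= (pi^-1 * (64 * t ^+ 2))%:E)%E.
  apply: (@le_trans _ _ (area (square zeta (4 * t)))).
    apply: le_measure; rewrite ?inE; [exact: measurable_carleson|exact: measurable_square|].
    by move=> q /(carleson_diam z1 t01); rewrite normc_distC; exact: ball_square.
  have t40 : 0 < 4 * t by rewrite mulr_gt0.
  rewrite areaE (leb2_square _ t40) -EFinM lee_fin ler_pM2l// exprMn; lra.
have EzU : (intE area Ez u <= (A * (pi^-1 / 4) * local_mass u z)%:E)%E.
  apply: (@le_trans _ _ (\int[area]_(q in pt @^-1` Ez) (cst (A * u z)%:E) q)%E).
    apply: ge0_le_integral_in => q Eq.
      by rewrite lee_fin ltW// u0//; apply: carleson_region_sub Da _ _; exact: EzS.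
    by rewrite lee_fin; have [] := hA z (pt q) Dz (Ezb _ Eq).
  rewrite integral_cst; last exact: measurable_eball.
  have uz := u0 Dz.
  have Auz : (0 <= (A * u z)%:E)%E by rewrite lee_fin mulr_ge0// ltW.
  apply: (le_trans (lee_wpmul2l Auz (area_eball_le z dl40))).
  rewrite -EFinM lee_fin /local_mass.
  have -> : A * u z * (pi^-1 * (4 * (dl / 4) ^+ 2)) = A * (pi^-1 / 4) * (u z * dl ^+ 2).
    by move: (pi^-1) (u z) => P v; field.
  rewrite ler_pM2l ?mulr_gt0// ler_pM2l// lerXn2r ?nnegrE ?(ltW dl0)//.
  by rewrite ltW// bdist_gt0.
have AE0 : 0 < pi^-1 * (dl / 4) ^+ 2 by rewrite mulr_gt0// exprn_gt0.
have := hM a Ez _ _ _ Da EzS (measurable_eball _ _) AE0 (area_eball_ge z dl40) Sarea EzU.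
move=> h; apply: le_trans _ (le_trans h _).
  have mS := measurable_carleson Da.
  have muS : measurable_fun (pt @^-1` carleson_region a) (fun q => (u (pt q))%:E).
    apply/measurable_EFinP; apply: (measurable_funS mD _ mu_u).
    by move=> q; exact: carleson_region_sub.
  have mr := m_region zeta (5 / 4 * 2 ^+ k * dl).
  apply: (ge0_subset_integral area mr mS muS).
    by move=> q /(carleson_region_sub Da) Dq; rewrite lee_fin ltW// u0.
  move=> q [Dq]; rewrite /eball /= normc_distC => /ltW; exact: near.
have V0 := local_mass_gt0 hu Dz.
have AP : 0 < A * (pi^-1 / 4) by rewrite mulr_gt0// divr_gt0.
rewrite lee_fin; move: (A * (pi^-1 / 4)) AP => A' AP.
have -> : M * kap ^+ N' * A' * 4 ^+ (k * N') * local_mass u z =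
  M * (kap ^+ N' * 4 ^+ (k * N')) * (A' * local_mass u z) by ring.
rewrite ler_pM2r; last by rewrite mulr_gt0.
rewrite ler_pM2l//.
have X1 : 2 * (pi^-1 * (64 * t ^+ 2)) / (pi^-1 * (dl / 4) ^+ 2) <= kap * 4 ^+ k.
  rewrite ler_pdivrMr//.
  have ht : t ^+ 2 <= (5 / 2 * 2 ^+ k * dl) ^+ 2.
    by rewrite lerXn2r ?nnegrE ?(ltW t0)// (le_trans (ltW t0)).
  have e : kap * 4 ^+ k * (pi^-1 * (dl / 4) ^+ 2) = pi^-1 * (128 * (5 / 2 * 2 ^+ k * dl) ^+ 2).
    by rewrite hkap; have -> : 4 ^+ k = 2 ^+ k * 2 ^+ k :> R by rewrite -exprMn -natrM.
  rewrite e; have -> : 2 * (pi^-1 * (64 * t ^+ 2)) = pi^-1 * (128 * t ^+ 2).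
    by move: (pi^-1) => P; ring.
  by rewrite ler_pM2l// ler_pM2l.
have X0 : 0 <= 2 * (pi^-1 * (64 * t ^+ 2)) / (pi^-1 * (dl / 4) ^+ 2).
  apply: divr_ge0 (ltW AE0); apply: mulr_ge0 => //; apply: mulr_ge0 (ltW piv0) _.
  by apply: mulr_ge0; rewrite ?sqr_ge0 ?ler0n.
have kk1 : 1 <= kap * 4 ^+ k.
  by rewrite -[leLHS]mulr1 ler_pM// exprn_ege1// ler1n.
have kk0 : 0 <= kap * 4 ^+ k by exact: le_trans kk1.
apply: (@le_trans _ _ ((kap * 4 ^+ k) `^ N'%:R)).
  apply: (@le_trans _ _ ((kap * 4 ^+ k) `^ p)).
    by rewrite ge0_ler_powR ?nnegrE// (le_trans _ (ltW p1)).
  exact: ler_powR.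
by rewrite powR_mulrn// exprMn exprM.
Qed.

(** f is the N-th power of a partial sum of 1 / (1 - conj(z) w), with N - 1 >= p. Everywhere |f| <=
    (2 / |1 - conj(z) w|)^N, and on dyadic shells around the boundary point zeta in the direction of
    z this decays faster than the u-mass of the shells grows. *)
Lemma kernel_test_function : exists2 c, 0 < c & forall z, disk z ->
  exists f, [/\ A2 u f, f z != 0 &
    c * complex.Re (A2ip u f f) <= local_mass u z * normc (f z) ^+ 2].
Proof.
pose N' := (Num.bound p).
have pN : p <= N'%:R by rewrite ltW// archi_boundP// (le_trans _ (ltW p1)).
pose N := N'.+1.
have [cr cr0 hreg] := region_mass pN.
have e8 : 0 < (8 : R) ^+ (2 * N) by rewrite exprn_gt0.
have c40 : 0 < (1 / 4 : R) ^+ (2 * N) by apply: exprn_gt0; rewrite divr_gt0.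
have den0 : 0 < 2 * 8 ^+ (2 * N) * cr by apply: mulr_gt0 => //; apply: mulr_gt0.
exists ((1 / 4) ^+ (2 * N) / (2 * 8 ^+ (2 * N) * cr)); first exact: divr_gt0.
move=> z Dz; have [zeta z1 zE] := radial_direction z.
set dl := 1 - normc z.
have nz1 : normc z < 1 by [].
have nz0 := normc_ge0 z.
have dl0 : 0 < dl by rewrite subr_gt0.
have V0 := local_mass_gt0 hu Dz.
(* The partial sum is long enough to be, at w = z, at least half of the full sum 1 / (1 - |z|^2). *)
have [n hn] : exists n, (normc z ^+ 2) ^+ n <= 1 / 2.
  have z2 : `|normc z ^+ 2| < 1 by rewrite ger0_norm ?sqr_ge0// expr_lt1.
  have /cvgrPdist_lt /(_ (1 / 2)) := cvg_expr z2.
  have h2 : 0 < (1 / 2 : R) by rewrite divr_gt0.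
  move=> /(_ h2) [n _ /(_ n (leqnn n))]; rewrite /= sub0r normrN => h; exists n.
  by apply: ltW; apply: le_lt_trans h; exact: ler_norm.
pose P : {poly C} := (\sum_(i < n) (conjc z ^+ i) *: 'X^i) ^+ N.
pose f := poly_on_disk P.
have PE w : P.[w] = (\sum_(i < n) (conjc z * w) ^+ i) ^+ N.
  rewrite /P horner_exp horner_sum; congr (_ ^+ _); apply: eq_bigr => i _.
  by rewrite hornerZ hornerXn exprMn.
have geo (x : C) : (1 - x) * (\sum_(i < n) x ^+ i) = 1 - x ^+ n.
  have := subrX1 x n; rewrite -opprB => /eqP; rewrite eqr_oppLR => /eqP ->.
  by rewrite -mulNr opprB.
have den_ge w : disk w -> dl <= normc (1 - conjc z * w) /\
    normc (zeta - w) <= 2 * normc (1 - conjc z * w).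
  move=> Dw; have w1 : normc w < 1 by [].
  have w0 := normc_ge0 w.
  have d1 : dl <= normc (1 - conjc z * w).
    have := normcB_ge (1 : C) (conjc z * w); rewrite normc1 normcM normc_conj /dl; nra.
  split => //.
  have zz : conjc zeta * zeta = 1 by rewrite conjc_mul_normc z1 expr1n.
  have -> : normc (zeta - w) = normc (1 - conjc zeta * w).
    have -> : 1 - conjc zeta * w = conjc zeta * (zeta - w) by rewrite mulrBr zz.
    by rewrite normcM normc_conj z1 mul1r.
  have -> : 1 - conjc zeta * w = (1 - conjc z * w) - dl%:C * conjc zeta * w.
    rewrite {1}zE conjcM conjc_real.
    have -> : dl%:C = 1 - (normc z)%:C :> C by exact: rmorphB.
    by ring.
  apply: (le_trans (normcD _ _)); rewrite normcN !normcM normc_conj z1 mulr1 normc_real gtr0_norm//.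
  have : dl * normc w <= dl by rewrite ler_piMr ?ltW.
  lra.
have fle w : disk w -> normc (f w) ^+ 2 * normc (1 - conjc z * w) ^+ (2 * N) <= 2 ^+ (2 * N).
  move=> Dw; have w1 : normc w < 1 by [].
  have w0 := normc_ge0 w.
  rewrite /f poly_on_diskE// PE normcX -exprM [(N * 2)%N]mulnC -exprMn -normcM mulrC geo.
  apply: lerXn2r; rewrite ?nnegrE ?normc_ge0//.
  apply: (le_trans (normcD _ _)); rewrite normcN normc1 normcX normcM normc_conj.
  rewrite (_ : 2 = 1 + 1)// lerD2l exprn_ile1// ?mulr_ge0//; nra.
pose rk k := region zeta (5 / 4 * 2 ^+ k * dl).
pose ck k : R := (8 / (2 ^+ k * dl)) ^+ (2 * N).
have ck0 k : 0 <= ck k by rewrite exprn_ge0// divr_ge0// mulr_ge0 ?exprn_ge0// ltW.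
(* After K - 1 doublings the disk around zeta contains the unit disk, since 2^(K-1) (1 - |z|) >
   2. *)
pose K := (Num.bound (2 / dl)).+1.
have bigK w : disk w -> rk K.-1 w.
  move=> Dw; split=> //; rewrite /eball /=.
  have w1 : normc w < 1 by [].
  apply: (le_lt_trans (normcD _ _)); rewrite normcN z1.
  have h1 : 2 < (Num.bound (2 / dl))%:R * dl.
    by rewrite -ltr_pdivrMr// archi_boundP// divr_ge0// ltW.
  have h2 : (Num.bound (2 / dl))%:R * dl <= 2 ^+ (Num.bound (2 / dl)) * dl.
    by rewrite ler_pM2r// -natrX ler_nat ltnW// ltn_expl.
  rewrite /K /=; lra.
have shell w : disk w -> normc (f w) ^+ 2 * u w <=
    \sum_(k < K) ck k * (\1_(pt @^-1` rk k) (complex.Re w, complex.Im w) * u w).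
  move=> Dw; have uw := u0 Dw.
  have ex : exists k, `[< rk k w >] by exists K.-1; apply/asboolP; exact: bigK.
  case: (ex_minnP ex) => k /asboolP rkw kmin.
  have kK : (k < K)%N.
    by rewrite /K ltnS; apply: kmin; apply/asboolP; have := bigK w Dw.
  have [d1 d2] := den_ge w Dw.
  have dp : 0 < normc (1 - conjc z * w) by exact: lt_le_trans d1.
  (* For k > 0, minimality of k puts w outside the previous disk, so |zeta - w| >= 5/4 2^(k-1) dl,
     while |zeta - w| <= 2 |1 - conj(z) w|. For k = 0 the bound dl <= |1 - conj(z) w| suffices. *)
  have hden : 2 ^+ k * dl <= 4 * normc (1 - conjc z * w).
    case: k {kK} rkw kmin => [|k] rkw kmin; first by rewrite expr0 mul1r; lra.
    have : ~ rk k w by move=> /asboolP /kmin; rewrite ltnn.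
    rewrite exprS => nrk.
    have : 5 / 4 * 2 ^+ k * dl <= normc (zeta - w).
      by rewrite leNgt; apply/negP => h; apply: nrk; split=> //; rewrite /eball /= normc_distC.
    have := exprn_ge0 k (ler0n R 2); nra.
  have p2 : 0 < 2 ^+ k * dl by rewrite mulr_gt0// exprn_gt0.
  have fck : normc (f w) ^+ 2 <= ck k.
    have dN : 0 < normc (1 - conjc z * w) ^+ (2 * N) by rewrite exprn_gt0.
    rewrite -(ler_pM2r dN); apply: (le_trans (fle w Dw)).
    rewrite /ck -exprMn lerXn2r ?nnegrE ?mulr_ge0 ?divr_ge0 ?(ltW p2) ?(ltW dp)//.
      by rewrite invr_ge0 ltW.
    by rewrite mulrAC ler_pdivlMr//; lra.
  rewrite (bigD1 (Ordinal kK))//=.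
  have -> : \1_(pt @^-1` rk k) (complex.Re w, complex.Im w) = 1 :> R.
    by rewrite indicE mem_set//= /pt /= complex_eta.
  rewrite mul1r; apply: (@le_trans _ _ (ck k * u w)); first by rewrite ler_pM2r.
  rewrite lerDl; apply: sumr_ge0 => i _; rewrite mulr_ge0// mulr_ge0// ltW//.
have mass_le : (mass u f disk <= (2 * 8 ^+ (2 * N) * cr * (dl ^-1 ^+ (2 * N)) * local_mass u z)%:E)%E.
  have le1 : (mass u f disk <= \int[area]_(q in D)
     (\sum_(k <- index_iota 0 K) ((ck k)%:E * ((\1_(pt @^-1` rk k) q : R)%:E * (u (pt q))%:E))))%E.
    apply: ge0_le_integral_in => q Dq; first by rewrite lee_fin mass_ge0.
    rewrite -[X in (_ <= X)%E]/(_) big_mkord.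
    rewrite (eq_bigr (fun k : 'I_K => (ck k * (\1_(pt @^-1` rk k) q * u (pt q)))%:E)); last first.
      by move=> i _; rewrite -!EFinM.
    rewrite sumEFin lee_fin; have := shell _ Dq.
    by rewrite /pt /=; case: q Dq.
  apply: (le_trans le1) => {le1}.
  have mi k : measurable_fun D (fun q => ((\1_(pt @^-1` rk k) q : R)%:E * (u (pt q))%:E)%E).
    apply: emeasurable_funM; last exact/measurable_EFinP.
    apply/measurable_EFinP; apply: measurable_funTS; apply: measurable_indic.
    exact: m_region.
  have i0 k q : D q -> (0 <= (\1_(pt @^-1` rk k) q : R)%:E * (u (pt q))%:E)%E.
    by move=> Dq; rewrite mule_ge0// lee_fin// ltW// u0.
  rewrite ge0_integral_sum//; first last.
  - move=> k q Dq; apply: mule_ge0; [by rewrite lee_fin; exact: ck0|exact: i0].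
  - by move=> k; apply: measurable_funeM.
  rewrite (@eq_bigr _ _ _ _ _ _ _ (fun k => (ck k)%:E * intE area (rk k) u)%E); last first.
    move=> k _; rewrite ge0_integralZl//; [|by move=> q; exact: i0|by rewrite lee_fin; exact: ck0].
    congr (_ * _)%E; rewrite /intE.
    have -> : pt @^-1` rk k = D `&` (pt @^-1` rk k).
      by apply/seteqP; split=> q; [move=> h; split => //; case: h|case].
    rewrite integral_mkcondr; apply: eq_integral => q _.
    rewrite /patch indicE; case: ifPn => [qr|qr]; first by rewrite inE in qr; rewrite mem_set ?mul1e//; case: qr.
    rewrite memNset ?mul0e// => qr'; move: qr; rewrite notin_setE; apply.
    by case: qr'.
  apply: (@le_trans _ _ (\sum_(k <- index_iota 0 K)
     ((ck k * (cr * 4 ^+ (k * N') * local_mass u z)))%:E)%E).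
    apply: lee_sum => k _; rewrite [leRHS](EFinM (ck k) _); apply: lee_wpmul2l; [by rewrite lee_fin; exact: ck0|].
    exact: hreg.
  rewrite sumEFin lee_fin.
  have ckE k : ck k * (cr * 4 ^+ (k * N') * local_mass u z) =
      (8 ^+ (2 * N) * cr * (dl ^-1 ^+ (2 * N)) * local_mass u z) * (1 / 4) ^+ k.
    have e1 : (8 / (2 ^+ k * dl)) ^+ (2 * N) =
        8 ^+ (2 * N) * ((2 ^+ k)^-1 ^+ (2 * N) * dl^-1 ^+ (2 * N)).
      by rewrite invfM !exprMn.
    have e2 := half_pow_shell k N'.
    have N4 : (4 : R) ^+ (k * N') != 0 by rewrite expf_neq0.
    rewrite /ck e1 /N e2 -/N; move: (4 ^+ (k * N')) N4 => x x0.
    move: (8 ^+ (2 * N)) ((1 / 4) ^+ k) (dl^-1 ^+ (2 * N)) (local_mass u z).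
    by move=> a b c v; field.
  under eq_bigr do rewrite ckE.
  rewrite -mulr_sumr.
  have c1 : 0 <= 8 ^+ (2 * N) * cr * dl^-1 ^+ (2 * N) * local_mass u z.
    apply: mulr_ge0 (ltW V0); apply: mulr_ge0; first by apply: mulr_ge0; exact: ltW.
    by rewrite exprn_ge0// invr_ge0 ltW.
  apply: (le_trans (ler_wpM2l c1 (geometric_quarter_le K))).
  by rewrite le_eqVlt; apply/orP; left; apply/eqP; ring.
have Af : A2 u f.
  split; first exact: analytic_poly.
    by move=> w nw; rewrite /f /poly_on_disk asboolF.
  by apply: le_lt_trans mass_le _; rewrite ltry.
have fz : (1 / (4 * dl)) ^+ N <= normc (f z).
  rewrite /f poly_on_diskE// PE normcX conjc_mul_normc.
  have nn : 0 <= 1 / (4 * dl) by rewrite divr_ge0// mulr_ge0// ltW.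
  rewrite lerXn2r ?nnegrE ?normc_ge0//.
  have x1 : 0 < 1 - normc z ^+ 2 by rewrite subr_gt0 expr_lt1.
  have := congr1 (@normc R) (geo ((normc z ^+ 2)%:C)).
  have -> : 1 - (normc z ^+ 2)%:C = (1 - normc z ^+ 2)%:C :> C by apply/esym; exact: rmorphB.
  have -> : 1 - (normc z ^+ 2)%:C ^+ n = (1 - (normc z ^+ 2) ^+ n)%:C :> C.
    have <- : ((normc z ^+ 2) ^+ n)%:C = (normc z ^+ 2)%:C ^+ n :> C by exact: rmorphXn.
    by apply/esym; exact: rmorphB.
  rewrite normcM !normc_real (gtr0_norm x1) ger0_norm; last by rewrite subr_ge0; lra.
  set S := normc (\sum_(i < n) _) => hS.
  have S0 : 0 <= S by exact: normc_ge0.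
  have b2 : 1 - normc z ^+ 2 <= 2 * dl by rewrite /dl; nra.
  rewrite ler_pdivrMr ?mulr_gt0//.
  have : (1 - normc z ^+ 2) * S <= 2 * dl * S by rewrite ler_wpM2r.
  lra.
have fzp : 0 < normc (f z).
  by apply: lt_le_trans fz; rewrite exprn_gt0// divr_gt0// mulr_gt0.
exists f; split=> //.
  by apply/eqP => h; move: fzp; rewrite h normc0 ltxx.
have := mass_le; rewrite A2_massE// lee_fin => hm.
rewrite mulrAC ler_pdivrMr//.
apply: (le_trans (ler_wpM2l (ltW c40) hm)).
have fz2 : (1 / 4) ^+ (2 * N) * dl^-1 ^+ (2 * N) <= normc (f z) ^+ 2.
  rewrite -exprMn mulnC exprM lerXn2r ?nnegrE ?normc_ge0 ?exprn_ge0 ?mulr_ge0 ?divr_ge0 ?invr_ge0 ?(ltW dl0)//.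
  by apply: le_trans fz; rewrite !div1r invfM.
move: (normc (f z) ^+ 2) fz2 (2 * 8 ^+ (2 * N) * cr) den0 => F hF c hc.
have -> : (1 / 4) ^+ (2 * N) * (c * dl^-1 ^+ (2 * N) * local_mass u z) =
   ((1 / 4) ^+ (2 * N) * dl^-1 ^+ (2 * N)) * (c * local_mass u z) by ring.
have -> : local_mass u z * F * c = F * (c * local_mass u z) by ring.
by rewrite ler_pM2r// mulr_gt0.
Qed.

End test_functions.

(** * Reproducing kernels and the Toeplitz form *)

Section reproducing_kernels.
Context {R : realType}.
Local Notation C := (Cplx R).
Local Notation D := (pt @^-1` (disk : set C)).
Implicit Types (z w : C) (f g : C -> C).
Variable u : C -> R.
Hypothesis hu : is_weight u.
Hypothesis huC1 : condC1 u.
Variable K : C -> C -> C.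
Hypothesis hK : reproducing_kernel u K.
Local Notation ip := (A2ip u).
Local Notation n2 f := (complex.Re (A2ip u f f)).

Let ipP := A2_psd hu.
Let ipH := ipP.1.

Lemma kernel_A2 z : disk z -> A2 u (K^~ z).
Proof. by case/hK. Qed.

Lemma kernel_eval f z : A2 u f -> disk z -> f z = ip f (K^~ z).
Proof. by move=> Af /hK [_]; exact. Qed.

Definition knorm z : R := n2 (K^~ z).

Lemma kernel_sym z w : disk z -> disk w -> K z w = conjc (K w z).
Proof.
move=> Dz Dw; have Az := kernel_A2 Dz; have Aw := kernel_A2 Dw.
by rewrite (kernel_eval Aw Dz) (kernel_eval Az Dw) (hf_conj ipH Aw Az) conjcK.
Qed.

Lemma kernel_diag z : disk z -> K z z = (knorm z)%:C.
Proof.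
by move=> Dz; have Az := kernel_A2 Dz; rewrite {1}(kernel_eval Az Dz) (hf_real ipH Az).
Qed.

Lemma knorm_ge0 z : disk z -> 0 <= knorm z.
Proof. by move=> /kernel_A2; exact: ipP.2. Qed.

Lemma eval_le_knorm f z : A2 u f -> disk z -> normc (f z) ^+ 2 <= n2 f * knorm z.
Proof.
move=> Af Dz; rewrite (kernel_eval Af Dz).
exact: (psd_cauchy_schwarz ipP Af (kernel_A2 Dz)).
Qed.

(** For f = K_z the pointwise estimate reads K(z, z)^2 <= c / V(z) K(z, z). *)
Lemma knorm_le : exists2 c, 0 < c & forall z, disk z -> knorm z <= c / local_mass u z.
Proof.
have [c c0 hc] := A2_pointwise hu huC1; exists c => // z Dz.
have := hc _ z (kernel_A2 Dz) Dz; have V0 := local_mass_gt0 hu Dz.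
rewrite /= kernel_diag// normc_real ger0_norm ?knorm_ge0// -/(knorm z).
have := knorm_ge0 Dz; rewrite le_eqVlt => /orP[/eqP <- _|k0].
  by rewrite divr_ge0// ltW.
by rewrite expr2 ler_pM2r.
Qed.

(** For g = K_z - K_w the reproducing property gives |g|^2 = g(z) - g(w); the Lipschitz estimate for
    g itself bounds the right side by a multiple of |g|, and one factor cancels. *)
Lemma kernel_norm_lip : exists2 c, 0 < c & forall z w, disk z -> disk w ->
  normc (z - w) <= bdist z / 32 ->
  n2 (K^~ z - K^~ w) <= c * (normc (z - w) / bdist z) ^+ 2 / local_mass u z.
Proof.
have [c c0 hc] := A2_lipschitz hu huC1; exists c => // z w Dz Dw zw.
have Az := kernel_A2 Dz; have Aw := kernel_A2 Dw.
have Ag := hfB ipH Az Aw; set g := K^~ z - K^~ w in Ag *.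
have gE : n2 g = complex.Re (g z - g w).
  by rewrite {2}/g (hf_antilinB ipH Ag Az Aw) (kernel_eval Ag Dz) (kernel_eval Ag Dw).
have := hc g z w Ag Dz zw; have g0 := ipP.2 _ Ag.
have : n2 g <= normc (g z - g w).
  by rewrite gE; apply: le_trans (normc_Re _); exact: ler_norm.
move=> h1 h2; move: g0; rewrite le_eqVlt => /orP[/eqP <-|g0].
  rewrite divr_ge0 ?(ltW (local_mass_gt0 hu Dz))// mulr_ge0 ?sqr_ge0// ltW//.
have h3 : n2 g ^+ 2 <= normc (g z - g w) ^+ 2.
  by rewrite lerXn2r ?nnegrE ?normc_ge0// ltW.
have := le_trans h3 h2.
have -> : c * (normc (z - w) / bdist z) ^+ 2 * (n2 g / local_mass u z) =
  (c * (normc (z - w) / bdist z) ^+ 2 / local_mass u z) * n2 g by ring.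
by rewrite [n2 g ^+ 2]expr2 ler_pM2r.
Qed.

Lemma kernel_norm_cont z eps : disk z -> 0 < eps -> exists2 d : R, 0 < d &
  forall w, normc (w - z) < d -> disk w /\ n2 (K^~ w - K^~ z) < eps.
Proof.
move=> Dz e0; have [c c0 hc] := kernel_norm_lip; have V0 := local_mass_gt0 hu Dz.
have b0 := bdist_gt0 Dz; have [d1 d10 hd1] := disk_nbhd Dz.
have [A A0 AE] : exists2 A, 0 < A & A = c / local_mass u z / bdist z ^+ 2.
  by eexists; last reflexivity; rewrite !divr_gt0// exprn_gt0.
exists (Num.min d1 (Num.min (bdist z / 32) (Num.min 1 (eps / (2 * A))))).
  by rewrite !lt_min d10 ltr01 !divr_gt0// mulr_gt0.
move=> w; rewrite !lt_min => /and4P[w1 w2 w3 w4].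
have Dw := hd1 _ w1; split => //.
have -> : n2 (K^~ w - K^~ z) = n2 (K^~ z - K^~ w).
  have Ag := hfB ipH (kernel_A2 Dz) (kernel_A2 Dw).
  have -> : K^~ w - K^~ z = (-1 : C) *: (K^~ z - K^~ w) by rewrite scaleN1r opprB.
  by rewrite (hf_sqrZ ipH _ Ag) normcN normc1 expr1n mul1r.
have := hc z w Dz Dw; rewrite normc_distC => /(_ (ltW w2)) h.
apply: (le_lt_trans h).
have -> : c * (normc (w - z) / bdist z) ^+ 2 / local_mass u z = A * normc (w - z) ^+ 2.
  by rewrite AE expr_div_n; ring.
have n0 := normc_ge0 (w - z).
apply: (@le_lt_trans _ _ (A * normc (w - z))).
  by rewrite ler_pM2l// expr2 ler_piMr// ltW.
move: w4; rewrite ltr_pdivlMr ?mulr_gt0//; have := mulr_ge0 (ltW A0) n0.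
by move: (normc _) => n; rewrite mulrCA [n * A]mulrC; lra.
Qed.

Section lower_bounds.
Variable p : R.
Hypotheses (hp : 1 < p) (huB : Bp p u).

Lemma knorm_ge : exists2 c, 0 < c & forall z, disk z -> c / local_mass u z <= knorm z.
Proof.
have [c c0 hc] := kernel_test_function hu hp huB huC1; exists c => // z Dz.
have [f [Af fz cf]] := hc z Dz; have V0 := local_mass_gt0 hu Dz.
have f1 : 0 < normc (f z) ^+ 2.
  rewrite exprn_gt0// lt_neqAle normc_ge0 andbT eq_sym.
  by apply: contra fz => /eqP /eq0_normc ->.
have h := eval_le_knorm Af Dz.
have n0 : 0 < n2 f.
  rewrite lt_neqAle (ipP.2 _ Af) andbT eq_sym; apply/eqP => h0.
  by move: (lt_le_trans f1 h); rewrite h0 mul0r ltxx.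
rewrite ler_pdivrMr// mulrC -(ler_pM2r n0); apply: (le_trans cf).
by rewrite -(mulrA _ (knorm z)) [knorm z * _]mulrC ler_pM2l.
Qed.

Lemma knorm_gt0 z : disk z -> 0 < knorm z.
Proof.
have [c c0 hc] := knorm_ge => Dz; apply: lt_le_trans (hc z Dz).
by rewrite divr_gt0// (local_mass_gt0 hu Dz).
Qed.

Lemma kernel_near_diag : exists d c : R, [/\ 0 < d, d <= 1 / 32, 0 < c &
  forall z w, disk z -> normc (w - z) <= d * bdist z ->
  c / local_mass u z * knorm z <= normc (K w z) ^+ 2].
Proof.
have [c c0 hc] := A2_lipschitz hu huC1; have [k k0 hk] := knorm_ge.
(* Chosen so that |K(z, z) - K(w, z)|^2 <= c d^2 K(z, z) / V(z) <= K(z, z)^2 / 4, by K(z, z) >= k /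
   V(z). *)
pose d := Num.min (1 / 32) (Num.min 1 (k / (4 * c))).
have d0 : 0 < d by rewrite !lt_min ltr01 !divr_gt0// mulr_gt0.
have dc : 4 * c * d ^+ 2 <= k.
  have d1 : d <= 1 by rewrite !ge_min lexx !orbT.
  have : d <= k / (4 * c) by rewrite !ge_min lexx !orbT.
  rewrite ler_pdivlMr ?mulr_gt0// => h; apply: le_trans h.
  by rewrite mulrC ler_pM2r ?mulr_gt0// expr2 ler_piMr// ltW.
have d32 : d <= 1 / 32 by rewrite ge_min lexx.
exists d, (k / 4); split => //; first by rewrite divr_gt0.
move=> z w Dz wz; have b0 := bdist_gt0 Dz; have V0 := local_mass_gt0 hu Dz.
have Az := kernel_A2 Dz; have K0 := knorm_gt0 Dz.
have zw : normc (z - w) <= bdist z / 32.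
  rewrite normc_distC; apply: (le_trans wz).
  by apply: (@le_trans _ _ (1 / 32 * bdist z)); [rewrite ler_pM2r|lra].
have h := hc _ z w Az Dz zw; rewrite /= -/(knorm z) in h.
have q : (normc (z - w) / bdist z) ^+ 2 <= d ^+ 2.
  rewrite lerXn2r ?nnegrE ?(ltW d0) ?divr_ge0 ?normc_ge0 ?(ltW b0)//.
  by rewrite ler_pdivrMr// normc_distC.
have h4 : (2 * normc (K z z - K w z)) ^+ 2 <= knorm z ^+ 2.
  rewrite exprMn; have -> : 2 ^+ 2 = 4 :> R by rewrite -natrX.
  apply: (@le_trans _ _ (4 * (c * d ^+ 2 * (knorm z / local_mass u z)))).
    rewrite ler_pM2l//; apply: (le_trans h).
    by rewrite ler_pM2r ?divr_gt0// ler_pM2l.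
  have -> : 4 * (c * d ^+ 2 * (knorm z / local_mass u z)) =
    4 * c * d ^+ 2 * (knorm z / local_mass u z) by ring.
  apply: (@le_trans _ _ (k * (knorm z / local_mass u z))); first by rewrite ler_pM2r ?divr_gt0.
  have := hk z Dz; rewrite expr2 mulrCA [k * _]mulrC mulrA => hh.
  by rewrite -mulrA ler_pM2l// mulrC.
have h5 : 2 * normc (K z z - K w z) <= knorm z.
  by rewrite -(@ler_pXn2r _ 2) ?nnegrE ?mulr_ge0 ?normc_ge0 ?(ltW K0).
have : knorm z <= 2 * normc (K w z).
  have := normcB_ge (K z z) (K w z).
  by rewrite {1}(kernel_diag Dz) normc_real gtr0_norm//; lra.
move=> h6.
apply: (@le_trans _ _ (knorm z ^+ 2 / 4)).
  have -> : k / 4 / local_mass u z * knorm z = (k / local_mass u z) * knorm z / 4 by ring.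
  by rewrite ler_pM2r// expr2 ler_pM2r// hk.
rewrite ler_pdivrMr// mulrC; have -> : 4 = 2 ^+ 2 :> R by rewrite -natrX.
by rewrite -exprMn lerXn2r ?nnegrE ?mulr_ge0 ?normc_ge0 ?(ltW K0).
Qed.

End lower_bounds.
End reproducing_kernels.

(** * Nearly minimal vectors and continuity of bounded forms *)

Section hilbert_limits.
Context {R : realType} {V : lmodType (Cplx R)}.
Local Notation C := (Cplx R).
Variables (H : set V) (ip : V -> V -> C).
Hypothesis ipP : psd_form H ip.
Local Notation n2 f := (complex.Re (ip f f)).
Let ipH := ipP.1.

Lemma hf_parallelogram f g : H f -> H g -> n2 (f - g) + n2 (f + g) = 2 * n2 f + 2 * n2 g.
Proof.
move=> Hf Hg.
have -> : f - g = f - (1 : C) *: g by rewrite scale1r.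
have -> : f + g = f - (-1 : C) *: g by rewrite scaleN1r opprK.
rewrite !(hf_sqrB_scale ipH)// normcN normc1 expr1n.
have -> : conjc (1 : C) = 1 by exact: rmorph1.
have -> : conjc (-1 : C) = -1 by exact: rmorphN1.
by rewrite mulN1r mul1r Re_opp; ring.
Qed.

(** Subtracting c k with c = <r, k> / (|k|^2 + 1) lowers the squared norm by at least |<r, k>|^2 /
    (|k|^2 + 1), yet not below d. The summand 1 covers the case k = 0. *)
Lemma near_minimal_orth r k (d eps : R) : H r -> H k ->
  (forall c : C, d <= n2 (r - c *: k)) -> n2 r <= d + eps ->
  normc (ip r k) ^+ 2 <= eps * (n2 k + 1).
Proof.
move=> Hr Hk hd hr; have k0 := ipP.2 _ Hk.
have k1 : 0 < n2 k + 1 by rewrite ltr_wpDl.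
set t := (n2 k + 1)^-1; have t0 : 0 < t by rewrite invr_gt0.
have := hd (t%:C * ip r k); rewrite (hf_sqrB_scale ipH)//.
have -> : conjc (t%:C * ip r k) * ip r k = (t * normc (ip r k) ^+ 2)%:C.
  rewrite conjcM conjc_real -mulrA [conjc _ * _]mulrC mulc_conj.
  by apply/esym; exact: rmorphM.
rewrite /= normcM normc_real (gtr0_norm t0) exprMn.
set N := normc (ip r k) ^+ 2 => h; have N0 : 0 <= N by exact: sqr_ge0.
rewrite -ler_pdivrMr// -/t.
have tk : t * n2 k <= 1 by rewrite mulrC ler_pdivrMr// mul1r lerDl.
have : t * N * (t * n2 k) <= t * N * 1 by rewrite ler_wpM2l// mulr_ge0// ltW.
rewrite -/t in h; rewrite [N * t]mulrC; move: h hr.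
have -> : t ^+ 2 * N * n2 k = t * N * (t * n2 k) by ring.
move: (t * N) (t * N * _) (n2 r) => a b x; lra.
Qed.

Variable T : V -> V.
Hypothesis T_lin : linear_op H T.
Variable M : R.
Hypothesis M0 : 0 <= M.
Hypothesis T_le : forall f, H f -> n2 (T f) <= M * n2 f.

Let TB f g : H f -> H g -> T (f - g) = T f - T g.
Proof.
move=> Hf Hg; have H0 := hf0 ipH; have h := T_lin.2.
have := h (-1) g f Hg Hf; rewrite !scaleN1r => e.
by rewrite addrC e addrC.
Qed.

Lemma op_form_le f g : H f -> H g -> normc (ip (T f) g) ^+ 2 <= M * n2 f * n2 g.
Proof.
move=> Hf Hg; apply: (le_trans (psd_cauchy_schwarz ipP (T_lin.1 _ Hf) Hg)).
by rewrite ler_wpM2r ?T_le// (ipP.2 _ Hg).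
Qed.

Lemma op_form_cont f g eps : H f -> H g -> 0 < eps -> exists2 d : R, 0 < d &
  forall f' g', H f' -> H g' -> n2 (f - f') <= d -> n2 (g - g') <= d ->
  normc (ip (T f) g - ip (T f') g') <= eps.
Proof.
move=> Hf Hg e0.
have f0 := ipP.2 _ Hf; have g0 := ipP.2 _ Hg.
pose S := M * (n2 g + 2 * n2 f + 2) + 1.
have S0 : 0 < S by rewrite ltr_wpDl// mulr_ge0// !addr_ge0// mulr_ge0.
exists (Num.min 1 ((eps / 2) ^+ 2 / S)).
  by rewrite lt_min ltr01 divr_gt0// exprn_gt0// divr_gt0.
move=> f' g' Hf' Hg'; rewrite !le_min => /andP[f1 f2] /andP[_ g2].
have Hff := hfB ipH Hf Hf'; have Hgg := hfB ipH Hg Hg'.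
have -> : ip (T f) g - ip (T f') g' = ip (T (f - f')) g + ip (T f') (g - g').
  rewrite TB// (hf_linB ipH) ?(hf_antilinB ipH)//; try exact: T_lin.1.
  by ring.
have ff0 := ipP.2 _ Hff; have gg0 := ipP.2 _ Hgg; have fp0 := ipP.2 _ Hf'.
have fp : n2 f' <= 2 * n2 f + 2.
  have := hf_parallelogram Hf Hff.
  have -> : f - (f - f') = f' by rewrite subKr.
  have := ipP.2 _ (hfD ipH Hf Hff); lra.
have e2 : 0 <= eps / 2 by rewrite divr_ge0// ltW.
have sm x : 0 <= x -> x <= (eps / 2) ^+ 2 / S -> forall k, 0 <= k ->
    k <= n2 g + 2 * n2 f + 2 -> M * x * k <= (eps / 2) ^+ 2.
  move=> x0 xS k k0 kS; move: xS; rewrite ler_pdivlMr// => h; apply: le_trans h.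
  rewrite -mulrA mulrCA ler_wpM2l// /S; apply: (@le_trans _ _ (M * (n2 g + 2 * n2 f + 2))).
    by rewrite ler_wpM2l.
  by rewrite lerDl.
apply: (le_trans (normcD _ _)); rewrite [leRHS]splitr; apply: lerD.
  rewrite -(@ler_pXn2r _ 2) ?nnegrE ?normc_ge0//.
  apply: (le_trans (op_form_le Hff Hg)); apply: sm => //; lra.
rewrite -(@ler_pXn2r _ 2) ?nnegrE ?normc_ge0//.
apply: (le_trans (op_form_le Hf' Hgg)); rewrite mulrAC; apply: sm => //; lra.
Qed.

End hilbert_limits.

Section kernel_span.
Context {R : realType}.
Local Notation C := (Cplx R).
Local Notation D := (pt @^-1` (disk : set C)).
Implicit Types (z w : C) (f g : C -> C).
Variable u : C -> R.
Hypothesis hu : is_weight u.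
Variable K : C -> C -> C.
Hypothesis hK : reproducing_kernel u K.
Local Notation ip := (A2ip u).
Local Notation n2 f := (complex.Re (A2ip u f f)).

Let ipP := A2_psd hu.
Let ipH := ipP.1.
Let mD := @measurable_disk R.
Let mu_u : measurable_fun D (u \o pt). Proof. by case: hu. Qed.

Inductive kspan : (C -> C) -> Prop :=
| kspan_zero : kspan 0
| kspan_cons (a : C) z f : disk z -> kspan f -> kspan (a *: K^~ z + f).

Lemma kspan_A2 f : kspan f -> A2 u f.
Proof.
elim=> [|a z g Dz _ Ag]; first exact: (hf0 ipH).
exact: (hfP ipH a (kernel_A2 hK Dz) Ag).
Qed.

Lemma kspan_linear (a : C) f g : kspan f -> kspan g -> kspan (a *: f + g).
Proof.
move=> sf sg; elim: sf => [|b z k Dz _ IH]; first by rewrite scaler0 add0r.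
by rewrite scalerDr scalerA -addrA; exact: kspan_cons.
Qed.

Lemma kspan_kernel z : disk z -> kspan (K^~ z).
Proof.
by move=> Dz; have := kspan_cons 1 Dz kspan_zero; rewrite scale1r addr0.
Qed.

(** r_n(z) = <r_n, K_z>, and a vector of nearly minimal norm modulo the span is nearly orthogonal to
    K_z. *)
Lemma minimizing_eval_cvg0 (r : nat -> C -> C) (d : R) z : disk z ->
  (forall n, A2 u (r n)) -> (forall n k, kspan k -> d <= n2 (r n - k)) ->
  (forall n, n2 (r n) <= d + n.+1%:R^-1) ->
  (fun n => normc (r n z)) @ \oo --> (0 : R).
Proof.
move=> Dz Ar dr rd; have Az := kernel_A2 hK Dz; have k0 := ipP.2 _ Az.
have k1 : 0 < n2 (K^~ z) + 1 by rewrite ltr_wpDl.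
apply/cvgrPdist_le => eps e0.
have e2 : 0 < eps ^+ 2 by rewrite exprn_gt0.
pose N := Num.bound ((n2 (K^~ z) + 1) / eps ^+ 2).
exists N => // n /= Nn; rewrite sub0r normrN ger0_norm ?normc_ge0//.
rewrite -(@ler_pXn2r _ 2) ?nnegrE ?normc_ge0 ?(ltW e0)//.
rewrite (kernel_eval hK (Ar n) Dz).
have hm (c : C) : d <= n2 (r n - c *: K^~ z).
  by apply: dr; have := kspan_cons c Dz kspan_zero; rewrite addr0.
apply: (le_trans (near_minimal_orth ipP (Ar n) Az hm (rd n))).
rewrite mulrC ler_pdivrMr ?ltr0Sn// -ler_pdivrMl// mulrC.
apply: (@le_trans _ _ N%:R); last by rewrite ler_nat ltnW.
by rewrite ltW// archi_boundP// divr_ge0// ltW.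
Qed.

(* Fatou's lemma replaces completeness of A2: the residuals r n are Cauchy in
   norm and tend to 0 pointwise. *)
Lemma kspan_dense f eps : A2 u f -> 0 < eps -> exists2 g, kspan g & n2 (f - g) <= eps.
Proof.
move=> Af e0.
pose E : set R := [set n2 (f - g) | g in [set g | kspan g]].
have hE : has_inf E.
  split; first by exists (n2 (f - 0)); exists 0 => //; exact: kspan_zero.
  exists 0 => _ [g sg <-]; apply: ipP.2; exact: (hfB ipH Af (kspan_A2 sg)).
pose d := inf E.
have dE k : kspan k -> d <= n2 (f - k).
  by move=> sk; apply: ge_inf; [exact: hE.2|exists k].
have ex n : exists g, kspan g /\ n2 (f - g) <= d + n.+1%:R^-1.
  have n0 : 0 < (n.+1%:R^-1 : R) by rewrite invr_gt0.
  have [_ [g sg <-] /ltW h] := inf_adherent n0 hE.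
  by exists g.
have [g hg] := choice ex.
pose r n := f - g n.
have Ar n : A2 u (r n) by exact: (hfB ipH Af (kspan_A2 (hg n).1)).
have dr n k : kspan k -> d <= n2 (r n - k).
  move=> sk; rewrite /r -addrA -opprD; apply: dE.
  by rewrite -[g n]scale1r; apply: kspan_linear => //; exact: (hg n).1.
have rd n : n2 (r n) <= d + n.+1%:R^-1 by exact: (hg n).2.
have [N hN] : exists N : nat, 4 * N.+1%:R^-1 <= eps.
  exists (Num.bound (4 / eps)); rewrite ler_pdivrMr ?ltr0Sn// mulrC -ler_pdivrMr//.
  rewrite ltW//; apply: (@lt_trans _ _ (Num.bound (4 / eps))%:R); last by rewrite ltr_nat.
  by rewrite archi_boundP// divr_ge0// ltW.
exists (g N); first exact: (hg N).1.
apply: le_trans hN; rewrite -/(r N).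
have cauchy m : (N <= m)%N -> n2 (r N - r m) <= 4 * N.+1%:R^-1.
  move=> Nm; have := hf_parallelogram ipP (Ar N) (Ar m).
  (* The midpoint of r_N and r_m is again f minus an element of the span, so its squared norm is at
     least d; the parallelogram identity then bounds |r_N - r_m|^2 by 4 / (N + 1). *)
  have half : 4 * d <= n2 (r N + r m).
    have -> : r N + r m = (2%:C : C) *: (r N - (2^-1%:C : C) *: (g m - g N)).
      rewrite scalerBr scalerA -rmorphM /= mulfV// scale1r.
      have -> : (2%:C : C) = 1 + 1 by exact: rmorphD.
      by rewrite scalerDl scale1r /r; apply/funext => x; rewrite !fctE; ring.
    have Ax : A2 u (r N - (2^-1%:C : C) *: (g m - g N)).
      apply: (hfB ipH (Ar N)); apply: (hfZ ipH); exact: (hfB ipH (kspan_A2 (hg m).1) (kspan_A2 (hg N).1)).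
    rewrite (hf_sqrZ ipH _ Ax) normc_real ger0_norm// -natrX ler_pM2l//.
    apply: dr; rewrite -[_ *: _]addr0; apply: kspan_linear; last exact: kspan_zero.
    by rewrite addrC -scaleN1r; apply: kspan_linear; [exact: (hg N).1|exact: (hg m).1].
  have rN := rd N; have rm := rd m.
  have : m.+1%:R^-1 <= N.+1%:R^-1 :> R by rewrite lef_pV2 ?posrE ?ltr0Sn// ler_nat.
  move: (m.+1%:R^-1) (N.+1%:R^-1) (n2 (r N + r m)) half rN rm => a b c; lra.
(* As m grows the integrand tends pointwise to |r_N|^2 u, so Fatou's lemma transfers the Cauchy
   bound to r_N itself. *)
pose F m (p : plane R) := (normc ((r N - r (m + N)%N) (pt p)) ^+ 2 * u (pt p))%:E.
have Arm m : A2 u (r N - r (m + N)%N) by exact: (hfB ipH (Ar N) (Ar _)).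
have mF m : measurable_fun D (F m).
  by apply/measurable_EFinP; apply: measurable_mass => // z; exact: A2_econt.
have F0 m p : D p -> (0 <= F m p)%E by move=> Dp; rewrite lee_fin mass_ge0.
have := fatou area mD mF F0.
rewrite -lee_fin -(A2_massE hu (Ar N)) => fat.
apply: (le_trans _ (le_trans fat _)).
  apply: ge0_le_integral_in => p Dp; first by rewrite lee_fin mass_ge0.
  have cF : F^~ p @ \oo --> (normc (r N (pt p)) ^+ 2 * u (pt p))%:E.
    apply: cvg_EFin; first by near=> m.
    apply: cvgMl; rewrite /comp /=.
    have c1 : (fun m => normc ((r N - r (m + N)%N) (pt p))) @ \oo --> normc (r N (pt p)).
      apply/cvgrPdist_le => e ep.
      have := minimizing_eval_cvg0 (Dp : disk (pt p)) Ar dr rd.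
      move=> /cvgrPdist_le /(_ e ep) [n0 _ h]; exists n0 => // m /= nm.
      have := h (m + N)%N; rewrite /= sub0r normrN ger0_norm ?normc_ge0// => h'.
      have {h'} h' : normc (r (m + N)%N (pt p)) <= e by apply: h'; exact: leq_trans nm (leq_addr _ _).
      apply: le_trans h'.
      have -> : (r N - r (m + N)%N) (pt p) = r N (pt p) - r (m + N)%N (pt p) by [].
      rewrite ler_norml; apply/andP; split.
        rewrite lerBrDl; have := normcD (r N (pt p)) (- r (m + N)%N (pt p)).
        by rewrite normcN; lra.
      have := normcB_ge (r N (pt p)) (r (m + N)%N (pt p)); lra.
    by apply: cvgM.
  by rewrite (cvg_limn_einf_sup cF).1.
rewrite limn_einf_lim; apply: lime_le; first exact: is_cvg_einfs.
near=> n; rewrite /einfs; apply: (@le_trans _ _ (\int[area]_(p in D) F n p)%E).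
  by apply: ereal_inf_lbound; exists n => //=.
have := A2_massE hu (Arm n); rewrite /mass /intE => ->.
by rewrite lee_fin; apply: cauchy; exact: leq_addl.
Unshelve. all: by end_near. Qed.

End kernel_span.

(** * The Toeplitz form on the span of the kernels and its positivity *)

Section toeplitz_form.
Context {R : realType}.
Local Notation C := (Cplx R).
Local Notation D := (pt @^-1` (disk : set C)).
Implicit Types (z w : C) (f g : C -> C).
Variable u : C -> R.
Hypothesis hu : is_weight u.
Hypothesis huC1 : condC1 u.
Variable K : C -> C -> C.
Hypothesis hK : reproducing_kernel u K.
Variable mu : {measure set (plane R) -> \bar R}.
Hypothesis hTdef : toeplitz_defined u K mu.
Local Notation ip := (A2ip u).
Local Notation n2 f := (complex.Re (A2ip u f f)).
Local Notation T := (toeplitz K mu).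
Hypothesis hTcomp : compact_op (A2 u) ip T.

Let ipP := A2_psd hu.
Let ipH := ipP.1.
Let mD := @measurable_disk R.
Let T_lin := hTcomp.1.

Lemma Cintegrable_in (F G : C -> C) : (forall z, disk z -> F z = G z) ->
  Cintegrable mu disk F -> Cintegrable mu disk G.
Proof.
move=> FG [fr fi]; split; [apply: eq_integrable fr|apply: eq_integrable fi] => //;
  by move=> q; rewrite inE => Dq; rewrite FG.
Qed.

Lemma intC_in (F G : C -> C) : (forall z, disk z -> F z = G z) ->
  intC mu disk F = intC mu disk G.
Proof.
move=> FG; rewrite /intC /intR.
by congr (_ +i* _); apply: eq_Rintegral => q; rewrite inE => Dq /=; rewrite FG.
Qed.

(** <T f, K_z> = (T f)(z) is the defining integral, and antilinearity in g extends this to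
    combinations. The second argument is confined to the span because integrability is given only
    against kernels. *)
Lemma toeplitz_span f g : A2 u f -> kspan K g ->
  Cintegrable mu disk (fun w => f w * conjc (g w)) /\
  ip (T f) g = intC mu disk (fun w => f w * conjc (g w)).
Proof.
move=> Af; have ATf := T_lin.1 _ Af; have [int0 int00] := Cintegrable_zero mu (disk : set C).
elim=> [|a z k Dz sk [ik ek]].
  have e : (fun w => f w * conjc ((0 : C -> C) w)) = fun=> 0.
    by apply/funext => w; have -> : (0 : C -> C) w = 0 by []; rewrite conjc0 mulr0.
  rewrite e int00; split => //.
  have -> : 0 = (0 : C) *: (0 : C -> C) by rewrite scale0r.
  by rewrite (hf_antilinZ ipH) ?conjc0 ?mul0r//; exact: (hf0 ipH).
have Az := kernel_A2 hK Dz; have Ak := kspan_A2 hu hK sk.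
have Kc w : disk w -> f w * K z w = f w * conjc (K w z).
  by move=> Dw; rewrite -(kernel_sym hu hK Dz Dw).
have iz := Cintegrable_in Kc (hTdef Af Dz).
have [il el] := intC_linear mD (conjc a) iz ik.
have E w : conjc a * (f w * conjc (K w z)) + f w * conjc (k w) =
    f w * conjc ((a *: K^~ z + k) w).
  have -> : (a *: K^~ z + k) w = a * K w z + k w by [].
  by rewrite conjcD conjcM; ring.
have EF : (fun w => conjc a * (f w * conjc (K w z)) + f w * conjc (k w)) =
    (fun w => f w * conjc ((a *: K^~ z + k) w)) by exact/funext/E.
rewrite -EF; split => //.
have Aaz := hfZ ipH a Az.
rewrite el (hf_antilinD ipH ATf Aaz Ak) (hf_antilinZ ipH a ATf Az) -ek.
by rewrite -(kernel_eval hK ATf Dz) /toeplitz (intC_in Kc).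
Qed.

Lemma toeplitz_bounded : exists2 M, 0 <= M & forall f, A2 u f -> n2 (T f) <= M * n2 f.
Proof. exact: (compact_op_bounded ipP (A2_definite hu huC1) hTcomp). Qed.

Let approx f g eps : A2 u f -> A2 u g -> 0 < eps -> exists f' g',
  [/\ kspan K f', kspan K g', normc (ip (T f) g - ip (T f') g') <= eps,
   normc (ip (T g) f - ip (T g') f') <= eps & normc (ip (T f) f - ip (T f') f') <= eps].
Proof.
move=> Af Ag e0; have [M M0 hM] := toeplitz_bounded.
have [d1 d10 h1] := op_form_cont ipP T_lin M0 hM Af Ag e0.
have [d2 d20 h2] := op_form_cont ipP T_lin M0 hM Ag Af e0.
have [d3 d30 h3] := op_form_cont ipP T_lin M0 hM Af Af e0.
have d0 : 0 < Num.min d1 (Num.min d2 d3) by rewrite !lt_min d10 d20.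
have [f' sf] := kspan_dense hu hK Af d0.
have [g' sg] := kspan_dense hu hK Ag d0.
rewrite !le_min => /and3P[g1 g2 g3] /and3P[f1 f2 f3].
have Af' := kspan_A2 hu hK sf; have Ag' := kspan_A2 hu hK sg.
by exists f', g'; split => //; [exact: h1|exact: h2|exact: h3].
Qed.

Lemma normc_le_eps (x : C) : (forall eps, 0 < eps -> normc x <= eps) -> x = 0.
Proof.
move=> h; apply: eq0_normc; apply/eqP; rewrite eq_le normc_ge0 andbT.
by apply/ler_addgt0Pr => e e0; rewrite add0r; exact: h.
Qed.

(** On the span the form is the integral of f conj(g) dmu, hence Hermitian and nonnegative; density
    of the span and boundedness of T carry both properties to [A2]. *)
Lemma toeplitz_psd : psd_form (A2 u) (fun f g => ip (T f) g).
Proof.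
split; first split.
- exact: (hf0 ipH).
- by move=> a f g Af Ag; exact: (hfP ipH a Af Ag).
- move=> a f g k Af Ag Ak; rewrite (T_lin.2 a f g Af Ag).
  by apply: (hf_lin ipH) => //; exact: T_lin.1.
- move=> f g Af Ag; apply/eqP; rewrite -subr_eq0; apply/eqP; apply: normc_le_eps => e e0.
  have e2 : 0 < e / 2 by rewrite divr_gt0.
  have [f' [g' [sf sg h1 h2 _]]] := approx Af Ag e2.
  have sym : ip (T g') f' = conjc (ip (T f') g').
    have Af' := kspan_A2 hu hK sf; have Ag' := kspan_A2 hu hK sg.
    have [i1 ->] := toeplitz_span Af' sg; have [_ ->] := toeplitz_span Ag' sf.
    have [_ <-] := intC_conj mD i1; congr intC; apply/funext => w.
    by rewrite conjcM conjcK mulrC.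
  have -> : ip (T g) f - conjc (ip (T f) g) =
     (ip (T g) f - ip (T g') f') - conjc (ip (T f) g - ip (T f') g').
    by rewrite conjcB -sym; ring.
  apply: (le_trans (normcD _ _)); rewrite normcN normc_conj [leRHS]splitr.
  exact: lerD.
- move=> f Af; rewrite leNgt; apply/negP => neg.
  have e0 : 0 < - complex.Re (ip (T f) f) / 2 by rewrite divr_gt0// oppr_gt0.
  have [f' [_ [sf _ _ _ h]]] := approx Af Af e0.
  have Af' := kspan_A2 hu hK sf.
  have pos : 0 <= complex.Re (ip (T f') f').
    have [_ ->] := toeplitz_span Af' sf; rewrite /intC /= /intR.
    apply: Rintegral_ge0 => q _ /=.
    by rewrite mulc_conj /= sqr_ge0.
  have := le_trans (normc_Re _) h; rewrite Re_add Re_opp ler_norml => /andP[h1 h2].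
  lra.
Qed.

Lemma toeplitz_mass g : kspan K g ->
  intE mu disk (fun w => normc (g w) ^+ 2) = (complex.Re (ip (T g) g))%:E.
Proof.
move=> sg; have Ag := kspan_A2 hu hK sg.
have [[ir ii] ->] := toeplitz_span Ag sg.
have E w : complex.Re (g w * conjc (g w)) = normc (g w) ^+ 2 by rewrite mulc_conj.
rewrite /intC /= /intR /Rintegral fineK; last exact: integrable_fin_num.
by apply: eq_integral => q _; rewrite /= E.
Qed.

Lemma berezin2E z : disk z -> 0 < knorm u K z ->
  berezin2 u K mu z = complex.Re (ip (T (K^~ z)) (K^~ z)) / knorm u K z.
Proof.
move=> Dz k0; have sz := kspan_kernel K Dz; have Az := kernel_A2 hK Dz.
have [[ir ii] ->] := toeplitz_span Az sz.
have E w : normc (K w z / (hnorm ip (K^~ z))%:C) ^+ 2 =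
    (knorm u K z)^-1 * complex.Re (K w z * conjc (K w z)).
  rewrite mulc_conj /= normcM normcV normc_real ger0_norm ?sqrtr_ge0//.
  by rewrite exprMn exprVn sqr_sqrtr ?(ltW k0)// mulrC.
rewrite /berezin2 /intR /intC /= [RHS]mulrC -RintegralZl//.
by apply: eq_Rintegral => q _; rewrite /= E.
Qed.

Lemma berezin2_ge0 z : 0 <= berezin2 u K mu z.
Proof. by apply: Rintegral_ge0 => q _; rewrite /= sqr_ge0. Qed.

Lemma berezin2_bounded : exists2 M, 0 <= M & forall z, disk z -> 0 < knorm u K z ->
  berezin2 u K mu z <= M.
Proof.
have [M M0 hM] := toeplitz_bounded; exists (M + 1) => [|z Dz k0]; first by rewrite addr_ge0.
rewrite berezin2E// ler_pdivrMr//.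
have Az := kernel_A2 hK Dz.
have B0 := toeplitz_psd.2 _ Az; have := op_form_le ipP T_lin hM Az Az.
have := le_trans (ler_norm _) (normc_Re (ip (T (K^~ z)) (K^~ z))).
rewrite -/(knorm u K z); set x := complex.Re _ in B0 *; set y := normc _ => xy h.
have M1 : 0 <= M + 1 by rewrite addr_ge0.
rewrite -(@ler_pXn2r _ 2) ?nnegrE ?mulr_ge0 ?(ltW k0)//.
apply: (@le_trans _ _ (y ^+ 2)); first by rewrite lerXn2r ?nnegrE ?normc_ge0.
apply: (le_trans h); rewrite -mulrA -expr2 exprMn ler_wpM2r ?sqr_ge0//.
by rewrite expr2; nra.
Qed.

End toeplitz_form.

Section tonelli_on_sets.
Context d1 d2 (T1 : measurableType d1) (T2 : measurableType d2) (R : realType).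
Variables (m1 : {measure set T1 -> \bar R}) (m2 : {measure set T2 -> \bar R}).
Variables (D1 : set T1) (D2 : set T2).
Hypotheses (mD1 : measurable D1) (mD2 : measurable D2).
Hypotheses (fin1 : (m1 D1 < +oo)%E) (fin2 : (m2 D2 < +oo)%E).

(** It is applied to [mu], which is known to be finite only on the disk. Restricting both measures
    to sets of finite measure provides the sigma-finiteness in Tonelli's theorem. *)
Lemma tonelli_on (F : T1 * T2 -> \bar R) : measurable_fun (D1 `*` D2) F ->
  (forall x y, D1 x -> D2 y -> 0 <= F (x, y))%E ->
  (\int[m1]_(x in D1) \int[m2]_(y in D2) F (x, y) =
   \int[m2]_(y in D2) \int[m1]_(x in D1) F (x, y))%E.
Proof.
move=> mF F0.
pose n1 : {sigma_finite_measure set T1 -> \bar R} := mfrestr mD1 fin1.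
pose n2 : {sigma_finite_measure set T2 -> \bar R} := mfrestr mD2 fin2.
have e1 f : (\int[m1]_(x in D1) f x = \int[n1]_(x in D1) f x)%E.
  by apply: eq_measure_integral => A mA AD; rewrite /n1 /= /mfrestr /mrestr setIidl.
have e2 f : (\int[m2]_(x in D2) f x = \int[n2]_(x in D2) f x)%E.
  by apply: eq_measure_integral => A mA AD; rewrite /n2 /= /mfrestr /mrestr setIidl.
pose G := F \_ (D1 `*` D2).
have mG : measurable_fun setT G.
  by apply/(measurable_restrictT _ (measurableX mD1 mD2)).
have G0 x : (0 <= G x)%E.
  by rewrite /G /patch; case: ifPn => //; case: x => x y; rewrite inE => -[]; exact: F0.
have tG := @fubini_tonelli _ _ _ _ _ n1 n2 G mG G0.
rewrite e1 e2 integral_mkcond [RHS]integral_mkcond.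
have -> : ((fun x => \int[m2]_(y in D2) F (x, y)) \_ D1 = fun x => \int[n2]_y G (x, y))%E.
  apply/funext => x; rewrite /patch; case: ifPn => Dx.
    rewrite e2 integral_mkcond; apply: eq_integral => y _.
    by rewrite /G /patch in_setX Dx.
  by rewrite integral0_eq// => y _; rewrite /G /patch in_setX (negbTE Dx).
have -> : ((fun y => \int[m1]_(x in D1) F (x, y)) \_ D2 = fun y => \int[n1]_x G (x, y))%E.
  apply/funext => y; rewrite /patch; case: ifPn => Dy.
    rewrite e1 integral_mkcond; apply: eq_integral => x _.
    by rewrite /G /patch in_setX Dy andbT.
  by rewrite integral0_eq// => x _; rewrite /G /patch in_setX (negbTE Dy) andbF.
exact: tG.
Qed.

End tonelli_on_sets.

(** * Bounding the Toeplitz form by the 2-Berezin transform *)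

Section carleson_estimate.
Context {R : realType}.
Local Notation C := (Cplx R).
Local Notation D := (pt @^-1` (disk : set C)).
Implicit Types (z w : C) (f g : C -> C).
Variable u : C -> R.
Hypothesis hu : is_weight u.
Hypothesis huC1 : condC1 u.
Variable K : C -> C -> C.
Hypothesis hK : reproducing_kernel u K.
Variable mu : {measure set (plane R) -> \bar R}.
Hypothesis hmu : (mu D < +oo)%E.
Hypothesis hTdef : toeplitz_defined u K mu.
Local Notation ip := (A2ip u).
Local Notation n2 f := (complex.Re (A2ip u f f)).
Local Notation T := (toeplitz K mu).
Local Notation V := (local_mass u).
Local Notation beta := (berezin2 u K mu).
Hypothesis hTcomp : compact_op (A2 u) ip T.
Variable p : R.
Hypotheses (hp : 1 < p) (huB : Bp p u).

Let ipP := A2_psd hu.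
Let ipH := ipP.1.
Let mD := @measurable_disk R.
Let T_lin := hTcomp.1.
Let u0 z : disk z -> 0 < u z. Proof. by case: hu => h _ _ /h. Qed.
Let mu_u : measurable_fun D (u \o pt). Proof. by case: hu. Qed.
Let k0 z : disk z -> 0 < knorm u K z.
Proof. by move=> Dz; exact: (knorm_gt0 hu huC1 hK hp huB). Qed.

(** z -> K_z is continuous in norm, so the function is continuous. It serves for S = T and for S the
    identity, whose quotient is the 2-Berezin transform. *)
Lemma measurable_kernel_form (S : (C -> C) -> C -> C) (M : R) : linear_op (A2 u) S -> 0 <= M ->
  (forall f, A2 u f -> n2 (S f) <= M * n2 f) ->
  measurable_fun D (fun q => complex.Re (ip (S (K^~ (pt q))) (K^~ (pt q)))).
Proof.
move=> Sl M0 hM.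
apply: (@measurable_cplx_disk _ (fun z => complex.Re (ip (S (K^~ z)) (K^~ z)))) => z Dz eps e0.
have Az := kernel_A2 hK Dz; have e2 : 0 < eps / 2 by rewrite divr_gt0.
have [d d0 hd] := op_form_cont ipP Sl M0 hM Az Az e2.
have [r r0 hr] := kernel_norm_cont hu huC1 hK Dz d0.
exists r => // w wz; have [Dw nd] := hr w wz; have Aw := kernel_A2 hK Dw.
have nd' : n2 (K^~ z - K^~ w) <= d.
  have -> : K^~ z - K^~ w = (-1 : C) *: (K^~ w - K^~ z) by rewrite scaleN1r opprB.
  by rewrite (hf_sqrZ ipH _ (hfB ipH Aw Az)) normcN normc1 expr1n mul1r ltW.
have := le_trans (normc_Re _) (hd _ _ Aw Aw nd' nd').
by rewrite Re_add Re_opp distrC; lra.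
Qed.

Lemma measurable_berezin2 : measurable_fun D (beta \o pt).
Proof.
have [M M0 hM] := toeplitz_bounded hu huC1 hTcomp.
have mB := measurable_kernel_form T_lin M0 hM.
have idl : linear_op (A2 u) id by [].
have id1 f : A2 u f -> n2 (id f) <= 1 * n2 f by rewrite mul1r.
have mk := measurable_kernel_form idl ler01 id1.
apply: (@eq_measurable_fun _ _ _ _ _ (fun q => complex.Re (ip (T (K^~ (pt q))) (K^~ (pt q))) *
    (n2 (K^~ (pt q)) `^ (-1)))).
  move=> q; rewrite inE => Dq; have kq := k0 Dq.
  rewrite /= powR_inv1 ?(ltW kq)// (berezin2E hu hK hTdef hTcomp Dq)//.
apply: measurable_funM => //.
exact: (measurableT_comp (@measurable_powR R (-1)) mk).
Qed.

(** beta(q) K(q, q) is the integral of |K(., q)|^2 dmu, and near q the integrand is at least a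
    multiple of K(q, q) / V(q). *)
Lemma berezin2_local : exists d c : R, [/\ 0 < d, d <= 1 / 32, 0 < c &
  forall q, disk q -> (mu (pt @^-1` eball q (d * bdist q)) <= (c * (beta q * V q))%:E)%E].
Proof.
have [d [c [d0 d32 c0 h]]] := kernel_near_diag hu huC1 hK hp huB.
exists d, c^-1; split => //; first by rewrite invr_gt0.
move=> q Dq; have V0 := local_mass_gt0 hu Dq; have kq := k0 Dq.
have sub : eball q (d * bdist q) `<=` disk.
  move=> w wq; have d1 : 0 < 4 * d <= 1.
    by apply/andP; split; lra.
  apply: (@eball_disk R q _ d1) => //; move: wq; rewrite /eball /=.
  by have -> : 4 * d * bdist q / 4 = d * bdist q by field.
have mB := @measurable_eball R q (d * bdist q).
have mass := toeplitz_mass hu hK hTdef hTcomp (kspan_kernel K Dq).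
have bE : complex.Re (ip (T (K^~ q)) (K^~ q)) = beta q * knorm u K q.
  by rewrite (berezin2E hu hK hTdef hTcomp Dq)// mulfVK// gt_eqF.
have pos : 0 < c / V q * knorm u K q by rewrite mulr_gt0// divr_gt0.
have -> : c^-1 * (beta q * V q) = (c / V q * knorm u K q)^-1 * (beta q * knorm u K q).
  have [cn [Vn kn]] : c != 0 /\ (V q != 0 /\ knorm u K q != 0) by rewrite !gt_eqF.
  by move: (V q) (knorm u K q) (beta q) Vn kn => a b x an bn; field; rewrite cn an bn.
rewrite EFinM lee_pdivlMl// -bE -mass /intE.
rewrite -(integral_cst mu mB); apply: ge0_le_integral_patch => [w _|w _|w].
- by rewrite lee_fin ltW.
- by rewrite lee_fin sqr_ge0.
rewrite /patch; case: ifPn => [|_]; last by case: ifPn => // _; rewrite lee_fin sqr_ge0.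
rewrite inE => wB; rewrite mem_set; last exact: sub.
by rewrite lee_fin; apply: h => //; exact: ltW.
Qed.

Lemma area_disk_fin : (area D < +oo)%E.
Proof.
apply: (@le_lt_trans _ _ (area (pt @^-1` eball (0 : C) 1))).
  apply: le_measure; rewrite ?inE; [exact: mD|exact: measurable_eball|].
  by move=> q; rewrite /disk /eball /= !subr0.
by apply: le_lt_trans (area_eball_le _ ltr01) _; rewrite ltry.
Qed.

Lemma measurable_bdist : measurable_fun setT (fun q : plane R => bdist (pt q)).
Proof.
have e q : bdist (pt q) = 1 - (q.1 * q.1 + q.2 * q.2) by rewrite /bdist normc_sqr /= !expr2.
have -> : (fun q : plane R => bdist (pt q)) = (fun q : plane R => 1 - (q.1 * q.1 + q.2 * q.2)).
  exact/funext/e.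
have m1 : measurable_fun setT (fun q : plane R => q.1) by exact: measurable_fst.
have m2 : measurable_fun setT (fun q : plane R => q.2) by exact: measurable_snd.
apply: measurable_funB; first exact: measurable_cst.
by apply: measurable_funD; apply: measurable_funM.
Qed.

Lemma measurable_near (d : R) :
  measurable [set x : plane R * plane R | normc (pt x.2 - pt x.1) < d * bdist (pt x.2)].
Proof.
pose rho (x : plane R * plane R) := d * bdist (pt x.2) - normc (pt x.2 - pt x.1).
have m1 : measurable_fun setT (fun x : plane R * plane R => d * bdist (pt x.2)).
  apply: measurable_funM => //.
  exact: (measurableT_comp measurable_bdist measurable_snd).
have m2 : measurable_fun setT (fun x : plane R * plane R => normc (pt x.2 - pt x.1)).
  have e x : normc (pt x.2 - pt x.1) =
     Num.sqrt ((x.2.1 - x.1.1) * (x.2.1 - x.1.1) + (x.2.2 - x.1.2) * (x.2.2 - x.1.2)).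
    by rewrite -!expr2.
  have -> : (fun x : plane R * plane R => normc (pt x.2 - pt x.1)) = (fun x =>
      Num.sqrt ((x.2.1 - x.1.1) * (x.2.1 - x.1.1) + (x.2.2 - x.1.2) * (x.2.2 - x.1.2))).
    exact/funext/e.
  have cs : measurable_fun setT (@Num.sqrt R).
    by apply: continuous_measurable_fun; exact: sqrt_continuous.
  apply: (measurableT_comp cs).
  have mc (i j : plane R * plane R -> R) : measurable_fun setT i -> measurable_fun setT j ->
      measurable_fun setT (fun x => (i x - j x) * (i x - j x)).
    by move=> mi mj; apply: measurable_funM; apply: measurable_funB.
  apply: measurable_funD; apply: mc.
  - exact: (measurableT_comp measurable_fst measurable_snd).
  - exact: (measurableT_comp measurable_fst measurable_fst).
  - exact: (measurableT_comp measurable_snd measurable_snd).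
  - exact: (measurableT_comp measurable_snd measurable_fst).
have := measurable_funB m1 m2 measurableT (measurable_itv `]0, +oo[).
rewrite setTI; congr measurable; apply/seteqP; split=> x /=;
  by rewrite in_itv /= andbT subr_gt0.
Qed.

(** |g(w)|^2 is replaced by a local average and the integrals are exchanged, so that mu enters only
    through the measure of small disks around q, which [berezin2_local] bounds by a multiple of
    beta(q) V(q). *)
Lemma span_form_le : exists2 c, 0 < c & forall g, kspan K g ->
  ((complex.Re (ip (T g) g))%:E <=
   c%:E * intE area disk (fun z => (beta z * (normc (g z) ^+ 2 * u z))%R))%E.
Proof.
have [d [c [d0 d32 c0 hb]]] := berezin2_local.
(* Half of d, because after the exchange the disk is centred at q: |q - w| < d/2 bdist(w) implies |q
   - w| < d bdist(q), as bdist(w) <= 2 bdist(q). *)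
have d8 : 0 < d / 2 <= 1 / 8 by apply/andP; split; lra.
have [c1 c10 h1] := A2_pointwise_local hu huC1 d8.
have [A A1 hA] := local_mass_comparable hu huC1.
have A0 : 0 < A by exact: lt_le_trans A1.
exists (c1 * A * c) => [|g sg]; first by rewrite !mulr_gt0.
have Ag := kspan_A2 hu hK sg.
have gc z : disk z -> econt g z by move=> Dz; exact: (A2_econt Ag Dz).
have [_ _ mg] := measurable_econt gc.
(* On the disk this is c1 A |g|^2 u / V, where the weight has cancelled because u / V =
   bdist^(-2). *)
pose phi (q : plane R) := c1 * A * (normc (g (pt q)) ^+ 2 * (bdist (pt q) ^+ 2) `^ (-1)).
have phiE q : D q -> phi q = c1 * (A / V (pt q)) * (normc (g (pt q)) ^+ 2 * u (pt q)).
  move=> Dq; rewrite /phi powR_inv1 ?sqr_ge0// /local_mass.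
  have un : u (pt q) != 0 by rewrite gt_eqF// u0.
  have bn : bdist (pt q) != 0 by rewrite gt_eqF// bdist_gt0.
  by move: (u _) (bdist _) (normc _) un bn => a b n an bn; field; rewrite an bn.
have phi0 q : D q -> 0 <= phi q.
  move=> Dq; apply: mulr_ge0; first by rewrite mulr_ge0// ltW.
  by rewrite mulr_ge0 ?sqr_ge0 ?powR_ge0.
have mphi : measurable_fun D phi.
  apply: measurable_funM => //; apply: measurable_funM => //.
  apply: (measurableT_comp (@measurable_powR R (-1))); apply: measurable_funX.
  exact: measurable_funTS measurable_bdist.
pose S := [set x : plane R * plane R | normc (pt x.2 - pt x.1) < d * bdist (pt x.2)].
pose F x := (phi x.2 * \1_S x)%:E.
have mF : measurable_fun (D `*` D) F.
  apply/measurable_EFinP; apply: measurable_funM.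
    apply: (measurable_comp mD _ mphi); last exact: measurable_funTS measurable_snd.
    by move=> _ [x [_ Dx] <-].
  by apply: measurable_funTS; apply: measurable_indic; exact: measurable_near.
have F0 x y : D x -> D y -> (0 <= F (x, y))%E.
  by move=> _ Dy; rewrite lee_fin mulr_ge0// phi0.
rewrite -(toeplitz_mass hu hK hTdef hTcomp sg).
apply: (@le_trans _ _ (\int[mu]_(w in D) \int[area]_(q in D) F (w, q))%E).
  apply: ge0_le_integral_in => w Dw; first by rewrite lee_fin sqr_ge0.
  have b0 := bdist_gt0 (Dw : disk (pt w)); have Vw := local_mass_gt0 hu (Dw : disk (pt w)).
  apply: (le_trans (h1 g (pt w) Ag Dw)).
  have near q : eball (pt w) (d / 2 * bdist (pt w)) (pt q) ->
      [/\ disk (pt q), V (pt q) <= A * V (pt w) & normc (pt q - pt w) < d * bdist (pt q)].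
    rewrite /eball /= => hq.
    have q4 : normc (pt q - pt w) <= 1 * bdist (pt w) / 4.
      apply: (le_trans (ltW hq)); rewrite mul1r mulrC.
      by rewrite ler_pM2l//; lra.
    have h01 : 0 <= (1 : R) <= 1 by rewrite ler01 lexx.
    have [Dq _ bq _] := bdist_lip h01 Dw q4; split => //.
      by rewrite mul1r in q4; have [] := hA (pt w) (pt q) Dw q4.
    apply: (lt_le_trans hq); have -> : d * bdist (pt q) = d / 2 * (2 * bdist (pt q)) by field.
    by rewrite ler_pM2l// divr_gt0.
  have mB := @measurable_eball R (pt w) (d / 2 * bdist (pt w)).
  have sub : pt @^-1` eball (pt w) (d / 2 * bdist (pt w)) `<=` D by move=> q /near[].
  have m0 q : D q -> 0 <= normc (g (pt q)) ^+ 2 * u (pt q).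
    by move=> Dq; rewrite mulr_ge0 ?sqr_ge0// ltW// u0.
  rewrite /mass /intE -ge0_integralZl//; first last.
  - by rewrite lee_fin divr_ge0// ltW.
  - by move=> q /sub Dq; rewrite lee_fin m0.
  - apply/measurable_EFinP; apply: (measurable_funS mD sub).
    by apply: measurable_funM.
  apply: ge0_le_integral_patch => [q /sub Dq|q Dq|q].
  - by rewrite mule_ge0// lee_fin ?m0// divr_ge0// ltW.
  - exact: F0.
  rewrite /patch; case: ifPn => [|_]; last first.
    by case: ifPn => //; rewrite inE => Dq; exact: F0.
  rewrite inE => qB; have [Dq Vq nq] := near q qB.
  rewrite (mem_set (Dq : D q)) -EFinM lee_fin phiE// indicE mem_set// mulr1.
  have Vq0 := local_mass_gt0 hu Dq.
  rewrite ler_wpM2r ?m0// ler_pM2l//.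
  by rewrite ler_pdivlMr// mulrC ler_pdivrMr.
rewrite (tonelli_on mD mD hmu area_disk_fin mF F0).
have i0 q : D q -> 0 <= beta (pt q) * (normc (g (pt q)) ^+ 2 * u (pt q)).
  by move=> Dq; rewrite mulr_ge0 ?berezin2_ge0// mulr_ge0 ?sqr_ge0// ltW// u0.
have mi : measurable_fun D (fun q => (beta (pt q) * (normc (g (pt q)) ^+ 2 * u (pt q)))%:E).
  apply/measurable_EFinP; apply: measurable_funM; first exact: measurable_berezin2.
  by apply: measurable_funM.
have i0E q : D q -> (0 <= (beta (pt q) * (normc (g (pt q)) ^+ 2 * u (pt q)))%:E)%E.
  by move=> Dq; rewrite lee_fin i0.
have cE : (0 <= (c1 * A * c)%:E)%E by rewrite lee_fin ltW// !mulr_gt0.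
rewrite /intE -(ge0_integralZl _ mD mi i0E cE).
apply: ge0_le_integral_in => q Dq.
  by apply: integral_ge0 => w Dw; exact: F0.
apply: (@le_trans _ _ (\int[mu]_(w in pt @^-1` eball (pt q) (d * bdist (pt q))) cst (phi q)%:E w)%E).
  apply: ge0_le_integral_patch => [w Dw|w _|w]; [exact: F0|by rewrite lee_fin phi0|].
  rewrite /patch; case: ifPn => [|_]; last by case: ifPn => // _; rewrite lee_fin phi0.
  move=> _; rewrite /F /= indicE; case: ifPn => [_|].
    by rewrite lee_fin ler_piMr ?phi0// lern1 leq_b1.
  rewrite notin_setE => nw; rewrite memNset ?mulr0// => h; apply: nw.
  by change (normc (pt w - pt q) < d * bdist (pt q)); rewrite normc_distC; exact: h.
rewrite integral_cst; last exact: measurable_eball.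
have p0 : (0 <= (phi q)%:E)%E by rewrite lee_fin phi0.
apply: (le_trans (lee_wpmul2l p0 (hb _ Dq))).
rewrite -!EFinM lee_fin phiE// le_eqVlt; apply/orP; left; apply/eqP.
have Vn : V (pt q) != 0 by rewrite gt_eqF// (local_mass_gt0 hu Dq).
by move: (V _) (beta _) (u _) (normc _) Vn => v b a n vn; field.
Qed.

(** Since beta is at most M, the integral for the approximant g is controlled through |g|^2 <= 2 |f
    - g|^2 + 2 |f|^2, which costs the factor 2 in the constant. *)
Lemma toeplitz_form_le : exists2 c, 0 < c & forall f, A2 u f ->
  ((complex.Re (ip (T f) f))%:E <=
   c%:E * intE area disk (fun z => (beta z * (normc (f z) ^+ 2 * u z))%R))%E.
Proof.
have [c c0 hc] := span_form_le; exists (c * 2) => [|f Af]; first exact: mulr_gt0.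
have [M M0 hM] := berezin2_bounded hu huC1 hK hTdef hTcomp.
have [B B0 hB] := toeplitz_bounded hu huC1 hTcomp.
pose J g := intE area disk (fun z => (beta z * (normc (g z) ^+ 2 * u z))%R).
have mj g : A2 u g -> measurable_fun D (fun q => (normc (g (pt q)) ^+ 2 * u (pt q))%:E).
  move=> Ag; apply/measurable_EFinP; apply: measurable_mass => // z Dz; exact: (A2_econt Ag Dz).
have j0 g q : D q -> 0 <= normc (g (pt q)) ^+ 2 * u (pt q).
  by move=> Dq; rewrite mulr_ge0 ?sqr_ge0// ltW// u0.
have mJ g : A2 u g -> measurable_fun D (fun q => (beta (pt q) * (normc (g (pt q)) ^+ 2 * u (pt q)))%:E).
  move=> Ag; apply/measurable_EFinP; apply: measurable_funM; first exact: measurable_berezin2.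
  by apply/measurable_EFinP; exact: mj.
have J0 g q : D q -> (0 <= (beta (pt q) * (normc (g (pt q)) ^+ 2 * u (pt q)))%:E)%E.
  by move=> Dq; rewrite lee_fin mulr_ge0 ?j0// berezin2_ge0.
have ME (k : R) g : 0 <= k -> A2 u g ->
    (\int[area]_(q in D) (k * (normc (g (pt q)) ^+ 2 * u (pt q)))%:E)%E = (k * n2 g)%:E.
  move=> kp Ag; under eq_integral do rewrite EFinM.
  rewrite ge0_integralZl//; [|exact: mj|by move=> q Dq; rewrite lee_fin j0].
  by have := A2_massE hu Ag; rewrite /mass /intE => ->.
have Jfin : (J f <= (M * n2 f)%:E)%E.
  rewrite -ME//; apply: ge0_le_integral_in => q Dq; first exact: J0.
  by rewrite lee_fin ler_wpM2r ?j0// hM// k0.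
have Jf0 : (0 <= J f)%E by apply: integral_ge0 => q Dq; exact: J0.
have JE : J f = (fine (J f))%:E.
  by rewrite fineK// ge0_fin_numE//; apply: le_lt_trans Jfin _; rewrite ltry.
rewrite -/(J f) JE -EFinM lee_fin.
have c1 : 0 < 2 * c * M + 1 by rewrite ltr_wpDl// !mulr_ge0// ltW.
apply/ler_addgt0Pr => eps e0.
(* The total error, 2 c M eta from the integral and eta from the form, equals eps. *)
pose eta := eps / (2 * c * M + 1); have eta0 : 0 < eta by rewrite divr_gt0.
have [d d0 hd] := op_form_cont ipP T_lin B0 hB Af Af eta0.
have m0 : 0 < Num.min d eta by rewrite lt_min d0.
have [g sg] := kspan_dense hu hK Af m0; rewrite le_min => /andP[gd ge].
have Ag := kspan_A2 hu hK sg; have Afg := hfB ipH Af Ag.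
have close : complex.Re (ip (T f) f) <= complex.Re (ip (T g) g) + eta.
  have := le_trans (normc_Re _) (hd _ _ Ag Ag gd gd).
  by rewrite Re_add Re_opp ler_norml => /andP[_]; lra.
have Jg : (J g <= (2 * fine (J f) + 2 * M * n2 (f - g))%:E)%E.
  rewrite EFinD EFinM -JE -ME ?mulr_ge0//.
  rewrite /J /intE -ge0_integralZl ?lee_fin//; [|exact: mJ|exact: J0].
  rewrite -ge0_integralD//; first last.
  - by under eq_fun do rewrite EFinM; apply: measurable_funeM; exact: mj.
  - by move=> q Dq; rewrite lee_fin mulr_ge0 ?j0// mulr_ge0.
  - by apply: measurable_funeM; exact: mJ.
  - by move=> q Dq; rewrite mule_ge0 ?lee_fin//; have := J0 f q Dq; rewrite lee_fin.
  apply: ge0_le_integral_in => q Dq; first exact: J0.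
  rewrite -EFinM -EFinD lee_fin.
  have := @mass_parallelogram _ u hu (-1) (f - g) f (pt q) Dq.
  have -> : -1 * (f - g) (pt q) + f (pt q) = g (pt q).
    by have -> : (f - g) (pt q) = f (pt q) - g (pt q) by []; ring.
  rewrite normcN normc1 expr1n mulr1.
  have b0 := berezin2_ge0 u K mu (pt q); have bM := hM (pt q) Dq (k0 Dq).
  have := j0 (f - g) q Dq; move: (normc (g _) ^+ 2 * _) (normc (f _) ^+ 2 * _).
  move: (normc _ ^+ 2 * _) (beta (pt q)) b0 bM => x b b0 bM y z x0 h.
  have : b * x <= M * x by rewrite ler_wpM2r.
  have : b * y <= b * (2 * x + 2 * z) by rewrite ler_wpM2l.
  rewrite mulrDr; lra.
have := hc g sg; rewrite -/(J g) => h1.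
have cE : (0 <= c%:E)%E by rewrite lee_fin ltW.
have := le_trans h1 (lee_wpmul2l cE Jg); rewrite -EFinM lee_fin => h2.
have e3 : eta * (2 * c * M + 1) = eps by rewrite /eta mulfVK// gt_eqF.
have : c * M * n2 (f - g) <= c * M * eta by rewrite ler_wpM2l// mulr_ge0// ltW.
move: h2 close e3; move: (fine (J f)) (n2 (f - g)) (complex.Re _) (complex.Re _) => j n a b; lra.
Qed.

End carleson_estimate.

(** * Schatten classes *)

Section hyperbolic_geometry.
Context {R : realType}.
Local Notation C := (Cplx R).
Local Notation D := (pt @^-1` (disk : set C)).
Implicit Types (z w : C).

Let mD := @measurable_disk R.

(** The pseudohyperbolic disk contains the Euclidean disk of radius r bdist(z) / 4 and lies in that
    of radius 3 bdist(z) / (1 - r^2), and on its points u is comparable to u(z). *)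
Lemma pseudohyp_mass (u : C -> R) (r : R) : is_weight u -> condC1 u -> 0 < r -> r < 1 ->
  exists c C', [/\ 0 < c, 0 < C' & forall z, disk z ->
    c * local_mass u z <= intR area (pseudohyp_disk z r) u <= C' * local_mass u z].
Proof.
move=> hu huC1 r0 r1.
have u0 z : disk z -> 0 < u z by case: hu => h _ _ /h.
have [A A1 hA] := weight_comparable hu huC1.
have A0 : 0 < A by exact: lt_le_trans A1.
have [L L0 hL] := log_weight_lip huC1.
have P0 : 0 < (pi : R)^-1 by rewrite invr_gt0 pi_gt0.
have [s s0 sE] : exists2 s, 0 < s & s = 1 - r ^+ 2.
  by eexists; last reflexivity; rewrite subr_gt0 expr_lt1// ltW.
(* From z to a point of the disk the segment has bdist >= s / 4 bdist(z) and length at most 2 / s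
   bdist(z). *)
pose kap := expR (L / (s / 4) * (2 / s)).
have kap0 : 0 < kap by exact: expR_gt0.
pose c : R := pi^-1 * (r / 4) ^+ 2 / A.
pose C' : R := kap * (pi^-1 * (4 * (3 / s) ^+ 2)).
have c0 : 0 < c by apply: divr_gt0 => //; apply: mulr_gt0 => //; apply: exprn_gt0; exact: divr_gt0.
have C0 : 0 < C'.
  apply: mulr_gt0 => //; apply: mulr_gt0 => //; apply: mulr_gt0 => //; apply: exprn_gt0; exact: divr_gt0.
exists c, C'; split => // z Dz.
have b0 := bdist_gt0 Dz; have uz := u0 z Dz; have V0 := local_mass_gt0 hu Dz.
have sub w : pseudohyp_disk z r w -> disk w by case.
have rb : 0 < r * bdist z / 4 by rewrite divr_gt0// mulr_gt0.
have lo : ((c * local_mass u z)%:E <= intE area (pseudohyp_disk z r) u)%E.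
  apply: (@le_trans _ _ (\int[area]_(q in pt @^-1` eball z (r * bdist z / 4)) (cst (u z / A)%:E) q)%E).
    rewrite integral_cst; last exact: measurable_eball.
    have p0 : (0 <= (u z / A)%:E)%E by rewrite lee_fin divr_ge0// ltW.
    apply: le_trans _ (lee_wpmul2l p0 (area_eball_ge z rb)).
    rewrite -EFinM lee_fin /c /local_mass le_eqVlt; apply/orP; left; apply/eqP.
    have An : A != 0 by rewrite gt_eqF.
    by move: (pi^-1) (u z) (bdist z) => P v b; field.
  apply: ge0_le_integral_patch => [q _|q Dq|q]; [by rewrite lee_fin divr_ge0// ltW|by rewrite lee_fin ltW//; exact: (u0 _ (sub _ Dq))|].
  rewrite /patch; case: ifPn => [|_]; last first.
    by case: ifPn => //; rewrite inE => /sub Dq; rewrite lee_fin ltW//; exact: u0.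
  rewrite inE => qB; have Pq : pseudohyp_disk z r (pt q) by exact: pseudohyp_ball.
  rewrite (mem_set (Pq : (pt @^-1` pseudohyp_disk z r) q)) lee_fin ler_pdivrMr// mulrC.
  have q4 : normc (pt q - z) <= bdist z / 4.
    move/ltW: qB => /le_trans; apply; rewrite ler_pM2r//; nra.
  by have [] := hA z (pt q) Dz q4.
have hi : (intE area (pseudohyp_disk z r) u <= (C' * local_mass u z)%:E)%E.
  have rr : 0 < 3 / s * bdist z by rewrite mulr_gt0// divr_gt0.
  apply: (@le_trans _ _ (\int[area]_(q in pt @^-1` eball z (3 / s * bdist z)) (cst (kap * u z)%:E) q)%E).
    have k0 : (0 <= (kap * u z)%:E)%E by rewrite lee_fin mulr_ge0// ltW.
    apply: ge0_le_integral_patch => [q Dq|q _|q]; [by rewrite lee_fin ltW//; exact: (u0 _ (sub _ Dq))|exact: k0|].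
    rewrite /patch; case: ifPn => [|_]; last by case: ifPn.
    rewrite inE => Pq; have Dq := sub _ Pq.
    have [_ b1 _ dq] := pseudohyp_bounds r0 r1 Dz Pq.
    rewrite -sE in b1 dq.
    have qB : eball z (3 / s * bdist z) (pt q).
      apply: (le_lt_trans dq); rewrite ltr_pM2r// ltr_pM2r ?invr_gt0//; lra.
    rewrite (mem_set (qB : (pt @^-1` eball z (3 / s * bdist z)) q)) lee_fin.
    apply: expR_ln_ratio => //; first exact: u0.
    have m0 : 0 < s / 4 * bdist z by rewrite mulr_gt0// divr_gt0.
    have mz : s / 4 * bdist z <= bdist z.
      by rewrite ler_piMl ?(ltW b0)//; have := sqr_ge0 r; lra.
    apply: (le_trans (hL z (pt q) _ m0 mz b1)).
    have mi : 0 <= L / (s / 4 * bdist z) by rewrite divr_ge0// ltW.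
    apply: (le_trans (ler_wpM2l mi dq)).
    rewrite le_eqVlt; apply/orP; left; apply/eqP.
    have [sn bn] : s != 0 /\ bdist z != 0 by rewrite !gt_eqF.
    by move: (bdist z) bn => b bn; field; rewrite sn bn.
  rewrite integral_cst; last exact: measurable_eball.
  have k0 : (0 <= (kap * u z)%:E)%E by rewrite lee_fin mulr_ge0// ltW.
  apply: (le_trans (lee_wpmul2l k0 (area_eball_le z rr))).
  rewrite -EFinM lee_fin /C' /local_mass le_eqVlt; apply/orP; left; apply/eqP.
  by move: (pi^-1) (3 / s) (u z) (bdist z) => P t v b; ring.
have fin : intR area (pseudohyp_disk z r) u = fine (intE area (pseudohyp_disk z r) u) by [].
have I0 : (0 <= intE area (pseudohyp_disk z r) u)%E.
  by apply: le_trans lo; rewrite lee_fin mulr_ge0// ltW.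
have If : intE area (pseudohyp_disk z r) u \is a fin_num.
  by rewrite ge0_fin_numE//; apply: le_lt_trans hi _; rewrite ltry.
by rewrite -!lee_fin fin fineK// lo hi.
Qed.

(* Disjoint disks of comparable hyperbolic size accumulate at the point 1. *)
Lemma hyperbolic_area_infinite :
  intE area disk (fun z : C => (bdist z ^+ 2)^-1) = +oo%E.
Proof.
pose dl k : R := (1 / 4) ^+ k.+1.
have dl0 k : 0 < dl k by rewrite exprn_gt0// divr_gt0.
have dl1 k : dl k <= 1 / 4.
  by rewrite /dl exprS ler_piMr ?divr_ge0// exprn_ile1// ?divr_ge0//; lra.
pose ce k : C := (1 - dl k)%:C.
have bE k : bdist (ce k) = dl k * (2 - dl k).
  rewrite /bdist /ce normc_real ger0_norm; last by have := dl1 k; lra.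
  by ring.
have bb k : dl k <= bdist (ce k) <= 2 * dl k.
  by rewrite bE; have := dl0 k; have := dl1 k; move: (dl k) => x x1 x0; apply/andP; split; nra.
have Dk k : disk (ce k).
  by apply: disk_bdist; have /andP[h _] := bb k; apply: lt_le_trans h.
pose B k := pt @^-1` eball (ce k) (bdist (ce k) / 8).
have mB k : measurable (B k) by exact: measurable_eball.
have near k q : B k q -> disk (pt q) /\ bdist (pt q) <= 2 * bdist (ce k).
  move=> /ltW hq; have b0 := bdist_gt0 (Dk k).
  have h01 : 0 <= (1 : R) <= 1 by rewrite ler01 lexx.
  have q4 : normc (pt q - ce k) <= 1 * bdist (ce k) / 4 by apply: (le_trans hq); lra.
  by have [] := bdist_lip h01 (Dk k) q4.
have P0 : 0 < (pi : R)^-1 by rewrite invr_gt0 pi_gt0.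
(* With b the value of [bdist] at the centre, the ball has normalized area at least (b / 8)^2 / pi
   and the integrand is at least 1 / (2 b)^2; 64 4 = 256. *)
have a0 k : ((pi^-1 / 256)%:E <= \int[area]_(q in B k) ((bdist (pt q) ^+ 2)^-1)%:E)%E.
  have b0 := bdist_gt0 (Dk k); have b8 : 0 < bdist (ce k) / 8 by rewrite divr_gt0.
  apply: (@le_trans _ _ (\int[area]_(q in B k) (cst ((2 * bdist (ce k)) ^+ 2)^-1%:E) q)%E).
    rewrite integral_cst//.
    have p0 : (0 <= (((2 * bdist (ce k)) ^+ 2)^-1)%:E)%E by rewrite lee_fin invr_ge0 sqr_ge0.
    apply: le_trans _ (lee_wpmul2l p0 (area_eball_ge (ce k) b8)).
    rewrite -EFinM lee_fin le_eqVlt; apply/orP; left; apply/eqP.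
    have bn : bdist (ce k) != 0 by rewrite gt_eqF.
    by move: (pi^-1) (bdist _) bn => P b bn; field.
  apply: ge0_le_integral_in => q qB; first by rewrite lee_fin invr_ge0 sqr_ge0.
  have [Dq bq] := near k q qB; have q0 := bdist_gt0 Dq.
  rewrite lee_fin lef_pV2 ?posrE ?exprn_gt0// ?mulr_gt0//.
  by rewrite lerXn2r ?nnegrE ?mulr_ge0 ?(ltW q0) ?(ltW b0).
(* Real parts separate the balls: dl drops by a factor 4 at each step, and 5/4 1/4 < 3/4. *)
have re k q : B k q -> 3 / 4 * dl k < 1 - q.1 /\ 1 - q.1 < 5 / 4 * dl k.
  move=> hq; have := le_lt_trans (normc_Re (pt q - ce k)) hq.
  rewrite /= ltr_norml => /andP[]; have /andP[] := bb k; have := dl0 k.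
  by move: (bdist _) (dl k) => b x; lra.
have triv n : trivIset [set` index_iota 0 n] B.
  apply/trivIsetP => i j _ _; wlog ij : i j / (i < j)%N.
    move=> wl ij; have := ij; rewrite neq_ltn => /orP[h|h]; first exact: wl.
    by rewrite setIC; apply: wl => //; rewrite eq_sym.
  move=> _; apply/seteqP; split=> // q [/re[h1 _] /re[_ h2]].
  have : dl j <= 1 / 4 * dl i.
    rewrite /dl -exprS; apply: ler_wiXn2l; [by rewrite divr_ge0|lra|by rewrite ltnS].
  by have := dl0 i; move: (dl i) (dl j) h1 h2 => x y; lra.
have sum n : ((n%:R * (pi^-1 / 256))%:E <= intE area disk (fun z : C => ((bdist z ^+ 2)^-1)%R))%E.
  pose U := \big[setU/set0]_(i <- index_iota 0 n) B i.
  have sU : U `<=` D by rewrite /U -bigcup_seq => q [k _ /near[]].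
  have mb : measurable_fun D (fun q => (bdist (pt q) ^+ 2)^-1).
    apply: (@eq_measurable_fun _ _ _ _ _ (fun q => (bdist (pt q) ^+ 2) `^ (-1))).
      by move=> q _; rewrite powR_inv1 ?sqr_ge0.
    apply: (measurableT_comp (@measurable_powR R (-1))); apply: measurable_funX.
    exact: measurable_funTS measurable_bdist.
  have q0 q : (0 <= ((bdist (pt q) ^+ 2)^-1)%:E)%E by rewrite lee_fin invr_ge0 sqr_ge0.
  apply: (@le_trans _ _ (\int[area]_(q in U) ((bdist (pt q) ^+ 2)^-1)%:E)%E); last first.
    apply: ge0_subset_integral => //; last exact/measurable_EFinP.
    by apply: bigsetU_measurable.
  rewrite /U ge0_integral_bigsetU//; [|exact: iota_uniq|]; last first.
    by apply/measurable_EFinP; apply: measurable_funS mb.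
  apply: (@le_trans _ _ (\sum_(i <- index_iota 0 n) (pi^-1 / 256)%:E)%E); last exact: lee_sum.
  rewrite sumEFin lee_fin big_const_seq count_predT size_iota subn0 iter_addr_0.
  by rewrite mulr_natl.
have y0 : 0 < (pi : R)^-1 / 256 by rewrite divr_gt0.
case: (intE _ _ _) sum => [x sum|//|/(_ 0%N)]; last by rewrite leeNy_eq.
have x0 : 0 <= x / (pi^-1 / 256).
  by rewrite divr_ge0 ?(ltW y0)//; have := sum 0%N; rewrite mul0r lee_fin.
have := sum (Num.bound (x / (pi^-1 / 256))).
by rewrite lee_fin leNgt -ltr_pdivrMr// archi_boundP.
Qed.

End hyperbolic_geometry.

(** * The two implications between the Schatten condition and the integral condition *)

Section schatten_classes.
Context {R : realType}.
Local Notation C := (Cplx R).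
Local Notation D := (pt @^-1` (disk : set C)).
Implicit Types (z w : C) (f g : C -> C).
Variable u : C -> R.
Hypothesis hu : is_weight u.
Variable p : R.
Hypotheses (hp : 1 < p) (huB : Bp p u) (huC1 : condC1 u).
Variable K : C -> C -> C.
Hypothesis hK : reproducing_kernel u K.
Variable r : R.
Hypotheses (r0 : 0 < r) (r1 : r < 1).
Variable h : R -> R.
Hypothesis h_ge0 : forall x, 0 <= x -> 0 <= h x.
Hypothesis h_incr : {in `[0, +oo[ &, {homo h : x y / x <= y}}.
Hypothesis h_conv : convex_function (`[0, +oo[%classic : set R^o) h.
Variable mu : {measure set (plane R) -> \bar R}.
Hypothesis hmu : (mu D < +oo)%E.
Hypothesis hTdef : toeplitz_defined u K mu.
Local Notation ip := (A2ip u).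
Local Notation n2 f := (complex.Re (A2ip u f f)).
Local Notation T := (toeplitz K mu).
Local Notation V := (local_mass u).
Local Notation beta := (berezin2 u K mu).
Local Notation U z := (intR area (pseudohyp_disk z r) u).
Hypothesis hTcomp : compact_op (A2 u) ip T.

Let ipP := A2_psd hu.
Let ipH := ipP.1.
Let ipD := A2_definite hu huC1.
Let TP := toeplitz_psd hu huC1 hK hTdef hTcomp.
Let mD := @measurable_disk R.
Let T_lin := hTcomp.1.
Let u0 z : disk z -> 0 < u z. Proof. by case: hu => v _ _ /v. Qed.
Let V0 z : disk z -> 0 < V z. Proof. exact: local_mass_gt0. Qed.
Let mu_u : measurable_fun D (u \o pt). Proof. by case: hu. Qed.
Let k0 z : disk z -> 0 < knorm u K z.
Proof. by move=> Dz; exact: (knorm_gt0 hu huC1 hK hp huB). Qed.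
Let b0 z : 0 <= beta z. Proof. exact: berezin2_ge0. Qed.

Let h_le x y : 0 <= x -> x <= y -> h x <= h y.
Proof.
move=> x0 xy; apply: h_incr => //; rewrite in_itv /= andbT //.
exact: le_trans xy.
Qed.

Lemma bounded_below_series (a : nat -> R) (d : R) : 0 < d -> (forall n, d <= a n) ->
  (\sum_(0 <= n <oo) (a n)%:E = +oo)%E.
Proof.
move=> d0 da.
have a0 n : (0 <= n)%N -> true -> (0 <= (a n)%:E)%E.
  by move=> _ _; rewrite lee_fin (le_trans (ltW d0)).
have sum N : ((N%:R * d)%:E <= \sum_(0 <= n <oo) (a n)%:E)%E.
  apply: le_trans _ (nneseries_lim_ge N a0); rewrite sumEFin lee_fin.
  have -> : N%:R * d = \sum_(0 <= i < N) d.
    by rewrite big_const_seq count_predT size_iota subn0 iter_addr_0 mulr_natl.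
  exact: ler_sum.
case: (limn _) sum => [x sum|//|/(_ 0%N)]; last by rewrite leeNy_eq.
have x0 : 0 <= x / d.
  by rewrite divr_ge0 ?(ltW d0)//; have := sum 0%N; rewrite mul0r lee_fin.
have := sum (Num.bound (x / d)).
by rewrite lee_fin leNgt -ltr_pdivrMr// archi_boundP.
Qed.

Let h00 : ~ (0 < h 0) -> h 0 = 0.
Proof. by move/negP; rewrite -leNgt => h1; apply/eqP; rewrite eq_le h1 h_ge0. Qed.

(* Jensen's inequality for the weights |<k_z, e_n>|^2, whose sum is at most 1. *)
Lemma berezin2_jensen s e c z : h 0 = 0 -> eigenlist (A2 u) ip T s e ->
  eigenlist_complete (A2 u) T s e -> 0 < c -> disk z ->
  ((h (c * beta z))%:E <= \sum_(0 <= n <oo)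
     (weight_on ip s e (K^~ z) n / knorm u K z * h (c * s n))%:E)%E.
Proof.
move=> h0 es ec c0 Dz; have Az := kernel_A2 hK Dz; have kz := k0 Dz.
pose x := c * beta z; have x0 : 0 <= x by rewrite mulr_ge0// ltW.
have [m m0 hm] := convex_supporting_line h_incr h_conv x0.
pose w n := weight_on ip s e (K^~ z) n / knorm u K z.
have w0 n : 0 <= w n by rewrite divr_ge0 ?weight_on_ge0// ltW.
have s0 n : 0 <= s n by exact: (el_ge0 es).
(* Truncated form of the inequality: the error m c s_N is made small at the end by the choice of
   N. *)
have key N : h x <= \sum_(0 <= n < N) w n * h (c * s n) + m * (c * s N).
  have form : beta z <= \sum_(0 <= n < N) s n * w n + s N.
    rewrite (berezin2E hu hK hTdef hTcomp Dz)// ler_pdivrMr//.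
    apply: (le_trans (eigenlist_form_le ipP ipD TP hTcomp N es ec Az)).
    rewrite mulrDl; apply: lerD => //; rewrite mulr_suml le_eqVlt; apply/orP; left; apply/eqP.
    by apply: eq_bigr => n _; rewrite /w -mulrA mulfVK// gt_eqF.
  have bes : \sum_(0 <= n < N) w n <= 1.
    rewrite /w -mulr_suml ler_pdivrMr// mul1r.
    exact: (bessel ipP TP hTcomp N es Az).
  have jen : \sum_(0 <= n < N) w n * (h x + m * (c * s n)) <=
             \sum_(0 <= n < N) w n * (h (c * s n) + m * x).
    by apply: ler_sum => n _; rewrite ler_wpM2l//; apply: hm; rewrite mulr_ge0// ltW.
  have e1 : \sum_(0 <= n < N) w n * (h x + m * (c * s n)) =
      h x * (\sum_(0 <= n < N) w n) + m * c * (\sum_(0 <= n < N) s n * w n).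
    by rewrite !mulr_sumr -big_split /=; apply: eq_bigr => n _; ring.
  have e2 : \sum_(0 <= n < N) w n * (h (c * s n) + m * x) =
      \sum_(0 <= n < N) w n * h (c * s n) + m * x * (\sum_(0 <= n < N) w n).
    by rewrite mulr_sumr -big_split /=; apply: eq_bigr => n _; ring.
  rewrite e1 e2 in jen.
  (* By h(0) = 0 the supporting line gives h(x) <= m x, so the missing weight 1 - sum w_n
     contributes with the right sign. *)
  have at0 := hm 0 (lexx _); rewrite h0 mulr0 addr0 add0r in at0.
  have f1 : m * x <= m * (c * (\sum_(0 <= n < N) s n * w n + s N)).
    by rewrite ler_wpM2l// /x ler_wpM2l// ltW.
  have f2 : (h x - m * x) * (1 - \sum_(0 <= n < N) w n) <= 0.
    by rewrite mulr_le0_ge0 ?subr_ge0// subr_le0.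
  move: (\sum_(0 <= n < N) w n) (\sum_(0 <= n < N) s n * w n)
    (\sum_(0 <= n < N) w n * h (c * s n)) jen f1 f2 => P Q S.
  move: (h x) => a jen f1 f2; nra.
apply/lee_addgt0Pr => eps eps0.
have mc0 : 0 < m * c + 1 by rewrite ltr_wpDl// mulr_ge0// ltW.
have [N sN] := eigenlist_cvg0 ipP hTcomp es (divr_gt0 eps0 mc0).
have F0 n : (0 <= n)%N -> true -> (0 <= (w n * h (c * s n))%:E)%E.
  by move=> _ _; rewrite lee_fin mulr_ge0// h_ge0// mulr_ge0// ltW.
apply: le_trans _ (leeD2r _ (nneseries_lim_ge N F0)).
rewrite sumEFin -EFinD lee_fin; apply: (le_trans (key N)); rewrite lerD2l.
move: sN; rewrite ltr_pdivlMr//; have := s0 N; move: (s N) => t t0.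
by rewrite mulrDr mulr1 mulrA [t * _]mulrC; lra.
Qed.

Lemma eigenvector_mass s e n : eigenlist (A2 u) ip T s e -> 0 < s n ->
  A2 u (e n) /\ n2 (e n) = 1.
Proof.
move=> es sn; split; first exact: (el_H es).
by rewrite (el_orth es)// eqxx.
Qed.

Lemma weight_on_kernel s e z n : eigenlist (A2 u) ip T s e -> disk z ->
  weight_on ip s e (K^~ z) n = if 0 < s n then normc (e n z) ^+ 2 else 0.
Proof.
move=> es Dz; rewrite /weight_on; case: ifP => // sn.
have Ae := el_H es sn.
by rewrite (kernel_eval hK Ae Dz) (hf_conj ipH Ae (kernel_A2 hK Dz)) normc_conj.
Qed.

Let mmass f : A2 u f -> measurable_fun D (fun q => (normc (f (pt q)) ^+ 2 * u (pt q))%:E).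
Proof.
by move=> Af; apply/measurable_EFinP; apply: measurable_mass => // z Dz; exact: (A2_econt Af Dz).
Qed.

Let mass0 f z : disk z -> 0 <= normc (f z) ^+ 2 * u z.
Proof. by move=> Dz; rewrite mulr_ge0 ?sqr_ge0// ltW// u0. Qed.

(** Jensen's inequality for beta(z) is integrated against u / U. Since U >= c1 V and K(z, z) >= k /
    V, the factor 1 / (U K) is bounded by 1 / (k c1), and each |e_n|^2 u has integral 1. The
    constant c of the Schatten condition is kept. *)
Lemma schatten_berezin2 : schatten_h h (A2 u) ip T -> exists2 c : R, 0 < c &
  (intE area disk (fun z => h (c * beta z) * (U z)^-1 * u z)%R < +oo)%E.
Proof.
move=> [s sv [c c0 sum]]; exists c => //.
have [e es ec] := singular_values_eigenlist ipP ipD TP hTcomp sv.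
have s0 n : 0 <= s n by exact: (el_ge0 es).
have cs0 n : 0 <= c * s n by rewrite mulr_ge0// ltW.
have h0 : h 0 = 0.
  apply: h00 => hpos; move: sum; rewrite (@bounded_below_series _ (h 0))// => n.
  exact: h_le.
have [c1 [c2 [c10 _ hU]]] := pseudohyp_mass hu huC1 r0 r1.
have [k kp hk] := knorm_ge hu huC1 hK hp huB.
pose G n (q : plane R) := if 0 < s n then
  (((k * c1)^-1 * h (c * s n))%:E * (normc (e n (pt q)) ^+ 2 * u (pt q))%:E)%E else 0%E.
have kc0 : 0 < (k * c1)^-1 by rewrite invr_gt0 mulr_gt0.
have cst0 n : (0 <= ((k * c1)^-1 * h (c * s n))%:E)%E.
  by rewrite lee_fin mulr_ge0 ?h_ge0// ltW.
have G0 n q : D q -> (0 <= G n q)%E.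
  by move=> Dq; rewrite /G; case: ifP => // _; rewrite mule_ge0// lee_fin mass0.
have mG n : measurable_fun D (G n).
  have [sn|sn] := boolP (0 < s n); rewrite /G ?sn ?(negbTE sn)//.
  by apply: measurable_funeM; apply: mmass; exact: (el_H es).
have intG n : (\int[area]_(q in D) G n q <= ((k * c1)^-1 * h (c * s n))%:E)%E.
  have [sn|sn] := boolP (0 < s n); rewrite /G ?sn ?(negbTE sn); last by rewrite integral0.
  have [Ae ne] := eigenvector_mass es sn.
  rewrite ge0_integralZl//; [|exact: mmass|by move=> q Dq; rewrite lee_fin mass0].
  by have := A2_massE hu Ae; rewrite /mass /intE ne => ->; rewrite mule1.
apply: (@le_lt_trans _ _ (\int[area]_(q in D) \sum_(0 <= n <oo) G n q)%E).
  apply: ge0_le_integral_in => q Dq.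
    have /andP[lo _] := hU _ Dq.
    rewrite lee_fin mulr_ge0 ?(ltW (u0 Dq))// mulr_ge0 ?h_ge0 ?mulr_ge0 ?(ltW c0)//.
    by rewrite invr_ge0 (le_trans _ lo)// mulr_ge0 ?(ltW c10)// ltW// V0.
  have /andP[lo _] := hU _ Dq.
  have U0 : 0 < U (pt q) by apply: lt_le_trans lo; rewrite mulr_gt0// V0.
  have x0 : 0 <= (U (pt q))^-1 * u (pt q) by rewrite mulr_ge0 ?invr_ge0 ?(ltW U0)// ltW// u0.
  have -> : h (c * beta (pt q)) * (U (pt q))^-1 * u (pt q) =
     ((U (pt q))^-1 * u (pt q)) * h (c * beta (pt q)) by ring.
  rewrite EFinM.
  have x0E : (0 <= ((U (pt q))^-1 * u (pt q))%:E)%E by rewrite lee_fin.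
  apply: (le_trans (lee_wpmul2l x0E (berezin2_jensen h0 es ec c0 Dq))).
  have kz := k0 Dq.
  have F0 n : 0 <= weight_on ip s e (K^~ (pt q)) n / knorm u K (pt q) * h (c * s n).
    by rewrite mulr_ge0 ?h_ge0// divr_ge0 ?weight_on_ge0// ltW.
  rewrite -nneseriesZl; last by move=> n _; rewrite lee_fin.
  apply: lee_nneseries => [n _ _|n _]; first by rewrite mule_ge0// lee_fin.
  rewrite (weight_on_kernel _ es Dq) /G; case: ifP => sn; last by rewrite !mul0r mule0.
  rewrite -!EFinM lee_fin.
  have -> : (U (pt q))^-1 * u (pt q) * (normc (e n (pt q)) ^+ 2 / knorm u K (pt q) * h (c * s n)) =
    ((U (pt q))^-1 / knorm u K (pt q)) * (h (c * s n) * (normc (e n (pt q)) ^+ 2 * u (pt q))).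
    by ring.
  rewrite -[leRHS]mulrA ler_wpM2r//; first by rewrite mulr_ge0 ?h_ge0// mass0.
  rewrite -invfM lef_pV2 ?posrE ?mulr_gt0//.
  have := hk _ Dq; rewrite ler_pdivrMr ?V0// => kV.
  apply: (@le_trans _ _ (c1 * (knorm u K (pt q) * V (pt q)))).
    by rewrite mulrC ler_pM2l.
  by rewrite mulrCA [leRHS]mulrC ler_pM2l.
rewrite integral_nneseries//.
apply: (@le_lt_trans _ _ (\sum_(0 <= n <oo) ((k * c1)^-1 * h (c * s n))%:E)%E).
  by apply: lee_nneseries => // n _ _; apply: integral_ge0 => q Dq; exact: G0.
under eq_eseriesr do rewrite EFinM.
rewrite nneseriesZl; last by move=> n _; rewrite lee_fin h_ge0.
by rewrite lte_mul_pinfty// lee_fin ltW.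
Qed.

(** h is monotone only on [0, +oo); composed with max(0, .) it is monotone on the whole line, hence
    Borel. *)
Let measurable_h_berezin2 c : 0 < c -> measurable_fun D (fun q => h (c * beta (pt q))).
Proof.
move=> c0; apply: (@eq_measurable_fun _ _ _ _ _ (fun q => h (Num.max 0 (c * beta (pt q))))).
  by move=> q _; rewrite max_r// mulr_ge0// ltW.
have mh : measurable_fun setT (fun x : R => h (Num.max 0 x)).
  apply: nondecreasing_measurable => // x y xy; apply: h_le.
    by rewrite le_max lexx.
  by rewrite ge_max !le_max lexx xy orbT.
apply: (measurableT_comp mh); apply: measurable_funM => //.
exact: (measurable_berezin2 hu huC1 hK hTdef hTcomp hp huB).
Qed.

Let measurable_hyperbolic : measurable_fun D (fun q : plane R => (bdist (pt q) ^+ 2)^-1).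
Proof.
apply: (@eq_measurable_fun _ _ _ _ _ (fun q => (bdist (pt q) ^+ 2) `^ (-1))).
  by move=> q _; rewrite powR_inv1 ?sqr_ge0.
apply: (measurableT_comp (@measurable_powR R (-1))); apply: measurable_funX.
exact: (measurable_funTS (@measurable_bdist R)).
Qed.

Let J c (f : C -> C) :=
  intE area disk (fun z => h (c * beta z) * (normc (f z) ^+ 2 * u z))%R.

Let hJ0 c f z : 0 < c -> disk z -> 0 <= h (c * beta z) * (normc (f z) ^+ 2 * u z).
Proof. by move=> c0 Dz; rewrite mulr_ge0 ?mass0// h_ge0// mulr_ge0// ltW. Qed.

(* Jensen's inequality for the probability measure |f|^2 u dA. *)
Lemma form_jensen : exists2 c', 0 < c' & forall c f t, 0 < c -> A2 u f -> n2 f = 1 ->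
  0 <= t -> t <= complex.Re (ip (T f) f) -> ((h (c' * c * t))%:E <= J c f)%E.
Proof.
have [M M0 hM] := berezin2_bounded hu huC1 hK hTdef hTcomp.
have [c1 c10 hc1] := toeplitz_form_le hu huC1 hK hmu hTdef hTcomp hp huB.
(* With I the integral of beta |f|^2 u, t <= <T f, f> <= c1 I; dividing by c1 and using that h
   increases reduces the claim to h(c I). *)
exists c1^-1 => [|c f t c0 Af nf t0 tT]; first by rewrite invr_gt0.
have mf := mmass Af.
have massf (k : R) : 0 <= k ->
    (\int[area]_(q in D) (k * (normc (f (pt q)) ^+ 2 * u (pt q)))%:E = k%:E)%E.
  move=> kp; under eq_integral do rewrite EFinM.
  rewrite ge0_integralZl//; [|by move=> q Dq; rewrite lee_fin mass0].
  by have := A2_massE hu Af; rewrite /mass /intE nf => ->; rewrite mule1.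
have mbeta : measurable_fun D (fun q => beta (pt q)).
  exact: (measurable_berezin2 hu huC1 hK hTdef hTcomp hp huB).
have mfR : measurable_fun D (fun q => normc (f (pt q)) ^+ 2 * u (pt q)).
  by apply/measurable_EFinP.
pose I := intE area disk (fun z => (beta z * (normc (f z) ^+ 2 * u z))%R).
have I0 : (0 <= I)%E.
  by apply: integral_ge0 => q Dq; rewrite lee_fin mulr_ge0// mass0.
have IM : (I <= M%:E)%E.
  rewrite -massf//; apply: ge0_le_integral_in => q Dq; first by rewrite lee_fin mulr_ge0// mass0.
  by rewrite lee_fin ler_wpM2r ?mass0// hM// k0.
have Ifin : I \is a fin_num by rewrite ge0_fin_numE//; apply: le_lt_trans IM _; rewrite ltry.
pose y := fine I; have yE : I = y%:E by rewrite fineK.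
have y0 : 0 <= y by rewrite -lee_fin -yE.
have ty : c1^-1 * c * t <= c * y.
  have : (t%:E <= (c1 * y)%:E)%E.
    by rewrite EFinM -yE; apply: le_trans (hc1 f Af); rewrite lee_fin.
  rewrite lee_fin => h1; rewrite -mulrA mulrCA ler_wpM2l ?(ltW c0)//.
  by rewrite mulrC ler_pdivrMr// mulrC.
have x0 : 0 <= c * y by rewrite mulr_ge0// ltW.
apply: (@le_trans _ _ (h (c * y))%:E).
  by rewrite lee_fin; apply: h_le => //; rewrite !mulr_ge0 ?invr_ge0 ?(ltW c0) ?(ltW c10).
have [m m0 hm] := convex_supporting_line h_incr h_conv x0.
have mhb := measurable_h_berezin2 c0.
(* The supporting line at c I, evaluated at c beta(z), is integrated against |f|^2 u; the term m c I
   is finite and occurs on both sides, so it cancels. *)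
have int : ((h (c * y) + m * (c * y))%:E <= J c f + (m * (c * y))%:E)%E.
  apply: (@le_trans _ _ (\int[area]_(q in D)
     (h (c * y) * (normc (f (pt q)) ^+ 2 * u (pt q)) +
      m * c * (beta (pt q) * (normc (f (pt q)) ^+ 2 * u (pt q))))%:E)%E).
    under eq_integral do rewrite EFinD.
    have mc0 : 0 <= m * c by rewrite mulr_ge0// ltW.
    rewrite ge0_integralD//; first last.
    - by apply/measurable_EFinP; do 2 apply: measurable_funM => //.
    - by move=> q Dq; rewrite lee_fin mulr_ge0// mulr_ge0// mass0.
    - by apply/measurable_EFinP; apply: measurable_funM.
    - by move=> q Dq; rewrite lee_fin mulr_ge0 ?mass0// h_ge0.
    rewrite massf ?h_ge0// EFinD; apply: leeD2l.
    under eq_integral do rewrite EFinM.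
    rewrite ge0_integralZl ?lee_fin//; first last.
    - by move=> q Dq; rewrite lee_fin mulr_ge0// mass0.
    - by apply/measurable_EFinP; apply: measurable_funM.
    by rewrite -/(intE area disk (fun z => (beta z * (normc (f z) ^+ 2 * u z))%R)) -/I yE
      -EFinM mulrA.
  rewrite -massf ?mulr_ge0//; last exact: ltW.
  rewrite /J /intE -ge0_integralD//; first last.
  - by apply/measurable_EFinP; apply: measurable_funM.
  - move=> q Dq; rewrite lee_fin mulr_ge0 ?mass0//; exact: mulr_ge0 m0 (mulr_ge0 (ltW c0) y0).
  - by apply/measurable_EFinP; apply: measurable_funM.
  - by move=> q Dq; rewrite lee_fin hJ0.
  apply: ge0_le_integral_in => q Dq.
    rewrite lee_fin addr_ge0// mulr_ge0 ?mass0 ?h_ge0//; first by rewrite mulr_ge0// ltW.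
    by rewrite mulr_ge0// mass0.
  rewrite -EFinD lee_fin.
  have := hm (c * beta (pt q)); rewrite mulr_ge0 ?(ltW c0)// => /(_ isT) h1.
  have m1 := mass0 f Dq; move: (normc _ ^+ 2 * _) m1 => x x1.
  have -> : h (c * y) * x + m * c * (beta (pt q) * x) =
    (h (c * y) + m * (c * beta (pt q))) * x by ring.
  by rewrite -mulrDl ler_wpM2r.
by move: int; rewrite EFinD leeD2rE.
Qed.

(** s_n = <T e_n, e_n> enters [form_jensen]. After summation over n, Bessel's inequality for K_z and
    K(z, z) <= k / V(z) bound sum_n |e_n|^2 u by k bdist^(-2). The constant c becomes c' c. *)
Lemma berezin2_schatten : (exists2 c : R, 0 < c &
  (intE area disk (fun z => h (c * beta z) * (U z)^-1 * u z)%R < +oo)%E) ->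
  schatten_h h (A2 u) ip T.
Proof.
move=> [c c0 fin].
have [c1 [c2 [c10 c20 hU]]] := pseudohyp_mass hu huC1 r0 r1.
(* The integral for the invariant area bdist^(-2) dA, which is at most c2 times u / U dA because U
   <= c2 V. *)
pose W := intE area disk (fun z => h (c * beta z) * (bdist z ^+ 2)^-1)%R.
have hb0 z : 0 <= h (c * beta z) by rewrite h_ge0// mulr_ge0// ltW.
have q0 z : 0 <= (bdist z ^+ 2)^-1 by rewrite invr_ge0 sqr_ge0.
have mW : measurable_fun D (fun q => (h (c * beta (pt q)) * (bdist (pt q) ^+ 2)^-1)%:E).
  by apply/measurable_EFinP; apply: measurable_funM => //; exact: measurable_h_berezin2.
have Wfin : (W < +oo)%E.
  have : (c2^-1%:E * W <= intE area disk (fun z => (h (c * beta z) * (U z)^-1 * u z)%R))%E.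
    rewrite /W /intE -ge0_integralZl//; first last.
    - by rewrite lee_fin invr_ge0 ltW.
    - by move=> q _; rewrite lee_fin mulr_ge0.
    apply: ge0_le_integral_in => q Dq.
      by rewrite mule_ge0// lee_fin ?invr_ge0 ?(ltW c20)// mulr_ge0.
    have /andP[lo hi] := hU _ Dq; have Vq := V0 Dq.
    have U0 : 0 < U (pt q) by apply: lt_le_trans lo; rewrite mulr_gt0.
    rewrite -EFinM lee_fin mulrCA -[leRHS]mulrA ler_wpM2l//.
    have -> : c2^-1 * (bdist (pt q) ^+ 2)^-1 = (c2 * V (pt q))^-1 * u (pt q).
      have un : u (pt q) != 0 by rewrite gt_eqF// u0.
      have bn : bdist (pt q) != 0 by rewrite gt_eqF// bdist_gt0.
      have cn : c2 != 0 by rewrite gt_eqF.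
      by rewrite /local_mass; move: (u _) (bdist _) un bn => a b an bn; field; rewrite an bn cn.
    by rewrite ler_wpM2r ?(ltW (u0 Dq))// lef_pV2 ?posrE// mulr_gt0.
  move=> /le_lt_trans /(_ fin); case: W => [x _||//]; first exact: ltry.
  by rewrite gt0_muley ?lte_fin ?invr_gt0.
have h0 : h 0 = 0.
  apply: h00 => hpos; move: Wfin; rewrite ltNge => /negP; apply.
  apply: (@le_trans _ _ ((h 0)%:E * intE area disk (fun z : C => ((bdist z ^+ 2)^-1)%R))%E).
    by rewrite hyperbolic_area_infinite gt0_muley ?lte_fin.
  rewrite /W /intE -ge0_integralZl//; [|exact/measurable_EFinP|by move=> q _; rewrite lee_fin|by rewrite lee_fin ltW].
  apply: ge0_le_integral_in => q Dq; first by rewrite mule_ge0 ?lee_fin// ltW.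
  by rewrite -EFinM lee_fin ler_wpM2r// h_le// mulr_ge0// ltW.
have [s [e [sv es]]] := singular_values_exist ipP ipD TP hTcomp.
have s0 n : 0 <= s n by exact: (el_ge0 es).
have [c' c'0 jen] := form_jensen.
exists s => //; exists (c' * c); first exact: mulr_gt0.
have [k kp hk] := knorm_le hu huC1 hK.
pose w n (q : plane R) : R := if 0 < s n then normc (e n (pt q)) ^+ 2 * u (pt q) else 0.
have w0 n q : D q -> 0 <= w n q by move=> Dq; rewrite /w; case: ifP => // _; exact: mass0.
have mw n : measurable_fun D (w n).
  have [sn|sn] := boolP (0 < s n); rewrite /w ?sn ?(negbTE sn)//.
  by apply/measurable_EFinP; apply: mmass; exact: (el_H es).
have term n : ((h (c' * c * s n))%:E <=
    \int[area]_(q in D) (h (c * beta (pt q)) * w n q)%:E)%E.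
  have [sn|sn] := boolP (0 < s n); last first.
    have -> : s n = 0 by apply/eqP; rewrite eq_le s0 leNgt sn.
    by rewrite mulr0 h0; apply: integral_ge0 => q Dq; rewrite lee_fin mulr_ge0// w0.
  have [Ae ne] := eigenvector_mass es sn.
  rewrite /w sn; apply: jen => //; rewrite (el_eig es sn) (hf_linZ ipH)//.
  by rewrite (hf_real ipH Ae) ne mulr1.
have part N : (\sum_(0 <= n < N) (h (c' * c * s n))%:E <= k%:E * W)%E.
  apply: (@le_trans _ _ (\sum_(0 <= n < N) \int[area]_(q in D) (h (c * beta (pt q)) * w n q)%:E)%E).
    exact: lee_sum.
  rewrite -ge0_integral_sum//; first last.
  - by move=> n q Dq; rewrite lee_fin mulr_ge0// w0.
  - by move=> n; apply/measurable_EFinP; apply: measurable_funM => //; exact: measurable_h_berezin2.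
  rewrite /W /intE -ge0_integralZl//; first last.
  - by rewrite lee_fin ltW.
  - by move=> q _; rewrite lee_fin mulr_ge0.
  apply: ge0_le_integral_in => q Dq.
    by apply: sume_ge0 => n _; rewrite lee_fin mulr_ge0// w0.
  rewrite sumEFin -EFinM lee_fin -mulr_sumr mulrCA ler_wpM2l//.
  have -> : \sum_(0 <= n < N) w n q =
      (\sum_(0 <= n < N) weight_on ip s e (K^~ (pt q)) n) * u (pt q).
    rewrite mulr_suml; apply: eq_bigr => n _; rewrite (weight_on_kernel _ es Dq) /w.
    by case: ifP => // _; rewrite mul0r.
  have uq := u0 Dq.
  have bes := le_trans (bessel ipP TP hTcomp N es (kernel_A2 hK Dq)) (hk _ Dq).
  have := ler_wpM2r (ltW uq) bes.
  have -> // : k / V (pt q) * u (pt q) = k * (bdist (pt q) ^+ 2)^-1.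
  have un : u (pt q) != 0 by rewrite gt_eqF.
  have bn : bdist (pt q) != 0 by rewrite gt_eqF// bdist_gt0.
  by rewrite /local_mass; move: (u _) (bdist _) un bn => a b an bn; field; rewrite an bn.
apply: (@le_lt_trans _ _ (k%:E * W)%E); last by rewrite lte_mul_pinfty// lee_fin ltW.
apply: lime_le.
  by apply: is_cvg_nneseries => n _ _; rewrite lee_fin h_ge0// !mulr_ge0 ?(ltW c0) ?(ltW c'0).
by near=> N; exact: part.
Unshelve. all: by end_near. Qed.

End schatten_classes.

Theorem theorem1p6 (R : realType) (u : Cplx R -> R)
    (hu : is_weight u)
    (p0 : R) (hp0 : 1 < p0) (huB : Bp p0 u) (huC1 : condC1 u) (huC2 : condC2 u)
    (K : Cplx R -> Cplx R -> Cplx R) (hK : reproducing_kernel u K)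
    (r : R) (hr0 : 0 < r) (hr1 : r < 1)
    (h : R -> R) (h_ge0 : forall x, 0 <= x -> 0 <= h x)
    (h_cont : {within `[0, +oo[, continuous h})
    (h_incr : {in `[0, +oo[ &, {homo h : x y / x <= y}})
    (h_conv : convex_function (`[0, +oo[%classic : set R^o) h)
    (mu : {measure set (plane R) -> \bar R})
    (hmu : (mu (pt @^-1` disk) < +oo)%E)
    (hmuK : forall z, disk z ->
       (intE mu disk (fun w => normc (K w z) ^+ 2)%R < +oo)%E)
    (hTdef : toeplitz_defined u K mu)
    (hTcomp : compact_op (A2 u) (A2ip u) (toeplitz K mu)) :
  schatten_h h (A2 u) (A2ip u) (toeplitz K mu) <->
  exists2 c : R, 0 < c &
    (intE area disk (fun z =>
       h (c * berezin2 u K mu z) * (intR area (pseudohyp_disk z r) u)^-1 * u z)%R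
     < +oo)%E.
Proof.
split.
  exact: (schatten_berezin2 hu hp0 huB huC1 hK hr0 hr1 h_ge0 h_incr h_conv hTdef hTcomp).
exact: (berezin2_schatten hu hp0 huB huC1 hK hr0 hr1 h_ge0 h_incr h_conv hmu hTdef hTcomp).
Qed.
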